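(* Let $f\colon M\to\mathbb{S}^n$ be a compact substantial minimal surface (i.e. $M$ is compact). If $f$ is isometric to an isotropic pseudoholomorphic curve $g\colon M \to\mathbb{S}^6$, then $n=6$ and $f$ is congruent to $g$.
   Context: Surfaces. $M$ is a connected oriented $2$-dimensional Riemannian manifold (Riemann surface) with complex structure $J$. A minimal surface $f\colon M\to\mathbb{S}^n$ is a minimal isometric immersion into the unit sphere. It is substantial if $f(M)$ is not contained in any proper totally geodesic submanifold (subsphere) of $\mathbb{S}^n$. Two surfaces are congruent if they differ by an isometry of the ambient sphere. Pseudoholomorphic curves. $\mathbb{S}^6$ is the unit sphere in the imaginary Cayley numbers $\mathbb{R}^7=\mathrm{Im}\,\mathbb{O}$, with the nearly Kähler almost complex structure induced by Cayley multiplication ($v\mapsto p\cdot v$ on $T_p\mathbb{S}^6$). A pseudoholomorphic curve is a nonconstant smooth map $g\colon M\to\mathbb{S}^6$ from a Riemann surface whose differential is complex linear. $M$ carries the metric induced by $g$, and $g$ is regarded as an isometric immersion. A surface $f\colon M\to\mathbb{S}^n$ is isometric to $g$ if $f$ and $g$ induce the same Riemannian metric on $M$. Isotropy. Let $\alpha^f$ be the second fundamental form and $\nabla^\perp$ the normal connection. Put $\alpha^f_2=\alpha^f$ and, for $s\ge3$, $\alpha^f_s(X_1,\dots,X_s)=(\nabla^\perp_{X_s}\cdots\nabla^\perp_{X_3}\alpha^f(X_2,X_1))^\perp$, where $(\cdot)^\perp$ is projection onto the orthogonal complement of $N_1^f\oplus\cdots\oplus N_{s-2}^f$ in the normal bundle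 and $N^f_k$ is the span of the values of $\alpha^f_{k+1}$. The $r$-th curvature ellipse at $p$ is $\mathcal{E}^f_r(p)=\{\alpha^f_{r+1}(Z^\varphi,\dots,Z^\varphi): Z^\varphi=\cos\varphi Z+\sin\varphi JZ,\ \varphi\in[0,2\pi)\}\subset N_r^f(p)$, $Z$ a unit tangent vector. The surface is regular where the $N_k^f$ have locally constant dimension (an open dense set). A substantial minimal surface is $s$-isotropic if, at regular points, $\mathcal{E}^f_r$ is a circle for all $1\le r\le s$, and isotropic if this holds for all $s$. In particular an isotropic pseudoholomorphic curve $g\colon M\to\mathbb{S}^6$ is substantial in $\mathbb{S}^6$ with first and second curvature ellipses circles. *)

(* Defs.v *)
From mathcomp Require Export all_boot all_order all_algebra.
From mathcomp Require Export all_classical all_reals all_analysis.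
Export Order.TTheory GRing.Theory Num.Theory numFieldNormedType.Exports.

Set Implicit Arguments.
Unset Strict Implicit.
Unset Printing Implicit Defensive.

Local Open Scope classical_set_scope.
Local Open Scope ring_scope.

(** * Riemann surfaces *)

(* The complex line, as the real plane. *)
Notation plane R := (R * R)%type.

(* Multiplication by the imaginary unit. *)
Definition rotJ (R : realType) (v : plane R) : plane R := (- v.2, v.1).

Definition holomorphic_on (R : realType) (A : set (plane R))
    (T : plane R -> plane R) : Prop :=
  forall z, A z -> differentiable T z /\
    forall v, 'D_(rotJ v) T z = rotJ ('D_v T z).

(* [chart_map] is a homeomorphism from the open set [chart_dom] onto the open
   set [chart_cod], with inverse [chart_inv]; outside these sets the values of
   the two functions are irrelevant. *)
Record chart (R : realType) (M : topologicalType) := Chart {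
  chart_dom : set M;
  chart_cod : set (plane R);
  chart_map : M -> plane R;
  chart_inv : plane R -> M;
  chart_dom_open : open chart_dom;
  chart_cod_open : open chart_cod;
  chart_map_cod : forall p, chart_dom p -> chart_cod (chart_map p);
  chart_inv_dom : forall z, chart_cod z -> chart_dom (chart_inv z);
  chart_mapK : forall p, chart_dom p -> chart_inv (chart_map p) = p;
  chart_invK : forall z, chart_cod z -> chart_map (chart_inv z) = z;
  chart_map_cont : {within chart_dom, continuous chart_map};
  chart_inv_cont : {within chart_cod, continuous chart_inv}
}.

Record riemann_surface (R : realType) (M : topologicalType) := RiemannSurface {
  atlas : set (chart R M);
  atlas_cover : forall p : M, exists2 c, atlas c & chart_dom c p;
  atlas_holomorphic : forall c d, atlas c -> atlas d ->
    holomorphic_on (chart_cod c `&` chart_inv c @^-1` chart_dom d)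
                   (chart_map d \o chart_inv c);
  surface_hausdorff : hausdorff_space M;
  surface_second_countable : @second_countable M;
  surface_connected : connected [set: M]
}.

(* Iterated directional derivatives of every order exist and are
   differentiable: this is the class C^oo when [A] is open. *)
Definition smooth_on (R : realType) (m : nat) (A : set (plane R))
    (F : plane R -> 'rV[R]_m.+1) : Prop :=
  forall (vs : seq (plane R)) z, A z ->
    differentiable (foldr (fun v G => 'D_v G) F vs) z.

(** * Local geometry of a surface in the unit sphere *)

(* [F : plane R -> 'rV[R]_n.+1] is the expression in a chart of a surface in
   the unit sphere of R^(n+1).  A tangent vector is given by its components in
   the chart, and is extended to the vector field having constant components.
   Subspaces of R^(n+1) are row spaces of matrices. *)

Definition dot (R : realType) (m : nat) (u v : 'rV[R]_m) : R :=
  \sum_(i < m) u 0 i * v 0 i.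

(* Orthogonal projection of [v] onto the orthogonal complement of the row
   space of [A]. *)
Definition orth_proj (R : realType) (m k : nat) (A : 'M[R]_(k, m))
    (v : 'rV[R]_m) : 'rV[R]_m :=
  v *m proj_mx (kermx A^T) <<A>>%MS.

Definition induced_metric (R : realType) (n : nat)
    (F : plane R -> 'rV[R]_n.+1) (z v w : plane R) : R :=
  dot ('D_v F z) ('D_w F z).

(* The space spanned by the position vector and the tangent plane; its
   orthogonal complement is the normal space of the surface in the sphere. *)
Definition pos_tangent (R : realType) (n : nat)
    (F : plane R -> 'rV[R]_n.+1) (z : plane R) : 'M[R]_n.+1 :=
  (F z + 'D_((1, 0) : plane R) F z + 'D_((0, 1) : plane R) F z)%MS.

(* alpha(v, w) *)
Definition second_ff (R : realType) (n : nat) (F : plane R -> 'rV[R]_n.+1)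
    (v w : plane R) : plane R -> 'rV[R]_n.+1 :=
  fun z => orth_proj (pos_tangent F z) ('D_v ('D_w F) z).

Definition normal_connection (R : realType) (n : nat)
    (F : plane R -> 'rV[R]_n.+1) (v : plane R)
    (xi : plane R -> 'rV[R]_n.+1) : plane R -> 'rV[R]_n.+1 :=
  fun z => orth_proj (pos_tangent F z) ('D_v xi z).

(* For [vs = [:: X_1; ...; X_s]], the normal field
   nabla_{X_s} ... nabla_{X_3} alpha(X_2, X_1). *)
Definition nabla_second_ff (R : realType) (n : nat)
    (F : plane R -> 'rV[R]_n.+1) (vs : seq (plane R)) :
    plane R -> 'rV[R]_n.+1 :=
  if vs is X1 :: X2 :: us
  then foldl (fun xi X => normal_connection F X xi) (second_ff F X2 X1) us
  else fun=> 0.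

(* Components of the [i]-th coordinate vector field. *)
Definition coord_field (R : realType) (i : 'I_2) : plane R :=
  if i == 0 then (1, 0) else (0, 1).

(* N_1 + ... + N_k.  By multilinearity, N_j is spanned by the values of
   alpha_{j+1} on tuples of coordinate vector fields. *)
Fixpoint normal_flag (R : realType) (n : nat) (F : plane R -> 'rV[R]_n.+1)
    (k : nat) (z : plane R) : 'M[R]_n.+1 :=
  if k is j.+1 then
    let W := normal_flag F j z in
    (W + \sum_(t : j.+2.-tuple 'I_2)
           <<orth_proj W
               (nabla_second_ff F [seq coord_field R i | i <- t] z)>>)%MS
  else 0.

(* alpha_s(X_1, ..., X_s) for [vs = [:: X_1; ...; X_s]], s >= 2.  The value
   depends only on the vectors X_i at [z]: another choice of extensions changes
   the iterated normal derivative by an element of N_1 + ... + N_{s-2}. *)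
Definition higher_ff (R : realType) (n : nat) (F : plane R -> 'rV[R]_n.+1)
    (vs : seq (plane R)) (z : plane R) : 'rV[R]_n.+1 :=
  orth_proj (normal_flag F (size vs - 2) z) (nabla_second_ff F vs z).

(* N_k, for k >= 1 *)
Definition normal_space (R : realType) (n : nat) (F : plane R -> 'rV[R]_n.+1)
    (k : nat) (z : plane R) : 'M[R]_n.+1 :=
  (\sum_(t : k.+1.-tuple 'I_2)
      <<higher_ff F [seq coord_field R i | i <- t] z>>)%MS.

Definition regular_at (R : realType) (n : nat) (F : plane R -> 'rV[R]_n.+1)
    (z : plane R) : Prop :=
  forall k, (1 <= k)%N ->
    \forall y \near z,
      \rank (normal_space F k y) = \rank (normal_space F k z).

(* The [r]-th curvature ellipse, parametrized from the unit vector [Z]. *)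
Definition curvature_ellipse (R : realType) (n : nat)
    (F : plane R -> 'rV[R]_n.+1) (r : nat) (z Z : plane R) :
    set 'rV[R]_n.+1 :=
  [set higher_ff F (nseq r.+1 (cos phi *: Z + sin phi *: rotJ Z)) z
     | phi in [set phi : R | 0 <= phi < 2 * pi]].

Definition is_circle (R : realType) (m : nat) (E : set 'rV[R]_m) : Prop :=
  exists (c u v : 'rV[R]_m) (rho : R),
    [/\ 0 < rho, dot u u = 1, dot v v = 1, dot u v = 0 &
        E = [set c + rho *: (cos t *: u + sin t *: v) | t in [set: R]]].

(** * Surfaces in spheres *)

Definition in_chart (R : realType) (M : topologicalType) (n : nat)
    (f : M -> 'rV[R]_n.+1) (c : chart R M) : plane R -> 'rV[R]_n.+1 :=
  f \o chart_inv c.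

Definition smooth_sphere_map (R : realType) (M : topologicalType)
    (X : riemann_surface R M) (n : nat) (f : M -> 'rV[R]_n.+1) : Prop :=
  (forall p, dot (f p) (f p) = 1) /\
  (forall c, atlas X c -> smooth_on (chart_cod c) (in_chart f c)).

Definition immersed (R : realType) (M : topologicalType)
    (X : riemann_surface R M) (n : nat) (f : M -> 'rV[R]_n.+1) : Prop :=
  forall c z, atlas X c -> chart_cod c z ->
    forall v, v != 0 -> 'D_v (in_chart f c) z != 0.

(* The mean curvature vector, half the trace of the second fundamental form
   with respect to the induced metric, vanishes. *)
Definition zero_mean_curvature (R : realType) (M : topologicalType)
    (X : riemann_surface R M) (n : nat) (f : M -> 'rV[R]_n.+1) : Prop :=
  forall c z, atlas X c -> chart_cod c z ->
    let F := in_chart f c in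
    forall v w, induced_metric F z v v = 1 -> induced_metric F z w w = 1 ->
      induced_metric F z v w = 0 ->
      second_ff F v v z + second_ff F w w z = 0.

Definition minimal_surface (R : realType) (M : topologicalType)
    (X : riemann_surface R M) (n : nat) (f : M -> 'rV[R]_n.+1) : Prop :=
  [/\ smooth_sphere_map X f, immersed X f & zero_mean_curvature X f].

(* The totally geodesic subspheres are the intersections of the sphere with
   linear subspaces. *)
Definition substantial (R : realType) (M : topologicalType) (n : nat)
    (f : M -> 'rV[R]_n.+1) : Prop :=
  ~ exists2 W : 'M[R]_n.+1, (\rank W < n.+1)%N & forall p, (f p <= W)%MS.

Definition isometric (R : realType) (M : topologicalType)
    (X : riemann_surface R M) (n m : nat)
    (f : M -> 'rV[R]_n.+1) (g : M -> 'rV[R]_m.+1) : Prop :=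
  forall c z, atlas X c -> chart_cod c z -> forall v w,
    induced_metric (in_chart f c) z v w = induced_metric (in_chart g c) z v w.

(* The isometries of the unit sphere are the restrictions of the orthogonal
   transformations of the ambient Euclidean space. *)
Definition congruent (R : realType) (M : topologicalType) (n : nat)
    (f g : M -> 'rV[R]_n.+1) : Prop :=
  exists2 Q : 'M[R]_n.+1, Q *m Q^T = 1%:M & forall p, f p = g p *m Q.

Definition s_isotropic (R : realType) (M : topologicalType)
    (X : riemann_surface R M) (n : nat) (s : nat)
    (f : M -> 'rV[R]_n.+1) : Prop :=
  [/\ substantial f, minimal_surface X f &
    forall r, (1 <= r <= s)%N ->
    forall c z, atlas X c -> chart_cod c z ->
      let F := in_chart f c in
      regular_at F z ->
      forall Z, induced_metric F z Z Z = 1 ->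
        is_circle (curvature_ellipse F r z Z)].

(* In the n-sphere the normal bundle has rank n - 2 and at most
   floor((n - 1) / 2) of the N_k are nonzero at regular points, so that the
   index s ranges up to this number; beyond it the curvature ellipses reduce to
   the origin.  In the 6-sphere, r = 1 and r = 2 are the relevant indices. *)
Definition isotropic (R : realType) (M : topologicalType)
    (X : riemann_surface R M) (n : nat) (f : M -> 'rV[R]_n.+1) : Prop :=
  forall s, (s <= n.-1./2)%N -> s_isotropic X s f.

(** * Cayley numbers and pseudoholomorphic curves *)

(* The product of the imaginary units is e_i e_{i+1} = e_{i+3}, with indices
   modulo 7, together with its cyclic permutations and antisymmetry; [cross] is
   the imaginary part of the product of imaginary Cayley numbers.  The index
   arithmetic below takes place in 'I_7, i.e. modulo 7. *)
Definition cross (R : realType) (u v : 'rV[R]_7) : 'rV[R]_7 :=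
  \row_(k < 7)
    ((u 0 (k + 1) * v 0 (k + 3) - u 0 (k + 3) * v 0 (k + 1))
   + (u 0 (k + 2) * v 0 (k + 6) - u 0 (k + 6) * v 0 (k + 2))
   + (u 0 (k + 4) * v 0 (k + 5) - u 0 (k + 5) * v 0 (k + 4))).

(* A Cayley number is the pair of its real and imaginary parts. *)
Definition cayley_mul (R : realType) (x y : R * 'rV[R]_7) : R * 'rV[R]_7 :=
  (x.1 * y.1 - dot x.2 y.2, x.1 *: y.2 + y.1 *: x.2 + cross x.2 y.2).

Definition cayley_im (R : realType) (u : 'rV[R]_7) : R * 'rV[R]_7 := (0, u).

Definition pseudoholomorphic_curve (R : realType) (M : topologicalType)
    (X : riemann_surface R M) (g : M -> 'rV[R]_(6.+1)) : Prop :=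
  [/\ smooth_sphere_map X g,
      exists p q, g p <> g q &
      forall c z, atlas X c -> chart_cod c z ->
        let G := in_chart g c in
        forall v, cayley_im ('D_(rotJ v) G z)
                  = cayley_mul (cayley_im (G z)) (cayley_im ('D_v G z))].

(* Main.v *)
(* Write z for a local conformal coordinate, F = <df, conj df>, and let A and B
   be the (2,0) and (3,0) parts of the second and third fundamental forms of f.
   Then |A|^2 = k F and |B|^2 = q |A|^2, where k and q depend only on the metric,
   and the forms <A, A>, and <B, B> when <A, A> = 0, are holomorphic.

   For a pseudoholomorphic curve g the cross product with g acts on dg and A as
   i, hence <A, A> = 0, and df, A, df x A, g and their conjugates form a frame of
   C^7.  Expanding B in it gives 2 |B|^2 F |A|^2 = (F |A|^2)^2 + |<B, B>|^2.  So
   at every non-umbilic point either q = F, or <B, B> = 0 and 2q = F.  The set of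
   these points is connected and dense, because log |A|^2 is subharmonic up to a
   bounded term.  If q = F on it, then g lies in a 5-sphere; hence 2q = F.

   With 2q = F, the function log (|<A, A>|^6 / (F |A|^2)^4) of f has Laplacian a
   positive multiple of F, so that by compactness <A, A> = 0 for f as well.  Also
   dB has no component beyond the span of the frame (f, df, A, B), for f and for
   g, with structure coefficients depending only on the metric.  The matrix
   carrying the frame of g to that of f is therefore locally constant. *)

(* The frame needs 1/k, so the local calculus lives off the umbilics; two devices lead back to the
   whole surface. The invariants of f and g are normalized by powers of F alone and stay continuous
   at umbilics. Rigidity is phrased through constant linear relations: near a non-umbilic point the
   frame matrix is a constant P, and f = g P is a linear relation between the coordinates of f and
   g, which spreads over the connected set of non-umbilic points and, by density, over M. For g
   alone the same matrix is the orthogonal projector onto the span of the frame. Its trace is a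
   dimension, and this is what excludes the 5-sphere.

   In the quotient given to the maximum principle, F |A|^2 enters because dbar d log (F |A|^2) = q -
   F does not contain k. The exponents balance weights: <A, A> has weight 4 in dz, and F |A|^2 has
   weight 3 in dz and in its conjugate, so both |<A, A>|^6 and (F |A|^2)^4 have weight 12. Since
   |<A, A>| <= |A|^2, the quotient is at most (k/F)^2 and extends by zero over the umbilics. *)
Require Import Defs.
From HB Require Import structures.
From mathcomp Require Import ring lra complex.

Set Implicit Arguments.
Unset Strict Implicit.
Unset Printing Implicit Defensive.

Local Open Scope classical_set_scope.
Local Open Scope ring_scope.

(** * Calculus in a differential ring *)

(* A model of the smooth complex functions on an open subset of the plane: [dd]
   is d/dz, [cj] is complex conjugation, [ddC] says that d/dz and d/dzbar
   commute, and inverses of functions without zeros are passed as arguments. *)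
Record dring (K : comPzRingType) := DRing {
  dd : K -> K;
  cj : K -> K;
  half : K;
  ddD : forall u v, dd (u + v) = dd u + dd v;
  ddM : forall u v, dd (u * v) = dd u * v + u * dd v;
  cjD : forall u v, cj (u + v) = cj u + cj v;
  cjM : forall u v, cj (u * v) = cj u * cj v;
  cjK : involutive cj;
  ddC : forall u, dd (cj (dd (cj u))) = cj (dd (cj (dd u)));
  halfP : half + half = 1;
  cj_pos : forall m (u : 'rV[K]_m), \sum_i u 0 i * cj (u 0 i) = 0 -> u = 0
}.

Definition bdot (K : pzRingType) m (u v : 'rV[K]_m) : K := \sum_i u 0 i * v 0 i.

Section Bdot.
Variable K : comPzRingType.
Variable m : nat.
Implicit Types (u v w : 'rV[K]_m) (a : K).

Lemma bdotC u v : bdot u v = bdot v u.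
Proof. by apply: eq_bigr => i _; rewrite mulrC. Qed.

Lemma bdotDl u v w : bdot (u + v) w = bdot u w + bdot v w.
Proof. by rewrite -big_split; apply: eq_bigr => i _; rewrite mxE mulrDl. Qed.

Lemma bdotZl a u v : bdot (a *: u) v = a * bdot u v.
Proof. by rewrite mulr_sumr; apply: eq_bigr => i _; rewrite mxE mulrA. Qed.

Lemma bdotDr u v w : bdot u (v + w) = bdot u v + bdot u w.
Proof. by rewrite bdotC bdotDl !(bdotC u). Qed.

Lemma bdotZr a u v : bdot u (a *: v) = a * bdot u v.
Proof. by rewrite bdotC bdotZl bdotC. Qed.

Lemma bdotNl u v : bdot (- u) v = - bdot u v.
Proof. by rewrite -scaleN1r bdotZl mulN1r. Qed.

Lemma bdotNr u v : bdot u (- v) = - bdot u v.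
Proof. by rewrite bdotC bdotNl bdotC. Qed.

Lemma bdot0l u : bdot 0 u = 0.
Proof. by rewrite -(scale0r 0) bdotZl mul0r. Qed.

Lemma bdot0r u : bdot u 0 = 0.
Proof. by rewrite bdotC bdot0l. Qed.

Definition bdotE := (bdotDl, bdotDr, bdotNl, bdotNr, bdotZl, bdotZr).

Lemma mulmx_bdot n (u v : 'rV[K]_m) (w : 'rV[K]_n) :
  u *m (v^T *m w) = bdot u v *: w.
Proof.
rewrite mulmxA; apply/rowP => j; rewrite !mxE big_ord1 !mxE; congr (_ * _).
by apply: eq_bigr => i _; rewrite !mxE.
Qed.

End Bdot.

Section DifferentialRing.
Variables (K : comPzRingType) (S : dring K).
Local Notation d := (dd S).
Local Notation "x ^*" := (cj S x) : ring_scope.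

Definition db u := (d (u^*))^*.

Lemma dd0 : d 0 = 0.
Proof. by apply: (addrI (d 0)); rewrite -ddD !addr0. Qed.
Lemma ddN u : d (- u) = - d u.
Proof. by apply: (addrI (d u)); rewrite -ddD !subrr dd0. Qed.
Lemma dd1 : d 1 = 0.
Proof. by apply: (addrI (d 1)); rewrite addr0 -{3}[1]mulr1 ddM mulr1 mul1r. Qed.
Lemma cj0 : 0^* = 0.
Proof. by apply: (addrI (cj S 0)); rewrite -cjD !addr0. Qed.
Lemma cjN u : (- u)^* = - u^*.
Proof. by apply: (addrI (cj S u)); rewrite -cjD !subrr cj0. Qed.
Lemma cj1 : 1^* = 1.
Proof. by rewrite -[LHS]mulr1 -[X in _ * X](cjK S) -cjM mul1r cjK. Qed.
Lemma dbD u v : db (u + v) = db u + db v.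
Proof. by rewrite /db !(cjD, ddD). Qed.
Lemma dbN u : db (- u) = - db u.
Proof. by rewrite /db !(cjN, ddN). Qed.
Lemma db0 : db 0 = 0.
Proof. by rewrite /db cj0 dd0 cj0. Qed.
Lemma db1 : db 1 = 0.
Proof. by rewrite /db cj1 dd1 cj0. Qed.
Lemma dbM u v : db (u * v) = db u * v + u * db v.
Proof. by rewrite /db !(cjM, ddM, cjD) !cjK. Qed.
Lemma ddb u : d (db u) = db (d u).
Proof. exact: ddC. Qed.
Lemma cjd u : (d u)^* = db (u^*).
Proof. by rewrite /db cjK. Qed.
Lemma cj_inv (u v : K) : u * v = 1 -> u^* = u -> v^* = v.
Proof.
move=> uv hu; have : (u * v)^* = 1 by rewrite uv cj1.
rewrite cjM hu => h; by rewrite -[LHS]mul1r -uv mulrAC h mul1r.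
Qed.
Lemma d_inv (u v : K) : u * v = 1 -> d v = - d u * v * v.
Proof.
move=> uv; have := dd1; rewrite -{1}uv ddM => /eqP.
rewrite addrC addr_eq0 => /eqP h.
by rewrite -[LHS]mul1r -uv mulrAC h; ring.
Qed.
Lemma half_inj (u : K) : u + u = 0 -> u = 0.
Proof. by move=> h; rewrite -[u]mul1r -(halfP S) mulrDl -mulrDr h mulr0. Qed.

Definition vd m : 'rV[K]_m -> 'rV[K]_m := map_mx d.
Definition vb m : 'rV[K]_m -> 'rV[K]_m := map_mx db.
Definition vc m : 'rV[K]_m -> 'rV[K]_m := map_mx (cj S).

Section Vectors.
Variable m : nat.
Implicit Types (u v : 'rV[K]_m) (a : K).

Lemma vdZ a u : vd (a *: u) = d a *: u + a *: vd u.
Proof. by apply/rowP => i; rewrite !mxE ddM. Qed.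
Lemma vbD u v : vb (u + v) = vb u + vb v.
Proof. by apply/rowP => i; rewrite !mxE dbD. Qed.
Lemma vbN u : vb (- u) = - vb u.
Proof. by apply/rowP => i; rewrite !mxE dbN. Qed.
Lemma vbZ a u : vb (a *: u) = db a *: u + a *: vb u.
Proof. by apply/rowP => i; rewrite !mxE dbM. Qed.
Lemma vcD u v : vc (u + v) = vc u + vc v.
Proof. by apply/rowP => i; rewrite !mxE cjD. Qed.
Lemma vcN u : vc (- u) = - vc u.
Proof. by apply/rowP => i; rewrite !mxE cjN. Qed.
Lemma vcZ a u : vc (a *: u) = a^* *: vc u.
Proof. by apply/rowP => i; rewrite !mxE cjM. Qed.
Lemma vcK : involutive (@vc m).
Proof. by move=> u; apply/rowP => i; rewrite !mxE cjK. Qed.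
Lemma vd_vc u : vd (vc u) = vc (vb u).
Proof. by apply/rowP => i; rewrite !mxE /db cjK. Qed.
Lemma vb_vc u : vb (vc u) = vc (vd u).
Proof. by apply/rowP => i; rewrite !mxE /db cjK. Qed.
Lemma vdb u : vd (vb u) = vb (vd u).
Proof. by apply/rowP => i; rewrite !mxE ddb. Qed.
Lemma d_bdot u v : d (bdot u v) = bdot (vd u) v + bdot u (vd v).
Proof.
rewrite /bdot (big_morph d (ddD S) dd0) -big_split.
by apply: eq_bigr => i _; rewrite ddM !mxE.
Qed.
Lemma db_bdot u v : db (bdot u v) = bdot (vb u) v + bdot u (vb v).
Proof.
rewrite /bdot (big_morph db dbD db0) -big_split.
by apply: eq_bigr => i _; rewrite dbM !mxE.
Qed.
Lemma cj_bdot u v : (bdot u v)^* = bdot (vc u) (vc v).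
Proof.
rewrite /bdot (big_morph (cj S) (cjD S) cj0).
by apply: eq_bigr => i _; rewrite cjM !mxE.
Qed.
(** Positivity enters the ring calculus here: several vector equations below are proved by showing
    that the hermitian norm of the difference of the two sides is 0. *)
Lemma bdot_pos u : bdot u (vc u) = 0 -> u = 0.
Proof.
by move=> h; apply: (cj_pos (d := S)); rewrite -[RHS]h; apply: eq_bigr => i _; rewrite mxE.
Qed.

End Vectors.

(* A conformal harmonic immersion [f] into the unit sphere; [F] is the
   conformal factor <df, conj df> and [iF] its inverse. *)
Record harm m (f : 'rV[K]_m) (F iF : K) : Prop := Harm {
  harm_real : vc f = f;
  harm_norm : bdot f f = 1;
  harm_conf : bdot (vd f) (vd f) = 0;
  harm_fact : bdot (vd f) (vc (vd f)) = F;
  harm_lap : vb (vd f) = - F *: f;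
  harm_inv : F * iF = 1
}.

(* [lF] is d log F.  Up to a factor, [vA] is the (2,0) part of the second
   fundamental form, and [gauss] below says that |vA|^2 = kF * F. *)
Definition lF (F iF : K) := d F * iF.
Definition kF (F iF : K) := F + db (lF F iF).
Definition vA m (f : 'rV[K]_m) (F iF : K) :=
  locked (vd (vd f) - lF F iF *: vd f).

Section Harmonic.
Variables (m : nat) (f : 'rV[K]_m) (F iF : K).
Hypothesis H : harm f F iF.
Local Notation p := (vd f).
Local Notation l := (lF F iF).
Local Notation k := (kF F iF).
Local Notation A := (vA f F iF).

Lemma cjF : F^* = F.
Proof. by rewrite -(harm_fact H) cj_bdot vcK bdotC. Qed.
Lemma cjiF : iF^* = iF.
Proof. exact: cj_inv (harm_inv H) cjF. Qed.
Lemma dF_eq : d F = l * F.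
Proof. by rewrite /lF -mulrA (mulrC iF) (harm_inv H) mulr1. Qed.
Lemma vAE : A = vd p - l *: p.
Proof. by rewrite /vA -lock. Qed.
Lemma vdp : vd p = l *: p + A.
Proof. by rewrite vAE addrC subrK. Qed.
Lemma vcp : vc p = vb f.
Proof. by rewrite -vb_vc (harm_real H). Qed.
Lemma vdpb : vd (vc p) = - F *: f.
Proof. by rewrite vd_vc (harm_lap H) vcZ cjN cjF (harm_real H). Qed.

Lemma dot_fp : bdot f p = 0.
Proof.
apply: half_inj; rewrite -{1}bdotC -d_bdot (harm_norm H); exact: dd1.
Qed.
Lemma dot_fpb : bdot f (vc p) = 0.
Proof. by rewrite -{1}(harm_real H) -cj_bdot dot_fp cj0. Qed.
Lemma dot_pdp : bdot p (vd p) = 0.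
Proof.
apply: half_inj; rewrite -{1}bdotC -d_bdot (harm_conf H); exact: dd0.
Qed.
Lemma dot_Af : bdot f A = 0.
Proof.
have := d_bdot f p; rewrite dot_fp dd0 (harm_conf H) add0r => h.
by rewrite vAE bdotDr bdotNr bdotZr -h dot_fp; ring.
Qed.
Lemma dot_Ap : bdot p A = 0.
Proof. by rewrite vAE !bdotE dot_pdp (harm_conf H); ring. Qed.
(** The coefficient [lF] is made for this: d(conj p) = -F f is orthogonal to p, so dF = <dp, conj
    p>, and subtracting l p from dp removes exactly this product. *)
Lemma dot_Apb : bdot (vc p) A = 0.
Proof.
have := d_bdot p (vc p); rewrite vdpb (harm_fact H) bdotZr (bdotC p f) dot_fp.
rewrite mulr0 addr0 dF_eq => h.
by rewrite vAE !bdotE (bdotC _ (vd p)) -h (bdotC _ p) (harm_fact H); ring.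
Qed.
Lemma dot_Abf : bdot f (vc A) = 0.
Proof. by rewrite -{1}(harm_real H) -cj_bdot dot_Af cj0. Qed.
Lemma dot_Abpb : bdot (vc p) (vc A) = 0.
Proof. by rewrite -cj_bdot dot_Ap cj0. Qed.
Lemma dot_Abp : bdot p (vc A) = 0.
Proof. by rewrite -[p]vcK -cj_bdot dot_Apb cj0. Qed.

(** Codazzi equation. Since dbar commutes with d, dbar dp = -dF f - F p; the f-terms cancel against
    those of dbar(l p) because dF = l F. *)
Lemma vbA : vb A = - k *: p.
Proof.
have h : vb (vd p) = - d F *: f - F *: p.
  by rewrite -vdb (harm_lap H) vdZ ddN !scaleNr.
rewrite vAE vbD vbN vbZ h (harm_lap H) dF_eq /kF.
by apply/rowP => i; rewrite !mxE; ring.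
Qed.

(** Gauss equation, by moving a derivative: dbar of <A, conj p> = 0 contains <dbar A, conj p>, known
    from [vbA], and <A, conj A>, because dbar(conj p) = conj(dp) has normal part conj A. *)
Lemma gauss : bdot A (vc A) = k * F.
Proof.
have h : bdot (vb A) (vc p) = - bdot A (vc A).
  have := db_bdot A (vc p).
  rewrite (bdotC A (vc p)) dot_Apb db0 vb_vc vdp vcD vcZ !bdotE.
  rewrite (bdotC A (vc p)) dot_Apb mulr0 add0r => /esym/eqP.
  by rewrite addr_eq0 => /eqP.
by rewrite -[LHS]opprK -h vbA bdotZl (harm_fact H); ring.
Qed.

(** Not visible on F + dbar l: reality is read off from k F = <A, conj A> and the invertibility of
    F. *)
Lemma cjk : k^* = k.
Proof.
have h : (k * F)^* = k * F by rewrite -gauss cj_bdot vcK bdotC.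
have := harm_inv H; rewrite cjM cjF in h => hi.
by rewrite -[LHS]mulr1 -hi mulrA h -mulrA hi mulr1.
Qed.

(** Holomorphy of the quartic Hopf form: dbar A is a multiple of p, to which A is orthogonal. *)
Lemma dbPhi : db (bdot A A) = 0.
Proof. by rewrite db_bdot vbA bdotZl bdotZr (bdotC A) dot_Ap; ring. Qed.

Lemma db_l : db l = k - F.
Proof. by rewrite /kF addrC addKr. Qed.

Section Umbilic_free.
Variable ik : K.
Hypothesis Hk : k * ik = 1.

(* The same construction one order higher: [mF] is d log (k F), [vB] is the part
   of d^3 f orthogonal to the first osculating space, and |vB|^2 = qF * |vA|^2. *)
Definition mF := d k * ik + l.
Local Notation mm := mF.
Definition vB := locked (vd A - mF *: A).
Definition qF := k + db mF.
Local Notation q := qF.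
Local Notation B := vB.

Lemma vBE : B = vd A - mF *: A.
Proof. by rewrite /vB -lock. Qed.
Lemma dk_eq : d k = (mm - l) * k.
Proof. by rewrite /mF; ring: Hk. Qed.

Lemma vdA : vd A = mm *: A + B.
Proof. by rewrite vBE addrC subrK. Qed.

Lemma dot_dAAb : bdot (vd A) (vc A) = mm * (k * F).
Proof.
have := d_bdot A (vc A); rewrite gauss vd_vc vbA vcZ bdotZr (bdotC A) dot_Apb.
by rewrite mulr0 addr0 => <-; rewrite ddM dk_eq dF_eq; ring.
Qed.

Lemma dot_BAb : bdot B (vc A) = 0.
Proof. by rewrite vBE !bdotE dot_dAAb gauss; ring. Qed.

(** The Codazzi step one order higher: the p-terms cancel because dk = (m - l) k, and the remaining
    coefficient of A is k + dbar m = q. *)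
Lemma vbB : vb B = - q *: A.
Proof.
rewrite vBE vbD vbN vbZ -vdb vbA !vdZ vdp ddN dk_eq /qF.
by apply/rowP => i; rewrite !mxE; ring.
Qed.

Lemma dot_BBb : bdot B (vc B) = q * (k * F).
Proof.
have h : bdot (vb B) (vc A) = - bdot B (vc B).
  have := db_bdot B (vc A).
  rewrite dot_BAb db0 vb_vc vdA vcD vcZ !bdotE.
  rewrite dot_BAb mulr0 add0r => /esym/eqP.
  by rewrite addr_eq0 => /eqP.
by rewrite -[LHS]opprK -h vbB bdotZl gauss; ring.
Qed.

Lemma cjq : q^* = q.
Proof.
have h : (q * (k * F))^* = q * (k * F) by rewrite -dot_BBb cj_bdot vcK bdotC.
have := harm_inv H; rewrite !cjM cjF cjk in h => hi.
have hh : k * F * (ik * iF) = 1 by rewrite mulrACA Hk hi mulr1.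
by rewrite -[LHS]mulr1 -hh mulrA h -mulrA hh mulr1.
Qed.

Lemma db_mm : db mm = q - k.
Proof. by rewrite /qF addrC addKr. Qed.

Section Phi_zero.
Hypothesis HPhi : bdot A A = 0.

Lemma dot_AdA : bdot A (vd A) = 0.
Proof. by apply: half_inj; rewrite -{1}bdotC -d_bdot HPhi; exact: dd0. Qed.
Lemma dot_BA : bdot A B = 0.
Proof. by rewrite vBE !bdotE dot_AdA HPhi; ring. Qed.
Lemma dot_Bf : bdot f B = 0.
Proof.
have := d_bdot f A; rewrite dot_Af dd0 dot_Ap add0r => h.
by rewrite vBE !bdotE -h dot_Af; ring.
Qed.
Lemma dot_Bp : bdot p B = 0.
Proof.
have := d_bdot p A; rewrite dot_Ap dd0 vdp !bdotE dot_Ap HPhi => h.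
by rewrite vBE !bdotE dot_Ap [RHS]h; ring.
Qed.
Lemma dot_Bpb : bdot (vc p) B = 0.
Proof.
have := d_bdot (vc p) A; rewrite dot_Apb dd0 vdpb bdotZl dot_Af => h.
by rewrite vBE !bdotE dot_Apb [RHS]h; ring.
Qed.
Lemma dot_Bbf : bdot f (vc B) = 0.
Proof. by rewrite -{1}(harm_real H) -cj_bdot dot_Bf cj0. Qed.

(** Makes <B, B> computable from dA, which needs no division by k and therefore makes sense at
    umbilics. *)
Lemma Phi2E : bdot (vd A) (vd A) = bdot B B.
Proof. by rewrite {1 2}vdA !bdotE HPhi (bdotC B) dot_BA; ring. Qed.

End Phi_zero.
End Umbilic_free.

End Harmonic.

End DifferentialRing.

(** * Structure equation of dB and transfer matrices between moving frames *)

Section DifferentialRing2.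
Variables (K : comPzRingType) (S : dring K).
Local Notation d := (dd S).
Local Notation db := (db S).
Local Notation vd := (vd S).
Local Notation vb := (vb S).
Local Notation vc := (vc S).
Local Notation half := (half S).
Local Notation "x ^*" := (cj S x) : ring_scope.

Section Third_order.
Variables (m : nat) (f : 'rV[K]_m) (F iF ik iq : K).
Hypothesis H : harm S f F iF.
Local Notation p := (vd f).
Local Notation l := (lF S F iF).
Local Notation k := (kF S F iF).
Local Notation A := (vA S f F iF).
Local Notation mm := (mF S F iF ik).
Local Notation q := (qF S F iF ik).
Local Notation B := (vB S f F iF ik).
Hypothesis Hk : k * ik = 1.
Hypothesis Hq : q * iq = 1.
Hypothesis HPhi : bdot A A = 0.

(** This is d log |B|^2, since |B|^2 = q k F and [mF] is d log (k F). With this coefficient,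
    removing r B from dB leaves a vector orthogonal to conj B. *)
Definition tF := d q * iq + mm.
Local Notation r := tF.
Definition vC := locked (vd B - r *: B).
Local Notation C := vC.

Lemma vCE : C = vd B - r *: B.
Proof. by rewrite /vC -lock. Qed.
Lemma vdB : vd B = r *: B + C.
Proof. by rewrite vCE addrC subrK. Qed.
Lemma dq_eq : d q = (r - mm) * q.
Proof. by rewrite /tF; ring: Hq. Qed.
Lemma dF_l : d F = l * F. Proof. exact: dF_eq H. Qed.

Lemma dot_CBb : bdot C (vc B) = 0.
Proof.
have := d_bdot S B (vc B); rewrite (dot_BBb H Hk) vd_vc (vbB H Hk) vcZ bdotZr.
rewrite (dot_BAb H Hk) mulr0 addr0 => h.
rewrite vCE !bdotE -h (dot_BBb H Hk) !ddM dq_eq dF_l (dk_eq Hk).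
by ring.
Qed.

Lemma vbC : vb C = - (q + db r) *: B.
Proof.
rewrite vCE vbD vbN vbZ -vdb (vbB H Hk) !vdZ (vdA S f F iF ik) ddN dq_eq.
by apply/rowP => i; rewrite !mxE; ring.
Qed.

Lemma dot_CCb : bdot C (vc C) = (q + db r) * (q * (k * F)).
Proof.
have h : bdot (vb C) (vc B) = - bdot C (vc C).
  have := db_bdot S C (vc B).
  rewrite dot_CBb db0 vb_vc vdB vcD vcZ !bdotE.
  rewrite dot_CBb mulr0 add0r => /esym/eqP.
  by rewrite addr_eq0 => /eqP.
by rewrite -[LHS]opprK -h vbC bdotZl (dot_BBb H Hk); ring.
Qed.

(** From d<B, A> = 0. Hence C has a component along conj A unless <B, B> = 0. *)
Lemma dot_CA : bdot C A = - bdot B B.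
Proof.
have := d_bdot S B A; rewrite (bdotC B A) (dot_BA _ HPhi) dd0 (vdA S f F iF ik) => h.
have {}h : bdot (vd B) A = - bdot B B.
  apply/eqP; rewrite -addr_eq0; apply/eqP.
  by rewrite [RHS]h bdotDr bdotZr (bdotC B A) (dot_BA _ HPhi); ring.
by rewrite vCE !bdotE h (bdotC B A) (dot_BA _ HPhi); ring.
Qed.

Lemma null_torsion_r : q + q = F -> r = l + mm.
Proof.
move=> hq; have h : d q = l * q.
  apply/eqP; rewrite -subr_eq0; apply/eqP; apply: (@half_inj _ S).
  have : d q + d q = l * (q + q) by rewrite -ddD hq dF_l.
  by move=> h; rewrite addrACA h; ring.
by rewrite /tF h; ring: Hq.
Qed.

(** |C|^2 = (q + dbar r) |B|^2, and r = l + m gives dbar r = (k - F) + (q - k), so the factor is 2q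
    - F = 0. *)
Lemma null_torsion_C : q + q = F -> C = 0.
Proof.
move=> hq; apply: (@bdot_pos _ S); rewrite dot_CCb null_torsion_r // dbD.
rewrite (db_l S F iF) (db_mm S F iF ik).
have -> : q + (k - F + (q - k)) = q + q - F by ring.
by rewrite hq subrr mul0r.
Qed.

Section Five_sphere.
Hypothesis HqF : q = F.
Hypothesis HPhi2 : bdot B B * (bdot B B)^* = (q * (k * F)) ^+ 2.
Let iFq : iF = iq.
Proof. by rewrite -[LHS]mulr1 -Hq HqF mulrA (mulrC iF) (harm_inv H) mul1r. Qed.

Lemma five_r : r = l + mm.
Proof. by rewrite /tF HqF /lF iFq. Qed.

(** The projection of C on conj A has squared length |<C, A>|^2 / |A|^2 = F^2 k F. Since dbar r = q
    - F = 0, this is also |C|^2, so C equals its projection. *)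
Lemma five_C : C = - (bdot B B * ik * iF) *: vc A.
Proof.
apply/eqP; rewrite -subr_eq0; apply/eqP; apply: (@bdot_pos _ S).
have hi := harm_inv H.
have hr : db r = 0 by rewrite five_r dbD (db_l S F iF) (db_mm S F iF ik) HqF; ring.
have cik : ik^* = ik by apply: (cj_inv Hk); exact: cjk H.
have cCA : bdot (vc C) (vc A) = - (bdot B B)^* by rewrite -cj_bdot dot_CA cjN.
rewrite scaleNr opprK vcD vcZ vcK !cjM (cjiF H) cik !bdotE dot_CCb hr.
rewrite dot_CA (bdotC (vc A)) cCA (bdotC (vc A)) (gauss H).
have hP := HPhi2; set b := bdot B B in hP *.
transitivity (q * q * (k * F) - (b * b^*) * (ik * iF) * (2%:R - (k * ik) * (F * iF))).
  by ring.
rewrite hP Hk hi HqF.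
transitivity (F * F * (k * F) - F * F * (k * F) * ((k * ik) * (F * iF))).
  by ring.
by rewrite Hk hi; ring.
Qed.

(** [HPhi2] says |<B, B>| = |B|^2, the equality case of the Cauchy-Schwarz inequality for B and conj
    B; the second curvature ellipse is a segment. *)
Lemma five_B : B = (bdot B B * iq * ik * iF) *: vc B.
Proof.
apply/eqP; rewrite -subr_eq0; apply/eqP; apply: (@bdot_pos _ S).
have hi := harm_inv H.
have cik : ik^* = ik by apply: (cj_inv Hk); exact: cjk H.
have ciq : iq^* = iq by apply: (cj_inv Hq); exact (cjq H Hk).
have cBB : bdot (vc B) (vc B) = (bdot B B)^* by rewrite -cj_bdot.
rewrite vcD vcN vcZ vcK !cjM (cjiF H) cik ciq !bdotE (bdotC (vc B) B).
rewrite cBB (dot_BBb H Hk).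
have hP := HPhi2; set b := bdot B B in hP *.
transitivity (q * (k * F) -
    (b * b^*) * (iq * ik * iF) * (2%:R - (q * iq) * (k * ik) * (F * iF))).
  by ring.
rewrite hP Hk hi Hq.
transitivity (q * (k * F) * (1 - ((q * iq) * (k * ik) * (F * iF)))).
  by ring.
by rewrite Hk hi Hq; ring.
Qed.

End Five_sphere.
End Third_order.

Section Transfer.
Variables (F iF ik iq : K).
Local Notation l := (lF S F iF).
Local Notation k := (kF S F iF).
Local Notation mm := (mF S F iF ik).
Local Notation q := (qF S F iF ik).
Local Notation r := (tF F iF ik iq).
Hypothesis Hk : k * ik = 1.
Hypothesis Hq : q * iq = 1.
Local Notation A f := (vA S f F iF).
Local Notation B f := (vB S f F iF ik).

(** When <u, u> = 0, right multiplication by this matrix sends u to |u|^2 v and conj u to |u|^2 conj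
    v. The factors [iF], [ik * iF] and [iq * ik * iF] used with it are the inverse squared lengths
    of df, A and B. *)
Definition herm m n (u : 'rV[K]_m) (v : 'rV[K]_n) : 'M[K]_(m, n) :=
  (vc u)^T *m v + u^T *m vc v.

(* If g and f have the same metric and vanishing torsion, the matrix sending the
   moving frame of g to that of f is constant.  The full frame is formed by f,
   df, A, B and their conjugates; [transfer6] serves for surfaces in a 5-sphere,
   where B and its conjugate are parallel. *)
Definition transfer5 m n (g : 'rV[K]_m) (f : 'rV[K]_n) : 'M[K]_(m, n) :=
  g^T *m f + iF *: herm (vd g) (vd f) + (ik * iF) *: herm (A g) (A f).

Definition transfer7 m n (g : 'rV[K]_m) (f : 'rV[K]_n) : 'M[K]_(m, n) :=
  transfer5 g f + (iq * ik * iF) *: herm (B g) (B f).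

Definition transfer6 m n (g : 'rV[K]_m) (f : 'rV[K]_n) : 'M[K]_(m, n) :=
  transfer5 g f + (iq * ik * iF) *: ((vc (B g))^T *m B f).

Lemma outerE m n (u : 'rV[K]_m) (v : 'rV[K]_n) i j : (u^T *m v) i j = u 0 i * v 0 j.
Proof. by rewrite !mxE big_ord1 !mxE. Qed.

Lemma bdot_herm m n x (u : 'rV[K]_m) (v : 'rV[K]_n) :
  x *m herm u v = bdot x (vc u) *: v + bdot x u *: vc v.
Proof. by rewrite mulmxDr !mulmx_bdot. Qed.

Lemma transfer5_mul m n (g : 'rV[K]_m) (f : 'rV[K]_n) : harm S g F iF ->
  g *m transfer5 g f = f.
Proof.
move=> Hg; rewrite !mulmxDr -!scalemxAr mulmx_bdot !bdot_herm (harm_norm Hg).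
rewrite (dot_fp Hg) (dot_fpb Hg) (dot_Af Hg) (dot_Abf Hg) !scale0r !addr0 !scaler0.
by rewrite !addr0 scale1r.
Qed.

Lemma transfer7_mul m n (g : 'rV[K]_m) (f : 'rV[K]_n) : harm S g F iF ->
  bdot (A g) (A g) = 0 -> g *m transfer7 g f = f.
Proof.
move=> Hg HP; rewrite mulmxDr -!scalemxAr bdot_herm (transfer5_mul _ Hg).
by rewrite (dot_Bf Hg) (dot_Bbf Hg) !scale0r !addr0 scaler0 addr0.
Qed.

Lemma transfer6_mul m n (g : 'rV[K]_m) (f : 'rV[K]_n) : harm S g F iF ->
  bdot (A g) (A g) = 0 -> g *m transfer6 g f = f.
Proof.
move=> Hg HP; rewrite mulmxDr -!scalemxAr mulmx_bdot (transfer5_mul _ Hg).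
by rewrite (dot_Bbf Hg) !scale0r scaler0 addr0.
Qed.

Lemma mxtrace_outer m (u v : 'rV[K]_m) : \tr (u^T *m v) = bdot u v.
Proof. by apply: eq_bigr => i _; rewrite outerE. Qed.

(** When <A, A> = 0, [transfer5 f f] is the orthogonal projector onto the span of f, df, A and their
    conjugates, and its trace is the dimension of this span. *)
Lemma mxtrace_transfer5 m (f : 'rV[K]_m) : harm S f F iF ->
  \tr (transfer5 f f) = 5%:R.
Proof.
move=> H; have hi := harm_inv H.
rewrite !(mxtraceD, mxtraceZ) !mxtrace_outer (harm_norm H) (gauss H).
rewrite (bdotC (vc _)) (harm_fact H) (bdotC (vc (A f))) (gauss H).
transitivity (1 + (F * iF) * 2%:R + (F * iF) * (k * ik) * 2%:R).
  by ring.
by rewrite hi Hk; ring.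
Qed.

Lemma mxtrace_transfer7 m (f : 'rV[K]_m) : harm S f F iF ->
  \tr (transfer7 f f) = 7%:R.
Proof.
move=> H; have hi := harm_inv H.
rewrite mxtraceD mxtrace_transfer5 // mxtraceZ mxtraceD !mxtrace_outer.
rewrite (bdotC (vc _)) (dot_BBb H Hk).
transitivity (5%:R + (F * iF) * (k * ik) * (q * iq) * 2%:R).
  by ring.
by rewrite hi Hk Hq; ring.
Qed.

Lemma mxtrace_transfer6 m (f : 'rV[K]_m) : harm S f F iF ->
  \tr (transfer6 f f) = 6%:R.
Proof.
move=> H; have hi := harm_inv H.
rewrite mxtraceD mxtrace_transfer5 // mxtraceZ !mxtrace_outer.
rewrite (bdotC (vc _)) (dot_BBb H Hk).
transitivity (5%:R + (F * iF) * (k * ik) * (q * iq)).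
  by ring.
by rewrite hi Hk Hq; ring.
Qed.

Lemma dik : F * iF = 1 -> d ik = - (mm - l) * ik.
Proof.
move=> hi; rewrite (d_inv S Hk) (dk_eq Hk).
transitivity (- (mm - l) * ik * (k * ik)); first by ring.
by rewrite Hk mulr1.
Qed.

Lemma diq : d iq = - (r - mm) * iq.
Proof.
rewrite (d_inv S Hq) (dq_eq Hq).
transitivity (- (r - mm) * iq * (q * iq)); first by ring.
by rewrite Hq mulr1.
Qed.

Lemma diF : F * iF = 1 -> d iF = - l * iF.
Proof. by move=> hi; rewrite (d_inv S hi) /lF; ring. Qed.

Lemma vd_entry m (u v : 'rV[K]_m) i : vd u = v -> d (u 0 i) = v 0 i.
Proof. by move=> <-; rewrite mxE. Qed.

Section TwoMaps.
Variables (m n : nat) (g : 'rV[K]_m) (f : 'rV[K]_n).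
Hypotheses (Hg : harm S g F iF) (Hf : harm S f F iF).

(** The structure equations make the sum telescope: the derivative of each block cancels what the
    previous block leaves, and only the next-order term of the A-block survives. *)
Lemma d_transfer5 i j : d (transfer5 g f i j) =
  ik * iF * (vc (A g) 0 i * B f 0 j + B g 0 i * vc (A f) 0 j).
Proof.
have hi := harm_inv Hf.
rewrite /transfer5 !mxE !(big_ord1, mxE) !cjd.
have dg m' (h : 'rV[K]_m') (Hh : harm S h F iF) s :
  [/\ d (d (h 0 s)) = l * d (h 0 s) + A h 0 s,
      d (db ((h 0 s)^*)) = - F * h 0 s,
      d (A h 0 s) = mm * A h 0 s + B h 0 s &
      d ((A h 0 s)^*) = - k * db ((h 0 s)^*)].
  split.
  - by have := vd_entry s (vdp S h F iF); rewrite !mxE.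
  - by have := vd_entry s (vdpb Hh); rewrite !mxE cjd.
  - by have := vd_entry s (vdA S h F iF ik); rewrite !mxE.
  - have : vd (vc (A h)) = - k *: vc (vd h).
      by rewrite vd_vc (vbA Hh) vcZ cjN (cjk Hh).
    by move/(vd_entry s); rewrite !mxE cjd.
have [g1 g2 g3 g4] := dg _ g Hg i; have [f1 f2 f3 f4] := dg _ f Hf j.
rewrite !(ddD, ddM) g1 g2 g3 g4 f1 f2 f3 f4 (dik hi) (diF hi).
have cg m' (h : 'rV[K]_m') (Hh : harm S h F iF) s : (h 0 s)^* = h 0 s.
  by have /rowP/(_ s) := harm_real Hh; rewrite mxE.
rewrite (cg _ g Hg) (cg _ f Hf).
(* The cancellations rest on F iF = 1 and k ik = 1; the right-hand side collects them in the factors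
   1 - F iF and 1 - k ik. *)
have -> : forall g0 f0 pg pf pgb pfb Ag Af Agb Afb Bg Bf,
  pg * f0 + g0 * pf +
  (- l * iF * (pgb * pf + pg * pfb) +
   iF * (- F * g0 * pf + pgb * (l * pf + Af) +
     ((l * pg + Ag) * pfb + pg * (- F * f0)))) +
  ((- (mm - l) * ik * iF + ik * (- l * iF)) * (Agb * Af + Ag * Afb) +
   ik * iF * (- k * pgb * Af + Agb * (mm * Af + Bf) +
     ((mm * Ag + Bg) * Afb + Ag * (- k * pfb)))) =
  (pg * f0 + g0 * pf) * (1 - F * iF) + (Ag * pfb + pgb * Af) * iF * (1 - k * ik) +
  ik * iF * (Agb * Bf + Bg * Afb) by move=> *; ring.
by rewrite hi Hk; ring.
Qed.

(** The B-block absorbs the remainder of [d_transfer5] because q iq = 1; its own remainder would be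
    linear in the two vectors C. *)
Lemma d_transfer7 i j : vC f F iF ik iq = 0 -> vC g F iF ik iq = 0 ->
  d (transfer7 g f i j) = 0.
Proof.
move=> Cf Cg; have hi := harm_inv Hf.
rewrite /transfer7 mxE ddD d_transfer5 !mxE !(big_ord1, mxE).
have dg m' (h : 'rV[K]_m') (Hh : harm S h F iF) (Ch : vC h F iF ik iq = 0) s :
  d (B h 0 s) = r * B h 0 s /\ d ((B h 0 s)^*) = - q * (A h 0 s)^*.
  split.
  - by have := vd_entry s (vdB h F iF ik iq); rewrite Ch addr0 !mxE.
  - have : vd (vc (B h)) = - q *: vc (A h).
      by rewrite vd_vc (vbB Hh Hk) vcZ cjN (cjq Hh Hk).
    by move/(vd_entry s); rewrite !mxE.
have [g1 g2] := dg _ g Hg Cg i; have [f1 f2] := dg _ f Hf Cf j.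
rewrite !(ddD, ddM) g1 g2 f1 f2 diq (dik hi) (diF hi).
have -> : forall Agb Afb Bg Bf Bgb Bfb,
  ik * iF * (Agb * Bf + Bg * Afb) +
  (((- (r - mm) * iq * ik + iq * (- (mm - l) * ik)) * iF +
    iq * ik * (- l * iF)) * (Bgb * Bf + Bg * Bfb) +
   iq * ik * iF * (- q * Agb * Bf + Bgb * (r * Bf) +
     (r * Bg * Bfb + Bg * (- q * Afb)))) =
  ik * iF * (Agb * Bf + Bg * Afb) * (1 - q * iq) by move=> *; ring.
by rewrite Hq; ring.
Qed.

End TwoMaps.

Lemma d_transfer6 m (g : 'rV[K]_m) i j : harm S g F iF -> bdot (A g) (A g) = 0 ->
  q = F -> bdot (B g) (B g) * (bdot (B g) (B g))^* = (q * (k * F)) ^+ 2 ->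
  d (transfer6 g g i j) = 0.
Proof.
move=> Hg HP hq HP2; have hi := harm_inv Hg.
rewrite /transfer6 mxE ddD (d_transfer5 Hg Hg) !mxE !(big_ord1, mxE).
have g1 := vd_entry j (vdB g F iF ik iq).
have C0 := five_C Hg Hk Hq HP hq HP2.
have g2 : d ((B g 0 i)^*) = - q * (A g 0 i)^*.
  have : vd (vc (B g)) = - q *: vc (A g).
    by rewrite vd_vc (vbB Hg Hk) vcZ cjN (cjq Hg Hk).
  by move/(vd_entry i); rewrite !mxE.
have hB : B g 0 i = bdot (B g) (B g) * iq * ik * iF * (B g 0 i)^*.
  by have /rowP/(_ i) := five_B Hg Hk Hq HP2; rewrite !mxE.
(* Only the B left over by [d_transfer5] is replaced by its multiple of conj B; it then cancels the
   contribution of C, a multiple of conj A. *)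
rewrite !(ddD, ddM) g1 g2 C0 diq (dik hi) (diF hi) !mxE {1}hB.
set b := bdot _ _.
have -> : forall Aib Ajb Bj Bib,
  ik * iF * (Aib * Bj + b * iq * ik * iF * Bib * Ajb) +
  (((- (r - mm) * iq * ik + iq * (- (mm - l) * ik)) * iF +
    iq * ik * (- l * iF)) * (Bib * Bj) +
   iq * ik * iF * (- q * Aib * Bj + Bib * (r * Bj + - (b * ik * iF) * Ajb))) =
  ik * iF * Aib * Bj * (1 - q * iq) by move=> *; ring.
by rewrite Hq; ring.
Qed.

Lemma db_real x : x^* = x -> d x = 0 -> db x = 0.
Proof. by move=> hx hd; rewrite -[db x]/((d (x^*))^*) hx hd cj0. Qed.

Lemma hermE m n (u : 'rV[K]_m) (v : 'rV[K]_n) i j :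
  herm u v i j = (u 0 i)^* * v 0 j + u 0 i * (v 0 j)^*.
Proof. by rewrite /herm !(mxE, big_ord1). Qed.

Lemma cj_herm m n (u : 'rV[K]_m) (v : 'rV[K]_n) i j : (herm u v i j)^* = herm u v i j.
Proof. by rewrite hermE cjD !cjM !cjK addrC. Qed.

Lemma transfer5E m n (g : 'rV[K]_m) (f : 'rV[K]_n) i j :
  transfer5 g f i j = g 0 i * f 0 j + iF * herm (vd g) (vd f) i j +
    ik * iF * herm (A g) (A f) i j.
Proof. by rewrite /transfer5 !hermE !(mxE, big_ord1). Qed.

Lemma cj_transfer5 m n (g : 'rV[K]_m) (f : 'rV[K]_n) i j : harm S g F iF -> harm S f F iF ->
  (transfer5 g f i j)^* = transfer5 g f i j.
Proof.
move=> Hg Hf.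
have cik : ik^* = ik by apply: (cj_inv Hk); exact: cjk Hg.
have cg m' (h : 'rV[K]_m') (Hh : harm S h F iF) s : (h 0 s)^* = h 0 s.
  by have /rowP/(_ s) := harm_real Hh; rewrite mxE.
by rewrite transfer5E !cjD !cjM !cj_herm cik (cjiF Hg) (cg _ g Hg) (cg _ f Hf).
Qed.

Lemma transfer7E m n (g : 'rV[K]_m) (f : 'rV[K]_n) i j :
  transfer7 g f i j =
    transfer5 g f i j + iq * ik * iF * herm (B g) (B f) i j.
Proof. by rewrite /transfer7 mxE; congr (_ + _); rewrite mxE. Qed.

Lemma transfer6E m (g : 'rV[K]_m) i j : transfer6 g g i j =
  transfer5 g g i j + iq * ik * iF * ((B g 0 i)^* * B g 0 j).
Proof. by rewrite /transfer6 mxE; congr (_ + _); rewrite mxE outerE mxE. Qed.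

Lemma cj_transfer7 m n (g : 'rV[K]_m) (f : 'rV[K]_n) i j : harm S g F iF -> harm S f F iF ->
  (transfer7 g f i j)^* = transfer7 g f i j.
Proof.
move=> Hg Hf.
have cik : ik^* = ik by apply: (cj_inv Hk); exact: cjk Hg.
have ciq : iq^* = iq by apply: (cj_inv Hq); exact (cjq Hg Hk).
rewrite transfer7E cjD !cjM cj_herm cik ciq.
by rewrite (cjiF Hg) cj_transfer5.
Qed.

(** The single outer product of conj B and B is real because B is a multiple of conj B. *)
Lemma cj_transfer6 m (g : 'rV[K]_m) i j : harm S g F iF ->
  bdot (B g) (B g) * (bdot (B g) (B g))^* = (q * (k * F)) ^+ 2 ->
  (transfer6 g g i j)^* = transfer6 g g i j.
Proof.
move=> Hg HP2.
have cik : ik^* = ik by apply: (cj_inv Hk); exact: cjk Hg.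
have ciq : iq^* = iq by apply: (cj_inv Hq); exact (cjq Hg Hk).
rewrite transfer6E cjD !cjM cik ciq.
rewrite (cjiF Hg) cj_transfer5 // cjK.
have hB s : B g 0 s = bdot (B g) (B g) * iq * ik * iF * (B g 0 s)^*.
  by have /rowP/(_ s) := five_B Hg Hk Hq HP2; rewrite !mxE.
by congr (_ + _ * _); rewrite (hB i) (hB j) !cjM !cjK -!hB; ring.
Qed.

End Transfer.
End DifferentialRing2.

(** * The seven-dimensional cross product with entries in any ring *)

Definition rcross (K : pzRingType) (u v : 'rV[K]_7) : 'rV[K]_7 :=
  \row_(k < 7)
    ((u 0 (k + 1) * v 0 (k + 3) - u 0 (k + 3) * v 0 (k + 1))
   + (u 0 (k + 2) * v 0 (k + 6) - u 0 (k + 6) * v 0 (k + 2))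
   + (u 0 (k + 4) * v 0 (k + 5) - u 0 (k + 5) * v 0 (k + 4))).

Definition coord7 (K : pzRingType) (u : 'rV[K]_7) (n : nat) : K := u 0 (inZp n).

(* Names the entries of vectors at closed indices of Z/7 by their residue. *)
Ltac norm7 :=
  repeat match goal with
  | |- context [@fun_of_matrix ?T 1 7 ?u ?z ?e] =>
    let n := eval vm_compute in (nat_of_ord e) in
    rewrite (_ : @fun_of_matrix T 1 7 u z e = coord7 u n);
      [ | by congr (fun_of_matrix u _ _); apply/val_inj ]
  end.

Section Cross.
Variable K : comPzRingType.
Implicit Types (u v w : 'rV[K]_7) (a : K).

Lemma rcrossDr u v w : rcross u (v + w) = rcross u v + rcross u w.
Proof. by apply/rowP => i; rewrite !mxE; ring. Qed.
Lemma rcrossZr a u v : rcross u (a *: v) = a *: rcross u v.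
Proof. by apply/rowP => i; rewrite !mxE; ring. Qed.
Lemma rcrossC u v : rcross u v = - rcross v u.
Proof. by apply/rowP => i; rewrite !mxE; ring. Qed.

Lemma bdot7E u v : bdot u v =
  coord7 u 0 * coord7 v 0 + coord7 u 1 * coord7 v 1 + coord7 u 2 * coord7 v 2 +
  coord7 u 3 * coord7 v 3 + coord7 u 4 * coord7 v 4 + coord7 u 5 * coord7 v 5 +
  coord7 u 6 * coord7 v 6.
Proof. by rewrite /bdot !big_ord_recl big_ord0; norm7; ring. Qed.

Lemma coord7_rcross u v n : coord7 (rcross u v) n =
  (coord7 u ((n + 1) %% 7) * coord7 v ((n + 3) %% 7) -
   coord7 u ((n + 3) %% 7) * coord7 v ((n + 1) %% 7)) +
  (coord7 u ((n + 2) %% 7) * coord7 v ((n + 6) %% 7) -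
   coord7 u ((n + 6) %% 7) * coord7 v ((n + 2) %% 7)) +
  (coord7 u ((n + 4) %% 7) * coord7 v ((n + 5) %% 7) -
   coord7 u ((n + 5) %% 7) * coord7 v ((n + 4) %% 7)).
Proof.
have e c : (c < 7)%N -> (inZp n + inZp c : 'I_7) = inZp ((n + c) %% 7).
  by move=> hc; apply/val_inj; rewrite /= (modn_small hc) modnDml modn_mod.
rewrite {1}/coord7 mxE /coord7 -!e //.
by congr (_ + _ + _); congr (_ - _); congr (fun_of_matrix u _ _ * fun_of_matrix v _ _);
  congr (_ + _); apply/val_inj.
Qed.

Lemma coord7D u v n : coord7 (u + v) n = coord7 u n + coord7 v n.
Proof. by rewrite /coord7 mxE. Qed.
Lemma coord7Z a u n : coord7 (a *: u) n = a * coord7 u n.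
Proof. by rewrite /coord7 mxE. Qed.

Lemma coord7P u v : (forall n, (n < 7)%N -> coord7 u n = coord7 v n) -> u = v.
Proof. by move=> h; apply/rowP => i; rewrite -(valZpK i); apply: h. Qed.

Lemma rcross_triple u v w : bdot (rcross u v) w = bdot u (rcross v w).
Proof. by rewrite !bdot7E !coord7_rcross /=; ring. Qed.

(** Polarized form of u x (u x w) = <u, w> u - <u, u> w. In dimension seven only this symmetrized
    version holds, not the double product formula of dimension three. *)
Lemma rcross_rcross u v w : rcross u (rcross v w) + rcross v (rcross u w) =
  - (bdot u v *+ 2) *: w + bdot u w *: v + bdot v w *: u.
Proof.
apply: coord7P => -[|[|[|[|[|[|[|//]]]]]]] _;
  by rewrite !(coord7D, coord7Z, coord7_rcross, bdot7E) /=; ring.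
Qed.
End Cross.

(** * The frame of a pseudoholomorphic curve and the expansion of B *)

Section G2.
Variables (K : comPzRingType) (S : dring K).
Local Notation d := (dd S).
Local Notation db := (db S).
Local Notation vd := (vd S).
Local Notation vb := (vb S).
Local Notation vc := (vc S).
Local Notation half := (half S).
Local Notation "x ^*" := (cj S x) : ring_scope.

Variables (ii : K).
Hypothesis ii2 : ii * ii = -1.
Hypothesis dii : d ii = 0.
Hypothesis cjii : ii^* = - ii.

Lemma vd_rcross u v : vd (rcross u v) = rcross (vd u) v + rcross u (vd v).
Proof. by apply/rowP => i; rewrite !mxE !(ddD, ddN, ddM); ring. Qed.

Lemma vc_rcross u v : vc (rcross u v) = rcross (vc u) (vc v).
Proof. by apply/rowP => i; rewrite !mxE !(cjD, cjN, cjM). Qed.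

Lemma rcross_self (u : 'rV[K]_7) : rcross u u = 0.
Proof. by apply/rowP => i; rewrite !mxE; ring. Qed.

Lemma half_ii u : u * ii + u * ii = 0 -> u = 0.
Proof.
move=> h; apply: (@half_inj _ S).
transitivity ((u * ii + u * ii) * - ii); last by rewrite h mul0r.
by ring: ii2.
Qed.

(** The cross product with g is skew, so e <u, v> = <g x u, v> = -<u, g x v> = -e <u, v>. *)
Lemma eigen_isotropic (g u v : 'rV[K]_7) (e : K) : (e = ii \/ e = - ii) ->
  rcross g u = e *: u -> rcross g v = e *: v -> bdot u v = 0.
Proof.
move=> he gu gv; have h : e * bdot u v = - (e * bdot u v).
  transitivity (bdot (rcross g u) v); first by rewrite gu bdotZl.
  by rewrite rcrossC bdotNl rcross_triple gv bdotZr.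
apply: half_ii; case: he h => -> h; last first.
  by apply: oppr_inj; rewrite oppr0 opprD -!mulrN !(mulrC _ (- ii)) {1}h addNr.
by rewrite !(mulrC _ ii) {1}h addNr.
Qed.

Variables (g : 'rV[K]_7) (F iF ik : K).
Hypothesis H : harm S g F iF.
Local Notation p := (vd g).
Local Notation l := (lF S F iF).
Local Notation k := (kF S F iF).
Local Notation A := (vA S g F iF).
Local Notation mm := (mF S F iF ik).
Local Notation q := (qF S F iF ik).
Local Notation B := (vB S g F iF ik).
Hypothesis Hk : k * ik = 1.
Hypothesis HJ : rcross g p = ii *: p.

Lemma rcross_gdp : rcross g (vd p) = ii *: vd p.
Proof.
have := vd_rcross g p; rewrite HJ vdZ dii scale0r add0r rcross_self add0r.
by move=> ->.
Qed.

Lemma rcross_gA : rcross g A = ii *: A.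
Proof.
rewrite vAE -scaleNr rcrossDr rcrossZr rcross_gdp HJ.
by apply/rowP => i; rewrite !mxE; ring.
Qed.

Lemma pseudohol_Phi : bdot A A = 0.
Proof. by apply: (eigen_isotropic (e := ii)) rcross_gA rcross_gA; left. Qed.

(** An eigenvector for -i which, with its conjugate, completes g, p, A and their conjugates to a
    frame of C^7 even where B and conj B are dependent. *)
Definition vN := locked (rcross p A).
Local Notation n := vN.

Lemma vNE : n = rcross p A.
Proof. by rewrite /vN -lock. Qed.

Lemma rcross_gn : rcross g n = - ii *: n.
Proof.
have := rcross_rcross g p A; rewrite rcross_gA rcrossZr (dot_fp H) (dot_Af H).
rewrite (dot_Ap H) mul0rn !scale0r oppr0 scale0r !addr0 -vNE => /eqP.
by rewrite addr_eq0 => /eqP ->; rewrite scaleNr.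
Qed.

Lemma rcross_conj u (e : K) : rcross g u = e *: u -> rcross g (vc u) = e^* *: vc u.
Proof. by move=> h; rewrite -{1}(harm_real H) -vc_rcross h vcZ. Qed.

Lemma rcross_gpb : rcross g (vc p) = - ii *: vc p.
Proof. by rewrite (rcross_conj HJ) cjii. Qed.
Lemma rcross_gAb : rcross g (vc A) = - ii *: vc A.
Proof. by rewrite (rcross_conj rcross_gA) cjii. Qed.
Lemma rcross_gnb : rcross g (vc n) = ii *: vc n.
Proof. by rewrite (rcross_conj rcross_gn) cjN cjii opprK. Qed.

Lemma dot_ng : bdot g n = 0.
Proof.
by rewrite vNE -rcross_triple HJ bdotZl (dot_Ap H) mulr0.
Qed.
Lemma dot_nbg : bdot g (vc n) = 0.
Proof. by rewrite -{1}(harm_real H) -cj_bdot dot_ng cj0. Qed.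
Lemma dot_np : bdot p n = 0.
Proof. by rewrite vNE -rcross_triple rcross_self bdot0l. Qed.
Lemma dot_nA : bdot A n = 0.
Proof. by rewrite bdotC vNE rcross_triple rcross_self bdot0r. Qed.
Lemma dot_npb : bdot (vc p) n = 0.
Proof.
by apply: (eigen_isotropic (e := - ii)) rcross_gpb rcross_gn; right.
Qed.
Lemma dot_nAb : bdot (vc A) n = 0.
Proof.
by apply: (eigen_isotropic (e := - ii)) rcross_gAb rcross_gn; right.
Qed.
Lemma dot_nn : bdot n n = 0.
Proof.
by apply: (eigen_isotropic (e := - ii)) rcross_gn rcross_gn; right.
Qed.
Lemma dot_nbp : bdot p (vc n) = 0.
Proof. by rewrite -[p](vcK S) -cj_bdot dot_npb cj0. Qed.
Lemma dot_nbA : bdot A (vc n) = 0.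
Proof. by rewrite -[A](vcK S) -cj_bdot dot_nAb cj0. Qed.
Lemma dot_nbpb : bdot (vc p) (vc n) = 0.
Proof. by rewrite -cj_bdot dot_np cj0. Qed.
Lemma dot_nbAb : bdot (vc A) (vc n) = 0.
Proof. by rewrite -cj_bdot dot_nA cj0. Qed.
Lemma dot_nbnb : bdot (vc n) (vc n) = 0.
Proof. by rewrite -cj_bdot dot_nn cj0. Qed.

(** The eigenvalues of p and conj A are i and -i. Expanding g x (p x conj A) in the two possible
    ways assigns both eigenvalues to the same vector. *)
Lemma rcross_pAb : rcross p (vc A) = 0.
Proof.
have := rcross_rcross g p (vc A); rewrite rcross_gAb rcrossZr (dot_fp H).
rewrite (dot_Abf H) (dot_Abp H) mul0rn !scale0r oppr0 scale0r !addr0 => /eqP.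
rewrite addr_eq0 scaleNr opprK => /eqP h1.
have := rcross_rcross g (vc A) p; rewrite HJ rcrossZr (dot_Abf H).
rewrite (dot_fp H) (bdotC _ p) (dot_Abp H) mul0rn !scale0r oppr0 scale0r !addr0.
rewrite (rcrossC (vc A)) -scaleN1r rcrossZr h1 => h2.
apply/rowP => i; rewrite [RHS]mxE; apply: half_ii.
have /rowP/(_ i) := h2; rewrite !mxE => h3.
by apply: oppr_inj; rewrite oppr0 -[RHS]h3; ring.
Qed.

(** Because p x conj A = 0, [rcross_rcross] for p, conj p, conj A reduces to p x conj n = -2F conj
    A; pairing with A through the triple product yields 2F |A|^2. *)
Lemma dot_nnb : bdot n (vc n) = 2%:R * (F * (k * F)).
Proof.
have := rcross_rcross p (vc p) (vc A).
rewrite rcross_pAb (dot_Abp H) (dot_Abpb H) (harm_fact H) !scale0r !addr0.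
have -> : rcross (vc p) 0 = 0 by rewrite -(scale0r 0) rcrossZr !scale0r.
rewrite addr0 -vc_rcross -vNE => h.
rewrite {1}vNE rcrossC bdotNl rcross_triple h bdotZr (gauss H).
by ring.
Qed.

Definition iN := locked (half * iF * ik * iF).

Lemma dot_nnb_inv : bdot n (vc n) * iN = 1.
Proof.
rewrite dot_nnb /iN -lock; have hi := harm_inv H.
transitivity ((half + half) * (k * ik) * (F * iF) * (F * iF)); first by ring.
by rewrite halfP Hk hi; ring.
Qed.

Lemma g2_frame : g^T *m g + iF *: herm S p p + (ik * iF) *: herm S A A +
  iN *: herm S n n = 1%:M.
Proof.
have hi := harm_inv H.
pose V := \matrix_(i < 7) nth 0 [:: g; p; vc p; A; vc A; n; vc n] i.
pose W := \matrix_(i < 7) nth 0 [:: g; iF *: vc p; iF *: p; (ik * iF) *: vc A;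
   (ik * iF) *: A; iN *: vc n; iN *: n] i.
have VW : V *m W^T = 1%:M.
  have e i j : (V *m W^T) i j = bdot (row i V) (row j W).
    by rewrite mxE; apply: eq_bigr => s _; rewrite !mxE.
  have h1 : iF * F = 1 by rewrite mulrC.
  have h2 : ik * iF * (k * F) = 1.
    by rewrite mulrACA (mulrC ik) Hk h1 mulr1.
  have h3 : iN * bdot n (vc n) = 1 by rewrite mulrC dot_nnb_inv.
  have hpc : bdot (vc p) (vc p) = 0 by rewrite -cj_bdot (harm_conf H) cj0.
  have hAc : bdot (vc A) (vc A) = 0 by rewrite -cj_bdot pseudohol_Phi cj0.
  pose facts := (harm_norm H, harm_conf H, harm_fact H, dot_fp H, dot_fpb H,
    dot_Af H, dot_Abf H, dot_Ap H, dot_Apb H, dot_Abp H, dot_Abpb H, gauss H,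
    pseudohol_Phi, hpc, hAc, dot_ng, dot_nbg, dot_np, dot_nA, dot_npb, dot_nAb,
    dot_nn, dot_nbp, dot_nbA, dot_nbpb, dot_nbAb, dot_nbnb).
  apply/matrixP => i j; rewrite e !rowK mxE.
  case: i => [[|[|[|[|[|[|[|//]]]]]]] ?]; case: j => [[|[|[|[|[|[|[|//]]]]]]] ?];
    rewrite /= ?bdotZr;
    first [by rewrite facts ?mulr0 ?h1 ?h2 | by rewrite bdotC facts ?mulr0 ?h1 ?h2
    | by rewrite h3 | by rewrite bdotC h3].
(* A one-sided inverse of a square matrix over a commutative ring is two-sided: the dual bases V and
   W give the resolution of the identity W^T V = 1. *)
have := mulmx1C VW => <-.
apply/matrixP => i j; rewrite [RHS]mxE !big_ord_recl big_ord0 !mxE /=.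
by rewrite !(big_ord1, mxE); ring.
Qed.

(** Differentiating g x A = i A gives g x B = i B - n. Pairing with conj n, an eigenvector for i,
    determines the n-component of B, which never vanishes. *)
Lemma dot_Bnb : bdot B (vc n) * (ii + ii) = bdot n (vc n).
Proof.
have h : rcross g (vd A) = ii *: vd A - n.
  have := vd_rcross g A; rewrite rcross_gA vdZ dii scale0r add0r -vNE => ->.
  by rewrite addrC addKr.
have hB : rcross g B = ii *: B - n.
  rewrite vBE -scaleNr rcrossDr rcrossZr h rcross_gA.
  by apply/rowP => i; rewrite !mxE; ring.
have e1 : bdot (rcross g B) (vc n) = - (ii * bdot B (vc n)).
  by rewrite rcrossC bdotNl rcross_triple rcross_gnb bdotZr.
have e2 : ii * bdot B (vc n) - bdot n (vc n) = - (ii * bdot B (vc n)).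
  by rewrite -e1 hB bdotDl bdotNl bdotZl.
have -> : bdot n (vc n) = ii * bdot B (vc n) - - (ii * bdot B (vc n)).
  by rewrite -e2; ring.
by ring.
Qed.

Lemma B_in_n : B = iN *: (bdot B (vc n) *: n + bdot B n *: vc n).
Proof.
have HP := pseudohol_Phi.
have := congr1 (fun X => B *m X) g2_frame => /=.
rewrite mulmx1 !mulmxDr -!scalemxAr !bdot_herm mulmx_bdot.
rewrite (bdotC B g) (bdotC B p) (bdotC B (vc p)) (bdotC B A).
rewrite (dot_Bf H ik) (dot_Bp H _ HP) (dot_Bpb H) (dot_BA _ HP) (dot_BAb H Hk).
by rewrite !scale0r !addr0 !scaler0 !add0r => {1}<-.
Qed.

(** Pythagoras in the plane of n and conj n. With N = |n|^2 = 2F |A|^2 and B = (ga n + be conj n)/N,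
    one has N |B|^2 = |ga|^2 + |be|^2. Here |ga|^2 = N^2/4 by [dot_Bnb], so that <B, B> = 2 ga be/N
    has the modulus of be. *)
Lemma g2_identity : 2%:R * (q * (k * F)) * (F * (k * F)) =
  (F * (k * F)) ^+ 2 + bdot B B * (bdot B B)^*.
Proof.
set be := bdot B n; set ga := bdot B (vc n); set N := bdot n (vc n).
have hN : N * iN = 1 := dot_nnb_inv.
have e x : bdot B x = iN * (ga * bdot n x + be * bdot (vc n) x).
  by rewrite -!bdotZl -bdotDl -bdotZl -B_in_n.
have eBB : bdot B B = iN * (ga * be + be * ga).
  by rewrite e (bdotC n) (bdotC (vc n)).
have h3 : q * (k * F) = iN * (ga * ga^* + be * be^*).
  rewrite -(dot_BBb H Hk) e; congr (_ * (_ * _ + _ * _)).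
    by rewrite /ga cj_bdot vcK bdotC.
  by rewrite /be cj_bdot bdotC.
have cN : N^* = N by rewrite /N cj_bdot vcK bdotC.
have ciN : iN^* = iN by apply: (cj_inv hN).
have hga : ga * (ii + ii) = N := dot_Bnb.
have hga' : ga^* * (ii + ii) = - N.
  by rewrite -cN -hga cjM cjD cjii; ring.
have h4 : 4%:R * (ga * ga^*) = N * N.
  transitivity (- (ga * (ii + ii) * (ga^* * (ii + ii)))); first by ring: ii2.
  by rewrite hga hga'; ring.
have hN2 : N = 2%:R * (F * (k * F)) := dot_nnb.
have h5 : (F * (k * F)) ^+ 2 = ga * ga^*.
  transitivity ((half + half) ^+ 2 * (half + half) ^+ 2 * (F * (k * F)) ^+ 2).
    by rewrite halfP; ring.
  transitivity (half ^+ 2 * (half + half) ^+ 2 * (N * N)); first by rewrite hN2; ring.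
  rewrite -h4; transitivity ((half + half) ^+ 2 * (half + half) ^+ 2 * (ga * ga^*)).
    by ring.
  by rewrite halfP; ring.
rewrite h5 eBB h3 !(cjM, cjD) ciN.
transitivity (N * iN * (ga * ga^* + be * be^*)); first by rewrite hN2; ring.
transitivity (ga * ga^* + iN * iN * (be * be^*) * (4%:R * (ga * ga^*))); last by ring.
rewrite h4 hN.
transitivity (ga * ga^* + (N * iN) ^+ 2 * (be * be^*)); last by ring.
by rewrite hN; ring.
Qed.

End G2.

(** * Logarithmic derivatives *)

Section LogDerivative.
Variables (K : comPzRingType) (S : dring K).
Local Notation d := (dd S).
Local Notation db := (db S).
Local Notation "x ^*" := (cj S x) : ring_scope.
Implicit Types u v a b : K.

(* [a] is the logarithmic derivative du/u. *)
Definition logd u a := d u = a * u.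

Lemma logdM u v a b : logd u a -> logd v b -> logd (u * v) (a + b).
Proof. by rewrite /logd => hu hv; rewrite ddM hu hv; ring. Qed.

Lemma logdX u a n : logd u a -> logd (u ^+ n) (a *+ n).
Proof.
move=> hu; elim: n => [|n IH]; first by rewrite /logd expr0 mulr0n mul0r dd1.
by rewrite exprS mulrS; apply: logdM.
Qed.

Lemma logdV u v a : u * v = 1 -> logd u a -> logd v (- a).
Proof.
rewrite /logd => uv hu; rewrite (d_inv S uv) hu.
by transitivity (- a * v * (u * v)); [ring|rewrite uv mulr1].
Qed.

Lemma dbMn u n : db (u *+ n) = db u *+ n.
Proof. by elim: n => [|n IH]; rewrite ?mulr0n ?db0 // !mulrS dbD IH. Qed.

(** Harmonicity of log |u|^2: such a factor can be multiplied into a function without changing the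
    Laplacian of its logarithm. *)
Lemma logd_holomorphic u v : u * v = 1 -> db u = 0 ->
  exists2 a, logd (u * u^*) a & db a = 0.
Proof.
move=> uv hu; exists (d u * v).
  have hc : d (u^*) = 0 by rewrite -(cjK S (d (u^*))) -/(db u) hu cj0.
  rewrite /logd ddM hc; transitivity (d u * u^* * (u * v)); first by rewrite uv; ring.
  by ring.
have hv : db v = 0.
  have h : db (u * v) = 0 by rewrite uv db1.
  move: h; rewrite dbM hu mul0r add0r => h.
  by rewrite -[LHS]mul1r -uv mulrAC h mul0r.
by rewrite dbM -ddb hu dd0 hv; ring.
Qed.

Section Surface.
Variables (F iF ik : K).
Hypothesis HF : F * iF = 1.
Local Notation l := (lF S F iF).
Local Notation k := (kF S F iF).
Local Notation mm := (mF S F iF ik).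
Local Notation q := (qF S F iF ik).
Hypothesis Hk : k * ik = 1.

Lemma logd_F : logd F l.
Proof. by rewrite /logd /lF -mulrA (mulrC iF) HF mulr1. Qed.
Lemma logd_k : logd k (mm - l).
Proof. exact: dk_eq. Qed.

Lemma db_logd_k : db (mm - l) = q - k *+ 2 + F.
Proof. by rewrite dbD dbN (db_mm S F iF ik) (db_l S F iF); ring. Qed.

Lemma db_logd_iFh2 : db (- (mm - l) - l - l) = F - q.
Proof.
rewrite dbD dbN (db_l S F iF) dbD [db (- l)]dbN (db_l S F iF) dbN db_logd_k.
by ring.
Qed.

(* The function [kappa] = k / F is invariant under a change of coordinate. *)
Lemma logd_kappa : exists2 a, logd (k * iF) a & db a = q - k *+ 3 + F *+ 2.
Proof.
exists (mm - l - l); first by apply: logdM logd_k (logdV HF logd_F).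
by rewrite dbD dbN db_logd_k (db_l S F iF); ring.
Qed.

(* For P = <vA, vA> the function is |P|^6 / (F |vA|^2)^4, which is invariant
   under a change of coordinate. *)
Lemma logd_quartic (P iP : K) : P * iP = 1 -> db P = 0 -> q + q = F ->
  exists2 a, logd ((P * P^*) ^+ 3 * (ik * iF * iF) ^+ 4) a & db a = F *+ 2.
Proof.
move=> PP hP hq; have [a ha ha0] := logd_holomorphic PP hP.
exists (a *+ 3 + (- (mm - l) - l - l) *+ 4).
  apply: logdM; first exact: logdX.
  apply: logdX; apply: logdM; last exact: logdV HF logd_F.
  by apply: logdM; [apply: logdV Hk logd_k|apply: logdV HF logd_F].
(* P contributes 0, and each of the four factors 1/(F |A|^2) contributes F - q = F/2. *)
rewrite dbD !dbMn ha0 db_logd_iFh2.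
transitivity (F *+ 4 - (q + q) *+ 2); first by ring.
by rewrite hq; ring.
Qed.

End Surface.
End LogDerivative.

Section G2Frame.
Variables (K : comPzRingType) (S : dring K).
Local Notation d := (dd S).
Local Notation db := (db S).
Local Notation vd := (vd S).
Local Notation vc := (vc S).
Local Notation "x ^*" := (cj S x) : ring_scope.
Variables (ii : K).
Hypothesis ii2 : ii * ii = -1.
Hypothesis dii : d ii = 0.
Hypothesis cjii : ii^* = - ii.
Variables (g : 'rV[K]_7) (F iF ik : K).
Hypothesis H : harm S g F iF.
Local Notation p := (vd g).
Local Notation k := (kF S F iF).
Local Notation A := (vA S g F iF).
Local Notation B := (vB S g F iF ik).
Local Notation q := (qF S F iF ik).
Local Notation n := (vN S g F iF).
Hypothesis Hk : k * ik = 1.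
Hypothesis HJ : rcross g p = ii *: p.
Local Notation iN := (iN S iF ik).

Lemma frame_expand (w : 'rV[K]_7) : w = bdot w g *: g +
  iF *: (bdot w (vc p) *: p + bdot w p *: vc p) +
  (ik * iF) *: (bdot w (vc A) *: A + bdot w A *: vc A) +
  iN *: (bdot w (vc n) *: n + bdot w n *: vc n).
Proof.
have := congr1 (fun X => w *m X) (g2_frame ii2 dii cjii H Hk HJ) => /=.
by rewrite mulmx1 !mulmxDr -!scalemxAr !bdot_herm mulmx_bdot => {1}<-.
Qed.

(** Cramer's rule in the plane of n and conj n, in which B and conj B lie. Where |<B, B>| differs
    from |B|^2, a vector orthogonal to B and conj B is orthogonal to n. *)
Lemma frame_disc (w : 'rV[K]_7) : bdot w n ^+ 2 *
    (bdot B B * (bdot B B)^* - bdot B (vc B) ^+ 2) =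
  - ((bdot B (vc n))^* * bdot w B - bdot B n * bdot w (vc B)) ^+ 2.
Proof.
have hB := B_in_n ii2 dii cjii H Hk HJ.
have ciN : iN^* = iN by apply: (cj_inv (dot_nnb_inv ii2 dii cjii H Hk HJ)); rewrite cj_bdot vcK bdotC.
set be := bdot B n in hB *; set ga := bdot B (vc n) in hB *.
have hBb : vc B = iN *: (ga^* *: vc n + be^* *: n).
  by rewrite {1}hB vcZ vcD !vcZ vcK ciN.
have e x : bdot x B = iN * (ga * bdot x n + be * bdot x (vc n)).
  by rewrite {1}hB !bdotE.
have eb x : bdot x (vc B) = iN * (ga^* * bdot x (vc n) + be^* * bdot x n).
  by rewrite {1}hBb !bdotE.
have eBB : bdot B B = iN * (ga * be + be * ga) by rewrite e.
have eBb : bdot B (vc B) = iN * (ga^* * ga + be^* * be) by rewrite eb.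
rewrite eBB eBb e eb !(cjM, cjD) ciN; ring.
Qed.

End G2Frame.

(** * Linear relations with constant coefficients *)

Section DifferentialIdeal.
Variables (K : comPzRingType) (S : dring K).
Local Notation d := (dd S).
Local Notation vd := (vd S).
Local Notation vc := (vc S).
Local Notation "x ^*" := (cj S x) : ring_scope.
Variable I : K -> Prop.
Hypothesis I0 : I 0.
Hypothesis ID : forall a b, I a -> I b -> I (a + b).
Hypothesis IM : forall a b, I b -> I (a * b).
Hypothesis Id : forall a, I a -> I (d a).
Hypothesis Ic : forall a, I a -> I (a^*).

Lemma sum_morph (h : K -> K) (T : finType) (u : T -> K) : h 0 = 0 ->
  {morph h : x y / x + y} -> h (\sum_i u i) = \sum_i h (u i).
Proof. by move=> h0 hD; exact: (big_morph h hD h0). Qed.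

Variables (m l : nat) (w : 'M[K]_(m, l)).
Hypothesis dw : forall i j, d (w i j) = 0.
Hypothesis cw : forall i j, (w i j)^* = w i j.

(** In the application I consists of the functions vanishing near a point and w is a constant real
    matrix. A relation V w = 0 then passes to derivatives and conjugates of V, hence from f to its
    whole moving frame. *)
Definition kills (V : 'rV[K]_m) := forall j, I ((V *m w) 0 j).

Lemma kills_vd V : kills V -> kills (vd V).
Proof.
move=> h j; have := Id (h j); congr I; rewrite !mxE (sum_morph _ (dd0 S) (ddD S)).
by apply: eq_bigr => i _; rewrite ddM dw mulr0 addr0 mxE.
Qed.

Lemma kills_vc V : kills V -> kills (vc V).
Proof.
move=> h j; have := Ic (h j); congr I; rewrite !mxE (sum_morph _ (cj0 S) (cjD S)).
by apply: eq_bigr => i _; rewrite cjM cw mxE.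
Qed.

Lemma killsD V W : kills V -> kills W -> kills (V + W).
Proof. by move=> hV hW j; rewrite mulmxDl mxE; apply: ID. Qed.

Lemma killsZ a V : kills V -> kills (a *: V).
Proof. by move=> hV j; rewrite -scalemxAl mxE; apply: IM. Qed.

Lemma killsB a V W : kills V -> kills W -> kills (V - a *: W).
Proof. by move=> hV hW; apply: killsD => //; rewrite -scaleNr; apply: killsZ. Qed.

Definition kills_mx n (P : 'M[K]_(n, m)) := forall i j, I ((P *m w) i j).

Lemma kills_mxD n (P Q : 'M[K]_(n, m)) : kills_mx P -> kills_mx Q -> kills_mx (P + Q).
Proof. by move=> hP hQ i j; rewrite mulmxDl mxE; apply: ID. Qed.

Lemma kills_mxZ n a (P : 'M[K]_(n, m)) : kills_mx P -> kills_mx (a *: P).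
Proof. by move=> hP i j; rewrite -scalemxAl mxE; apply: IM. Qed.

Lemma kills_outer n (u : 'rV[K]_n) V : kills V -> kills_mx (u^T *m V).
Proof. by move=> hV i j; rewrite -mulmxA mxE big_ord1; apply: IM. Qed.

Lemma kills_herm n (u : 'rV[K]_n) V : kills V -> kills_mx (herm S u V).
Proof.
by move=> hV; apply: kills_mxD; apply: kills_outer => //; apply: kills_vc.
Qed.

Section Transfer.
Variables (f : 'rV[K]_m) (F iF ik iq : K).
Hypothesis kf : kills f.
Let kp : kills (vd f) := kills_vd kf.
Let kA : kills (vA S f F iF).
Proof. by rewrite vAE; apply: killsB => //; apply: kills_vd. Qed.
Let kB : kills (vB S f F iF ik).
Proof. by rewrite vBE; apply: killsB => //; apply: kills_vd. Qed.
Let k5 : kills_mx (transfer5 S F iF ik f f).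
Proof.
apply: kills_mxD; last by apply: kills_mxZ; exact: kills_herm.
by apply: kills_mxD; [exact: kills_outer|apply: kills_mxZ; exact: kills_herm].
Qed.

Lemma kills_transfer7 : kills_mx (transfer7 S F iF ik iq f f).
Proof. by apply: kills_mxD => //; apply: kills_mxZ; exact: kills_herm. Qed.

Lemma kills_transfer6 : kills_mx (transfer6 S F iF ik iq f f).
Proof. by apply: kills_mxD => //; apply: kills_mxZ; exact: kills_outer. Qed.

(** The projector onto the span of the position and the tangent plane, for the totally geodesic case
    A = 0. *)
Definition transfer3 : 'M[K]_m := f^T *m f + iF *: herm S (vd f) (vd f).

Lemma kills_transfer3 : kills_mx transfer3.
Proof.
by apply: kills_mxD; [exact: kills_outer|apply: kills_mxZ; exact: kills_herm].
Qed.

End Transfer.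
End DifferentialIdeal.

Section TotallyGeodesic.
Variables (K : comPzRingType) (S : dring K) (m : nat) (f : 'rV[K]_m) (F iF : K).
Hypothesis H : harm S f F iF.
Local Notation d := (dd S).
Local Notation vd := (vd S).
Local Notation vc := (vc S).
Local Notation "x ^*" := (cj S x) : ring_scope.

Lemma transfer3_mul : f *m transfer3 S f iF = f.
Proof.
rewrite mulmxDr -scalemxAr mulmx_bdot bdot_herm (harm_norm H).
by rewrite (dot_fp H) (dot_fpb H) !scale0r !addr0 scaler0 addr0 scale1r.
Qed.

Lemma mxtrace_transfer3 : \tr (transfer3 S f iF) = 3%:R.
Proof.
have hi := harm_inv H.
rewrite !(mxtraceD, mxtraceZ) !mxtrace_outer (harm_norm H).
rewrite (bdotC (vc _)) (harm_fact H).
transitivity (1 + (F * iF) * 2%:R); first by ring.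
by rewrite hi; ring.
Qed.

Lemma transfer3E i j : transfer3 S f iF i j = f 0 i * f 0 j + iF * herm S (vd f) (vd f) i j.
Proof. by rewrite mxE outerE mxE. Qed.

Lemma cj_transfer3 i j : (transfer3 S f iF i j)^* = transfer3 S f iF i j.
Proof.
have cf s : (f 0 s)^* = f 0 s by have /rowP/(_ s) := harm_real H; rewrite mxE.
by rewrite transfer3E cjD !cjM !cf cj_herm (cjiF H).
Qed.

Lemma d_transfer3 i j : vA S f F iF = 0 -> d (transfer3 S f iF i j) = 0.
Proof.
move=> A0; have hi := harm_inv H.
have g1 s : d (d (f 0 s)) = lF S F iF * d (f 0 s).
  by have := vd_entry s (vdp S f F iF); rewrite A0 addr0 !mxE.
have g2 s : d (cj S (d (f 0 s))) = - F * f 0 s.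
  by have := vd_entry s (vdpb H); rewrite !mxE.
rewrite transfer3E hermE !mxE !(ddD, ddM) !g1 !g2 (diF S hi).
move: (cj S (d (f 0 i))) (cj S (d (f 0 j))) (d (f 0 i)) (d (f 0 j)) => a b a' b'.
transitivity ((1 - F * iF) * (a' * f 0 j + f 0 i * b')); first by ring.
by rewrite hi subrr mul0r.
Qed.

End TotallyGeodesic.

Section Transpose.
Variables (K : comPzRingType) (S : dring K) (m n : nat).
Variables (g : 'rV[K]_m) (f : 'rV[K]_n) (F iF ik iq : K).

(** Thus the transpose of the matrix carrying g to f carries f back to g, which is what makes it
    orthogonal in the end. *)
Lemma tr_transfer7 : (transfer7 S F iF ik iq g f)^T = transfer7 S F iF ik iq f g.
Proof.
by apply/matrixP => i j; rewrite mxE !transfer7E !transfer5E !hermE; ring.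
Qed.

End Transpose.

(** * Smooth complex functions of a plane variable *)

Section NearEq.
Context {R : realType} {V W : normedModType R}.

Lemma near_eq_differentiable (f g : V -> W) (x : V) :
  (\near x, f x = g x) -> differentiable f x -> differentiable g x.
Proof.
move=> fg df.
pose L : {linear V -> W} := 'd f x.
have Lc : continuous L by exact: diff_continuous.
have hg : g \o shift x = cst (g x) + L +o_ 0 id.
  apply/eqaddoP => e e0.
  have /eqaddoP/(_ e e0) := diff_locally df.
  have fgx := nbhs_singleton fg.
  have fg' : \forall h \near (0 : V), f (h + x) = g (h + x).
    by move: fg; rewrite (near_shift 0) subr0.
  apply: filterS2 fg' => h hfg /=.
  by rewrite -[(f \o shift x - _) h]/(f (h + x) - (f x + L h)) hfg fgx.
have dg : 'd g x = L :> (V -> W) by apply: diff_unique.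
by apply/diff_locallyP; rewrite dg.
Qed.

End NearEq.

Section Lines.
Context {R : realType} {V : normedModType R}.
Implicit Types (u : V -> R) (v w z : V).

Let line_quotient u v z (t : R) :
  (fun h : R => h^-1 *: (((fun t : R => u (t *: v + z)) \o shift t) (h *: (1 : R)) -
     u (t *: v + z))) =
  (fun h : R => h^-1 *: ((u \o shift (t *: v + z)) (h *: v) - u (t *: v + z))).
Proof.
apply/funext => h /=.
by congr (_ *: (u _ - _)); rewrite -[h *: 1]/(h * 1) mulr1 scalerDl addrA.
Qed.

Lemma derive_line u v z t :
  'D_1 (fun t : R => u (t *: v + z)) t = 'D_v u (t *: v + z).
Proof. by rewrite /derive line_quotient. Qed.

Lemma is_derive_line u v z t : derivable u (t *: v + z) v ->
  is_derive t 1 (fun t : R => u (t *: v + z)) ('D_v u (t *: v + z)).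
Proof.
by move=> du; apply: DeriveDef; [rewrite /derivable line_quotient|exact: derive_line].
Qed.

Lemma nbhs_norm_ball (D : set V) z : nbhs z D ->
  exists2 e : R, 0 < e & forall k, `|k| < e -> D (k + z).
Proof.
move=> /nbhs_ballP[e /= e0 He]; exists e => // k hk; apply: He.
by rewrite -ball_normE /ball_ /= opprD addrC subrK normrN.
Qed.

(** The mean value theorem in the direction v, applied to the difference of u along two parallel
    segments, leaves an increment of D_v u across h w. Differentiability of D_v u at the one point z
    estimates it. *)
Lemma second_difference u v w z (D : set V) : open D -> D z ->
  (forall y, D y -> differentiable u y) ->
  differentiable ('D_v u) z ->
  forall e, 0 < e -> exists2 r : R, 0 < r & forall h, 0 < h < r ->
    `|u (h *: v + (h *: w + z)) - u (h *: v + z) - u (h *: w + z) + u z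
      - h ^+ 2 * 'D_w ('D_v u) z| <= e * h ^+ 2.
Proof.
move=> oD Dz du dU e e0; set U := 'D_v u in dU *.
(* Two errors of size (e/c) h (|v| + |w|) arise, so c has to exceed 2 (|v| + |w|); the 1 keeps it
   positive. *)
pose c := 2 * (`|v| + `|w|) + 1.
have vw0 : 0 <= `|v| + `|w| by rewrite addr_ge0.
have c0 : 0 < c by rewrite /c; lra.
have ec0 := divr_gt0 e0 c0.
have /eqaddoP/(_ (e / c) ec0) := diff_locally dU.
move=> /nbhs_norm_ball[r r0 Hr].
have : nbhs z D by apply: open_nbhs_nbhs.
move=> /nbhs_norm_ball[r' r'0 Hr'].
exists (Num.min r r' / c); first by rewrite divr_gt0 // lt_min r0.
move=> h /andP[h0]; rewrite ltr_pdivlMr // lt_min => /andP[hr hr'].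
have small s t : 0 <= s <= h -> 0 <= t <= h ->
    `|s *: v + t *: w| <= h * (`|v| + `|w|).
  move=> /andP[s0 sh] /andP[t0 th].
  rewrite (le_trans (ler_normD _ _)) // !normrZ !ger0_norm // mulrDr.
  by rewrite lerD // ler_wpM2r.
have hc : h * (`|v| + `|w|) < h * c.
  by rewrite ltr_pM2l // /c; lra.
have inD s t : 0 <= s <= h -> 0 <= t <= h -> D (s *: v + (t *: w + z)).
  move=> hs ht; rewrite addrA; apply: Hr'.
  exact: (le_lt_trans (small s t hs ht) (lt_trans hc hr')).
have near_U s t : 0 <= s <= h -> 0 <= t <= h ->
    `|U (s *: v + (t *: w + z)) - U z - 'd U z (s *: v + t *: w)| <=
    e / c * (h * (`|v| + `|w|)).
  move=> hs ht; have hst := small s t hs ht.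
  have := Hr _ (le_lt_trans hst (lt_trans hc hr)).
  rewrite addr0 /= -[(U \o shift z - _) _]/(U _ - (U z + 'd U z _)) /= -addrA.
  rewrite opprD !addrA => /le_trans; apply.
  by rewrite ler_wpM2l // ltW.
pose phi t := u (t *: v + (h *: w + z)) - u (t *: v + (0 *: w + z)).
pose dphi t := U (t *: v + (h *: w + z)) - U (t *: v + (0 *: w + z)).
have hh : 0 <= h <= h by rewrite lexx ltW.
have h00 : (0 : R) <= 0 <= h by rewrite lexx ltW.
have dline t s : 0 <= s <= h -> 0 <= t <= h ->
    is_derive t 1 (fun t => u (t *: v + (s *: w + z))) (U (t *: v + (s *: w + z))).
  by move=> hs ht; apply: is_derive_line; apply: diff_derivable; apply/du/inD.
have dphiP t : 0 <= t <= h -> is_derive t 1 phi (dphi t).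
  by move=> ht; apply: is_deriveB; apply: dline.
have [||xi] := @MVT R phi dphi 0 h h0.
- by move=> t; rewrite in_itv /= => /andP[t0 th]; apply: dphiP; rewrite !ltW.
- apply: derivable_within_continuous => t; rewrite in_itv /= => ht.
  exact: (@ex_derive _ _ _ _ _ _ _ (dphiP t ht)).
- rewrite in_itv /= => /andP[xi0 xih].
have hxi : 0 <= xi <= h by rewrite !ltW.
rewrite /phi /dphi !scale0r !add0r subr0 => e1.
have -> : u (h *: v + (h *: w + z)) - u (h *: v + z) - u (h *: w + z) + u z =
   (U (xi *: v + (h *: w + z)) - U (xi *: v + z)) * h by rewrite -e1; ring.
have := near_U xi h hxi hh; have := near_U xi 0 hxi h00.
have dL a b : 'd U z (a *: v + b *: w) = a * 'd U z v + b * 'd U z w.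
  by rewrite linearD !linearZ.
rewrite !dL mul0r scale0r add0r addr0 deriveE //.
set Q := U (xi *: v + (h *: w + z)); set P := U (xi *: v + z).
set U0 := U z; set dv := 'd U z v; set dw := 'd U z w.
move=> n1 n2.
have -> : (Q - P) * h - h ^+ 2 * dw =
   h * ((Q - U0 - (xi * dv + h * dw)) - (P - U0 - xi * dv)) by ring.
rewrite normrM gtr0_norm // expr2 mulrCA ler_pM2l //.
apply: (le_trans (ler_normB _ _)); apply: (le_trans (lerD n2 n1)).
have -> : e / c * (h * (`|v| + `|w|)) + e / c * (h * (`|v| + `|w|)) =
  e * h * ((2 * (`|v| + `|w|)) / c).
  by field; rewrite gt_eqF.
rewrite ger_pMr ?mulr_gt0 // ler_pdivrMr // mul1r /c; lra.
Qed.

(** The second difference is symmetric in v and w, and divided by h^2 it tends to both mixed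
    derivatives. *)
Lemma derive_comm u v w z (D : set V) : open D -> D z ->
  (forall y, D y -> differentiable u y) ->
  differentiable ('D_v u) z -> differentiable ('D_w u) z ->
  'D_w ('D_v u) z = 'D_v ('D_w u) z.
Proof.
move=> oD Dz du dv dw; apply/eqP; rewrite -subr_eq0 -normr_le0.
apply/ler_addgt0Pl => e e0; rewrite addr0.
have e2 : 0 < e / 2 by rewrite divr_gt0.
have [r r0 Hr] := second_difference w oD Dz du dv e2.
have [s s0 Hs] := second_difference v oD Dz du dw e2.
pose h := Num.min r s / 2.
have h0 : 0 < h by rewrite divr_gt0 // lt_min r0.
have hm : h < Num.min r s by rewrite /h gtr_pMr ?lt_min ?r0 //; lra.
move: (hm); rewrite lt_min => /andP[hr hs].
have := Hr h; rewrite h0 hr => /(_ isT) n1.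
have := Hs h; rewrite h0 hs => /(_ isT) n2.
have hh : 0 < h ^+ 2 by rewrite exprn_gt0.
rewrite -(ler_pM2l hh) -{1}(gtr0_norm hh) -normrM mulrBr.
have e1 : h *: w + (h *: v + z) = h *: v + (h *: w + z) by rewrite addrCA.
rewrite e1 in n2.
move: ('D_w ('D_v u) z) ('D_v ('D_w u) z) n1 n2 => P Q n1 n2.
set a := h ^+ 2 * _ in n1 *; set b := h ^+ 2 * _ in n2 *.
set X := u _ - _ - _ + _ in n1; set Y := u _ - _ - _ + _ in n2.
have XY : X = Y by rewrite /X /Y; ring.
rewrite -XY in n2.
have -> : a - b = (X - b) - (X - a) by ring.
apply: (le_trans (ler_normB _ _)); apply: (le_trans (lerD n2 n1)).
by rewrite -mulrDl -splitr mulrC.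
Qed.

End Lines.

Local Open Scope complex_scope.

Section Ck.
Context {R : realType}.
Implicit Types (u v : plane R -> R) (w z : plane R).

Lemma derD u v w z : differentiable u z -> differentiable v z ->
  'D_w (fun x => u x + v x) z = 'D_w u z + 'D_w v z.
Proof. by move=> du dv; apply: deriveD; apply: diff_derivable. Qed.
Lemma derN u w z : differentiable u z -> 'D_w (fun x => - u x) z = - 'D_w u z.
Proof. by move=> du; apply: deriveN; apply: diff_derivable. Qed.
Lemma derM u v w z : differentiable u z -> differentiable v z ->
  'D_w (fun x => u x * v x) z = 'D_w u z * v z + u z * 'D_w v z.
Proof.
move=> du dv; have /= -> := @deriveM R _ u v z w (diff_derivable du) (diff_derivable dv).
by rewrite addrC mulrC.
Qed.
Lemma derV u w z : differentiable u z -> u z != 0 ->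
  'D_w (fun x => (u x)^-1) z = - ('D_w u z * ((u z)^-1 * (u z)^-1)).
Proof.
move=> du u0; have /= -> := @deriveV R _ u z w u0 (diff_derivable du).
by rewrite -[_ *: _]/(_ * _) -exprVn expr2; ring.
Qed.

Variables (D : set (plane R)) (oD : open D).

Fixpoint ck n u : Prop := (forall z, D z -> differentiable u z) /\
  if n is m.+1 then forall w, ck m ('D_w u) else True.

Lemma nearD z : D z -> \forall x \near z, D x.
Proof. by move=> Dz; apply: open_nbhs_nbhs. Qed.

Lemma der_ext u v w z : D z -> (forall z, D z -> u z = v z) -> 'D_w u z = 'D_w v z.
Proof.
by move=> Dz uv; apply: near_eq_derive; apply: filterS (nearD Dz) => x /uv.
Qed.

Lemma ck_ext n u v : (forall z, D z -> u z = v z) -> ck n u -> ck n v.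
Proof.
elim: n u v => [|n IH] u v uv [du hu]; split => //.
- move=> z Dz; apply: near_eq_differentiable (du z Dz).
  by apply: filterS (nearD Dz) => x /uv.
- move=> z Dz; apply: near_eq_differentiable (du z Dz).
  by apply: filterS (nearD Dz) => x /uv.
- by move=> w; apply: IH (hu w) => z Dz; apply: der_ext.
Qed.

Lemma ck_diff n u : ck n u -> forall z, D z -> differentiable u z.
Proof. by case: n => [|n] []. Qed.

Lemma ckW n u : ck n.+1 u -> ck n u.
Proof. by elim: n u => [|n IH] u [du hu]; split => // w; apply: IH. Qed.

Lemma ck_cst n (c : R) : ck n (fun _ => c).
Proof.
elim: n c => [|n IH] c; first by split=> // z _; apply: differentiable_cst.
split=> [z _|w]; first exact: differentiable_cst.
rewrite (_ : 'D_w _ = fun _ => 0) //; apply/funext => z.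
exact: derive_cst.
Qed.

Lemma ckD n u v : ck n u -> ck n v -> ck n (fun x => u x + v x).
Proof.
elim: n u v => [|n IH] u v hu hv.
  by split=> // z Dz; apply: differentiableD; [apply: (ck_diff hu)|apply: (ck_diff hv)].
split=> [z Dz|w].
  by apply: differentiableD; [apply: (ck_diff hu)|apply: (ck_diff hv)].
have [du ku] := hu; have [dv kv] := hv.
apply: ck_ext (IH _ _ (ku w) (kv w)) => z Dz.
by rewrite derD //; [apply: du|apply: dv].
Qed.

Lemma ckN n u : ck n u -> ck n (fun x => - u x).
Proof.
elim: n u => [|n IH] u hu.
  by split=> // z Dz; apply: differentiableN; apply: (ck_diff hu).
split=> [z Dz|w]; first by apply: differentiableN; apply: (ck_diff hu).
have [du ku] := hu.
by apply: ck_ext (IH _ (ku w)) => z Dz; rewrite derN //; apply: du.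
Qed.

Lemma ckM n u v : ck n u -> ck n v -> ck n (fun x => u x * v x).
Proof.
elim: n u v => [|n IH] u v hu hv.
  by split=> // z Dz; apply: differentiableM; [apply: (ck_diff hu)|apply: (ck_diff hv)].
split=> [z Dz|w].
  by apply: differentiableM; [apply: (ck_diff hu)|apply: (ck_diff hv)].
have [du ku] := hu; have [dv kv] := hv.
apply: ck_ext (ckD (IH _ _ (ku w) (ckW hv)) (IH _ _ (ckW hu) (kv w))) => z Dz.
by rewrite derM //; [apply: du|apply: dv].
Qed.

Lemma ckV n u : (forall z, D z -> u z != 0) -> ck n u -> ck n (fun x => (u x)^-1).
Proof.
move=> u0; elim: n => [|n IH] hu.
  by split=> // z Dz; apply: differentiableV; [apply: (ck_diff hu)|apply: u0].
split=> [z Dz|w].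
  by apply: differentiableV; [apply: (ck_diff hu)|apply: u0].
have [du ku] := hu; have iu := IH (ckW hu).
apply: ck_ext (ckN (ckM (ku w) (ckM iu iu))) => z Dz.
by rewrite derV //; [apply: du|apply: u0].
Qed.

End Ck.

Lemma ck_sub {R : realType} (D E : set (plane R)) n u : E `<=` D -> ck D n u -> ck E n u.
Proof.
move=> ED; elim: n u => [|n IH] u [du hu]; split=> //.
- by move=> z /ED /du.
- by move=> z /ED /du.
- by move=> w; apply: IH; apply: hu.
Qed.

Section ReIm.
Context {R : realType}.
Implicit Types x y : R[i].
Lemma complex_ext x y : Re x = Re y -> Im x = Im y -> x = y.
Proof. by case: x y => a b [c d] /= -> ->. Qed.
Lemma ReM x y : Re (x * y) = Re x * Re y - Im x * Im y.
Proof. by case: x y => a b []. Qed.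
Lemma ImM x y : Im (x * y) = Re x * Im y + Im x * Re y.
Proof. by case: x y => a b []. Qed.
Lemma ReD x y : Re (x + y) = Re x + Re y.
Proof. by case: x y => a b []. Qed.
Lemma ImD x y : Im (x + y) = Im x + Im y.
Proof. by case: x y => a b []. Qed.
Lemma ReN x : Re (- x) = - Re x.
Proof. by case: x. Qed.
Lemma ImN x : Im (- x) = - Im x.
Proof. by case: x. Qed.
Lemma ReJ x : Re (conjc x) = Re x.
Proof. by case: x. Qed.
Lemma ImJ x : Im (conjc x) = - Im x.
Proof. by case: x. Qed.
End ReIm.

Section ComplexFun.
Context {R : realType}.
Implicit Types (u v : plane R -> R[i]) (w z : plane R).

Definition refun u : plane R -> R := fun z => Re (u z).
Definition imfun u : plane R -> R := fun z => Im (u z).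
Definition ex : plane R := (1, 0).
Definition ey : plane R := (0, 1).

Definition cder w u : plane R -> R[i] :=
  fun z => 'D_w (refun u) z +i* 'D_w (imfun u) z.

(* Sealed, so that the conversion test never unfolds limits. *)
Lemma dz_ex : {f : (plane R -> R[i]) -> plane R -> R[i] |
  forall u z, f u z = (2^-1)%:C * (cder ex u z - 'i * cder ey u z)}.
Proof. by exists (fun u z => (2^-1)%:C * (cder ex u z - 'i * cder ey u z)). Qed.

Definition dz : (plane R -> R[i]) -> plane R -> R[i] := sval dz_ex.

Lemma dzE u z : dz u z = (2^-1)%:C * (cder ex u z - 'i * cder ey u z).
Proof. exact: (svalP dz_ex). Qed.

Definition cdiff u z := differentiable (refun u) z /\ differentiable (imfun u) z.

Definition csm (D : set (plane R)) u := forall n, ck D n (refun u) /\ ck D n (imfun u).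

Lemma cderD w u v z : cdiff u z -> cdiff v z ->
  cder w (fun x => u x + v x) z = cder w u z + cder w v z.
Proof.
move=> [ru iu] [rv iv]; rewrite /cder.
rewrite (_ : refun _ = fun x => refun u x + refun v x); last first.
  by apply/funext => x; apply: ReD.
rewrite (_ : imfun _ = fun x => imfun u x + imfun v x); last first.
  by apply/funext => x; apply: ImD.
by rewrite !derD.
Qed.

Lemma cderM w u v z : cdiff u z -> cdiff v z ->
  cder w (fun x => u x * v x) z = cder w u z * v z + u z * cder w v z.
Proof.
move=> [ru iu] [rv iv]; rewrite /cder.
rewrite (_ : refun _ = fun x => refun u x * refun v x + - (imfun u x * imfun v x)); last first.
  by apply/funext => x; apply: ReM.
rewrite (_ : imfun (fun x => u x * v x) = fun x => refun u x * imfun v x + imfun u x * refun v x); last first.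
  by apply/funext => x; apply: ImM.
have dM (a b : plane R -> R) : differentiable a z -> differentiable b z ->
  differentiable (fun x => a x * b x) z by exact: differentiableM.
have dN (a : plane R -> R) : differentiable a z -> differentiable (fun x => - a x) z.
  by exact: differentiableN.
rewrite !derD ?derN ?derM //; try by [exact: dM|apply: dN; exact: dM].
by apply: complex_ext; rewrite ?(ReD, ReM, ImD, ImM) /= /refun /imfun; ring.
Qed.

Lemma cder_conj w u z : cdiff u z ->
  cder w (fun x => conjc (u x)) z = conjc (cder w u z).
Proof.
move=> [ru iu]; rewrite /cder.
rewrite (_ : refun _ = refun u); last by apply/funext => x; apply: ReJ.
rewrite (_ : imfun (fun x => conjc (u x)) = fun x => - imfun u x); last by apply/funext => x; apply: ImJ.
by rewrite derN.
Qed.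

Lemma dzD u v z : cdiff u z -> cdiff v z ->
  dz (fun x => u x + v x) z = dz u z + dz v z.
Proof.
move=> hu hv; rewrite !dzE (cderD ex hu hv) (cderD ey hu hv).
move: (cder ex u z) (cder ey u z) (cder ex v z) (cder ey v z) => a b c e.
by move: ((2^-1)%:C) => h; ring.
Qed.

Lemma dzM u v z : cdiff u z -> cdiff v z ->
  dz (fun x => u x * v x) z = dz u z * v z + u z * dz v z.
Proof.
move=> hu hv; rewrite !dzE (cderM ex hu hv) (cderM ey hu hv).
move: (cder ex u z) (cder ey u z) (cder ex v z) (cder ey v z) => a b c e.
by move: ((2^-1)%:C) (u z) (v z) => h x y; ring.
Qed.

Section OnOpen.
Variables (D : set (plane R)) (oD : open D).

Lemma csm_ext u v : (forall z, D z -> u z = v z) -> csm D u -> csm D v.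
Proof.
by move=> uv hu n; have [h1 h2] := hu n; split;
  [apply: ck_ext h1|apply: ck_ext h2] => // z Dz; rewrite /refun /imfun uv.
Qed.

Lemma csm_diff u z : csm D u -> D z -> cdiff u z.
Proof. by move=> /(_ 0%N)[[h1 _] [h2 _]] Dz; split; [apply: h1|apply: h2]. Qed.

Lemma cder_ext w u v z : D z -> (forall z, D z -> u z = v z) -> cder w u z = cder w v z.
Proof.
by move=> Dz uv; congr (_ +i* _); apply: der_ext Dz _ => // x Dx;
  rewrite /refun /imfun uv.
Qed.

Lemma dz_ext u v z : D z -> (forall z, D z -> u z = v z) -> dz u z = dz v z.
Proof. by move=> Dz uv; rewrite !dzE !(cder_ext _ Dz uv). Qed.

Lemma csm_cst (c : R[i]) : csm D (fun _ => c).
Proof. by move=> n; split; apply: ck_cst. Qed.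

Lemma csmD u v : csm D u -> csm D v -> csm D (fun x => u x + v x).
Proof.
move=> hu hv n; have [h1 h2] := hu n; have [h3 h4] := hv n; split.
  apply: ck_ext (ckD oD h1 h3) => // z _.
  by rewrite /refun ReD.
apply: ck_ext (ckD oD h2 h4) => // z _.
by rewrite /imfun ImD.
Qed.

Lemma csmN u : csm D u -> csm D (fun x => - u x).
Proof.
move=> hu n; have [h1 h2] := hu n; split.
  by apply: ck_ext (ckN oD h1) => // z _; rewrite /refun ReN.
by apply: ck_ext (ckN oD h2) => // z _; rewrite /imfun ImN.
Qed.

Lemma csmM u v : csm D u -> csm D v -> csm D (fun x => u x * v x).
Proof.
move=> hu hv n; have [h1 h2] := hu n; have [h3 h4] := hv n; split.
  apply: ck_ext (ckD oD (ckM oD h1 h3) (ckN oD (ckM oD h2 h4))) => // z _.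
  by rewrite /refun /imfun ReM.
apply: ck_ext (ckD oD (ckM oD h1 h4) (ckM oD h2 h3)) => // z _.
by rewrite /refun /imfun ImM.
Qed.

Lemma csm_conj u : csm D u -> csm D (fun x => conjc (u x)).
Proof.
move=> hu n; have [h1 h2] := hu n; split.
  by apply: ck_ext h1 => // z _; rewrite /refun ReJ.
by apply: ck_ext (ckN oD h2) => // z _; rewrite /imfun ImJ.
Qed.

Lemma csm_cder w u : csm D u -> csm D (cder w u).
Proof. by move=> hu n; have [[_ h1] [_ h2]] := hu n.+1; split; [apply: h1|apply: h2]. Qed.

Lemma csm_dz u : csm D u -> csm D (dz u).
Proof.
move=> hu; apply: (csm_ext (fun z _ => esym (dzE u z))).
apply: csmM; first exact: csm_cst.
apply: csmD; first exact: csm_cder.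
by apply: csmN; apply: csmM; [exact: csm_cst|exact: csm_cder].
Qed.

Lemma csmV u : (forall z, D z -> u z != 0) -> csm D u -> csm D (fun x => (u x)^-1).
Proof.
move=> u0 hu n; have [h1 h2] := hu n.
pose N x := refun u x * refun u x + imfun u x * imfun u x.
have N0 z : D z -> N z != 0.
  move=> /u0; apply: contra; rewrite /N -!expr2 paddr_eq0 ?sqr_ge0 //.
  by rewrite !expf_eq0 /= /refun /imfun eq_complex.
have hN : ck D n N by apply: ckD => //; apply: ckM.
have hV := ckV oD N0 hN.
split.
  apply: ck_ext (ckM oD h1 hV) => // z _.
  by rewrite /N /refun /imfun; case: (u z) => a b /=.
apply: ck_ext (ckN oD (ckM oD h2 hV)) => // z _.
by rewrite /N /refun /imfun; case: (u z) => a b /=.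
Qed.

Lemma cder_comm w' w u z : csm D u -> D z -> cder w (cder w' u) z = cder w' (cder w u) z.
Proof.
move=> hu Dz; have [[h1 k1] [h2 k2]] := hu 1%N.
have e (a : plane R -> R) : (forall y, D y -> differentiable a y) ->
    (forall s : plane R, ck D 0 ('D_s a)) -> 'D_w ('D_w' a) z = 'D_w' ('D_w a) z.
  move=> da ka; apply: (derive_comm oD Dz) => //.
    by have [h _] := ka w'; apply: h.
  by have [h _] := ka w; apply: h.
by apply: complex_ext; [exact: (e (refun u) h1 k1)|exact: (e (imfun u) h2 k2)].
Qed.

Lemma cderZ w (c : R[i]) u z : cdiff u z -> cder w (fun x => c * u x) z = c * cder w u z.
Proof.
move=> hu; rewrite cderM //; last by split; apply: differentiable_cst.
rewrite {1}/cder (_ : refun _ = cst (Re c)) // (_ : imfun _ = cst (Im c)) //.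
by rewrite !derive_cst mul0r add0r.
Qed.

(** Writing d dbar as a quarter of the Laplacian exhibits its invariance under conjugation, from
    which the axiom [ddC] is derived. *)
Lemma dz_lap u z : csm D u -> D z ->
  dz (fun x => conjc (dz (fun y => conjc (u y)) x)) z =
  (4^-1)%:C * (cder ex (cder ex u) z + cder ey (cder ey u) z).
Proof.
move=> hu Dz.
have e1 x : D x -> conjc (dz (fun y => conjc (u y)) x) =
    (2^-1)%:C * (cder ex u x + 'i * cder ey u x).
  move=> Dx; have du := csm_diff hu Dx; rewrite dzE (cder_conj ex du) (cder_conj ey du).
  move: (cder ex u x) (cder ey u x) => a b.
  by apply: complex_ext; rewrite ?(ReJ, ImJ, ReM, ImM, ReD, ImD, ReN, ImN) /=
    ?(ReJ, ImJ); ring.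
rewrite (dz_ext Dz e1).
have hx := csm_cder ex hu; have hy := csm_cder ey hu.
have dx := csm_diff hx Dz; have dy := csm_diff hy Dz.
have diy : cdiff (fun x => 'i * cder ey u x) z.
  by apply: csm_diff Dz; apply: csmM => //; apply: csm_cst.
have ds : cdiff (fun x => cder ex u x + 'i * cder ey u x) z.
  by apply: csm_diff Dz; apply: csmD => //; apply: csmM => //; apply: csm_cst.
have cE w : cder w (fun x => (2^-1)%:C * (cder ex u x + 'i * cder ey u x)) z =
    (2^-1)%:C * (cder w (cder ex u) z + 'i * cder w (cder ey u) z).
  by rewrite (cderZ w _ ds) (cderD w dx diy) (cderZ w 'i dy).
rewrite dzE (cE ex) (cE ey) (cder_comm ey ex hu Dz).
have -> : ((4^-1 : R))%:C = (2^-1)%:C * (2^-1)%:C :> R[i].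
  by rewrite -rmorphM /=; congr (_%:C); field.
have gen (K : comPzRingType) (h i a b c : K) : i * i = -1 ->
    h * (h * (a + i * b) - i * (h * (b + i * c))) = h * h * (a + c).
  by move=> i2; ring: i2.
by apply: gen; rewrite -expr2 sqr_i.
Qed.

End OnOpen.
End ComplexFun.

Record opn (R : realType) := Opn { oset :> set (plane R); oopen : open oset }.

(* Smooth complex functions on an open set; the value outside is forced to be
   [0] so that Leibniz equality is equality on the open set. *)
Record sfun (R : realType) (D : opn R) := SFun {
  sfv :> plane R -> R[i];
  sf_smooth : csm D sfv;
  sf_out : forall z, ~ oset D z -> sfv z = 0
}.

Section SFun.
Context {R : realType} (D : opn R).
Local Notation K := (sfun D).
Implicit Types (a b c : K) (u v : plane R -> R[i]).
Let oD := @oopen R D.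

Lemma sfunP a b : (forall z, oset D z -> a z = b z) -> a = b.
Proof.
move=> ab; have : sfv a = sfv b.
  apply/funext => z; have [/ab //|nD] := pselect (oset D z).
  by rewrite !sf_out.
case: a b {ab} => a sa oa [b sb ob] /= e; subst b.
by congr SFun; apply: Prop_irrelevance.
Qed.

Definition restr u : plane R -> R[i] := fun z => if pselect (oset D z) is left _ then u z else 0.

Lemma restrE u z : oset D z -> restr u z = u z.
Proof. by rewrite /restr; case: pselect. Qed.

Lemma restr_out u z : ~ oset D z -> restr u z = 0.
Proof. by rewrite /restr; case: pselect. Qed.

Lemma restr_smooth u : csm D u -> csm D (restr u).
Proof. by apply: csm_ext => // z Dz; rewrite restrE. Qed.

Definition mkS u (hu : csm D u) : K := SFun (restr_smooth hu) (@restr_out u).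

Lemma mkSE u (hu : csm D u) z : oset D z -> mkS hu z = u z.
Proof. exact: restrE. Qed.

HB.instance Definition _ := gen_eqMixin K.
HB.instance Definition _ := gen_choiceMixin K.

Lemma sf_cst_ex : {f : R[i] -> K | forall (c : R[i]) z, oset D z -> f c z = c}.
Proof. by exists (fun x => mkS (csm_cst D x)) => x z; apply: mkSE. Qed.
Lemma sf_add_ex : {f : K -> K -> K | forall a b z, oset D z -> f a b z = a z + b z}.
Proof.
by exists (fun a b => mkS (csmD oD (sf_smooth a) (sf_smooth b))) => a b z; apply: mkSE.
Qed.
Lemma sf_opp_ex : {f : K -> K | forall a z, oset D z -> f a z = - a z}.
Proof. by exists (fun a => mkS (csmN oD (sf_smooth a))) => a z; apply: mkSE. Qed.
Lemma sf_mul_ex : {f : K -> K -> K | forall a b z, oset D z -> f a b z = a z * b z}.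
Proof.
by exists (fun a b => mkS (csmM oD (sf_smooth a) (sf_smooth b))) => a b z; apply: mkSE.
Qed.
Lemma sf_dd_ex : {f : K -> K | forall a z, oset D z -> f a z = dz a z}.
Proof. by exists (fun a => mkS (csm_dz oD (sf_smooth a))) => a z; apply: mkSE. Qed.
Lemma sf_cj_ex : {f : K -> K | forall a z, oset D z -> f a z = conjc (a z)}.
Proof. by exists (fun a => mkS (csm_conj oD (sf_smooth a))) => a z; apply: mkSE. Qed.

(* The operations go through opaque existence lemmas so that the conversion
   test never unfolds limits. *)
Definition sf_cst : R[i] -> K := sval sf_cst_ex.
Definition sf_add : K -> K -> K := sval sf_add_ex.
Definition sf_opp : K -> K := sval sf_opp_ex.
Definition sf_mul : K -> K -> K := sval sf_mul_ex.
Definition sf_dd : K -> K := sval sf_dd_ex.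
Definition sf_cj : K -> K := sval sf_cj_ex.

Lemma sf_cstE (c : R[i]) z : oset D z -> sf_cst c z = c.
Proof. exact: (svalP sf_cst_ex). Qed.
Lemma sf_addE a b z : oset D z -> sf_add a b z = a z + b z.
Proof. exact: (svalP sf_add_ex). Qed.
Lemma sf_oppE a z : oset D z -> sf_opp a z = - a z.
Proof. exact: (svalP sf_opp_ex). Qed.
Lemma sf_mulE a b z : oset D z -> sf_mul a b z = a z * b z.
Proof. exact: (svalP sf_mul_ex). Qed.
Lemma sf_ddE a z : oset D z -> sf_dd a z = dz a z.
Proof. exact: (svalP sf_dd_ex). Qed.
Lemma sf_cjE a z : oset D z -> sf_cj a z = conjc (a z).
Proof. exact: (svalP sf_cj_ex). Qed.

Lemma sf_addA : associative sf_add.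
Proof. by move=> a b c; apply: sfunP => z Dz; rewrite !(sf_cstE, sf_addE, sf_oppE, sf_mulE) // addrA. Qed.
Lemma sf_addC : commutative sf_add.
Proof. by move=> a b; apply: sfunP => z Dz; rewrite !(sf_cstE, sf_addE, sf_oppE, sf_mulE) // addrC. Qed.
Lemma sf_add0 : left_id (sf_cst 0) sf_add.
Proof. by move=> a; apply: sfunP => z Dz; rewrite !(sf_cstE, sf_addE, sf_oppE, sf_mulE) // add0r. Qed.
Lemma sf_addN : left_inverse (sf_cst 0) sf_opp sf_add.
Proof. by move=> a; apply: sfunP => z Dz; rewrite !(sf_cstE, sf_addE, sf_oppE, sf_mulE) // addNr. Qed.
HB.instance Definition _ := GRing.isZmodule.Build K sf_addA sf_addC sf_add0 sf_addN.

Lemma sf_mulA : associative sf_mul.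
Proof. by move=> a b c; apply: sfunP => z Dz; rewrite !(sf_cstE, sf_addE, sf_oppE, sf_mulE) // mulrA. Qed.
Lemma sf_mulC : commutative sf_mul.
Proof. by move=> a b; apply: sfunP => z Dz; rewrite !(sf_cstE, sf_addE, sf_oppE, sf_mulE) // mulrC. Qed.
Lemma sf_mul1 : left_id (sf_cst 1) sf_mul.
Proof. by move=> a; apply: sfunP => z Dz; rewrite !(sf_cstE, sf_addE, sf_oppE, sf_mulE) // mul1r. Qed.
Lemma sf_mulDl : left_distributive sf_mul sf_add.
Proof. by move=> a b c; apply: sfunP => z Dz; rewrite !(sf_mulE, sf_addE) // mulrDl. Qed.
HB.instance Definition _ := GRing.Zmodule_isComPzRing.Build K
  sf_mulA sf_mulC sf_mul1 sf_mulDl.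

Lemma sfDE a b z : oset D z -> (a + b) z = a z + b z. Proof. exact: sf_addE. Qed.
Lemma sfNE a z : oset D z -> (- a) z = - a z. Proof. exact: sf_oppE. Qed.
Lemma sfME a b z : oset D z -> (a * b) z = a z * b z. Proof. exact: sf_mulE. Qed.
Lemma sf0E z : oset D z -> (0 : K) z = 0. Proof. exact: sf_cstE. Qed.
Lemma sf1E z : oset D z -> (1 : K) z = 1. Proof. exact: sf_cstE. Qed.
Lemma sf_sumE (I : finType) (F : I -> K) z : oset D z ->
  (\sum_i F i) z = \sum_i (F i) z.
Proof.
move=> Dz; apply: (big_morph (fun a : K => a z)); last exact: sf0E.
by move=> a b; apply: sfDE.
Qed.
Lemma sfXE a n z : oset D z -> (a ^+ n) z = a z ^+ n.
Proof. by move=> Dz; elim: n => [|n IH]; rewrite ?sf1E // !exprS sfME // IH. Qed.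

Lemma sf_diff a z : oset D z -> cdiff a z.
Proof. by move=> Dz; apply: csm_diff (sf_smooth a) Dz. Qed.

Lemma sf_ddD a b : sf_dd (a + b) = sf_dd a + sf_dd b.
Proof.
apply: sfunP => z Dz; rewrite (sfDE _ _ Dz) !(sf_ddE _ Dz).
rewrite -dzD; [|exact: sf_diff|exact: sf_diff].
by apply: (dz_ext oD Dz) => x Dx; rewrite sfDE.
Qed.
Lemma sf_ddM a b : sf_dd (a * b) = sf_dd a * b + a * sf_dd b.
Proof.
apply: sfunP => z Dz; rewrite (sfDE _ _ Dz) !(sfME _ _ Dz) !(sf_ddE _ Dz).
rewrite -dzM; [|exact: sf_diff|exact: sf_diff].
by apply: (dz_ext oD Dz) => x Dx; rewrite sfME.
Qed.
Lemma sf_cjD a b : sf_cj (a + b) = sf_cj a + sf_cj b.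
Proof. by apply: sfunP => z Dz; rewrite (sfDE _ _ Dz) !(sf_cjE _ Dz) (sfDE _ _ Dz) rmorphD. Qed.
Lemma sf_cjM a b : sf_cj (a * b) = sf_cj a * sf_cj b.
Proof. by apply: sfunP => z Dz; rewrite (sfME _ _ Dz) !(sf_cjE _ Dz) (sfME _ _ Dz) rmorphM. Qed.
Lemma sf_cjK : involutive sf_cj.
Proof. by move=> a; apply: sfunP => z Dz; rewrite !(sf_cjE _ Dz) conjcK. Qed.

Lemma sf_cjdE a z : oset D z -> sf_cj (sf_dd (sf_cj a)) z = conjc (dz (fun y => conjc (a y)) z).
Proof.
move=> Dz; rewrite (sf_cjE _ Dz) (sf_ddE _ Dz); congr conjc.
apply: (dz_ext oD Dz) => x Dx.
exact: sf_cjE.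
Qed.

Lemma sf_lap a z : oset D z -> sf_dd (sf_cj (sf_dd (sf_cj a))) z =
  (4^-1)%:C%C * (cder ex (cder ex a) z + cder ey (cder ey a) z).
Proof.
move=> Dz; rewrite -(dz_lap oD (sf_smooth a) Dz).
rewrite (sf_ddE _ Dz).
apply: (dz_ext oD Dz) => x Dx.
exact: sf_cjdE.
Qed.

Lemma sf_ddC a : sf_dd (sf_cj (sf_dd (sf_cj a))) = sf_cj (sf_dd (sf_cj (sf_dd a))).
Proof.
have h : sf_cj (sf_dd (sf_cj (sf_dd (sf_cj (sf_cj a))))) =
         sf_dd (sf_cj (sf_dd (sf_cj a))).
  apply: sfunP => z Dz.
  rewrite (sf_cjE _ Dz) (sf_lap (sf_cj a) Dz) (sf_lap a Dz).
  have e w x : oset D x -> cder w (sf_cj a) x = conjc (cder w a x).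
    move=> Dx; rewrite -(cder_conj w (sf_diff a Dx)).
    by apply: (cder_ext oD w Dx) => y Dy; apply: sf_cjE.
  have e2 w : cder w (cder w (sf_cj a)) z = conjc (cder w (cder w a) z).
    have hd : cdiff (cder w a) z by apply: csm_diff Dz; apply/csm_cder/sf_smooth.
    rewrite -(cder_conj w hd).
    by apply: (cder_ext oD w Dz) => y Dy; apply: e.
  have gen (r : R) (x y : R[i]) :
    conjc (r%:C%C * (conjc x + conjc y)) = r%:C%C * (x + y).
    by apply: complex_ext; rewrite !(ReJ, ImJ, ReM, ImM, ReD, ImD) /=; ring.
  by rewrite !e2; exact: gen.
by rewrite -h sf_cjK.
Qed.

Lemma sf_halfP : sf_cst (2^-1)%:C%C + sf_cst (2^-1)%:C%C = 1.
Proof.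
apply: sfunP => z Dz; rewrite sfDE // sf_cstE // sf1E // -rmorphD /=.
by congr (_%:C%C); field.
Qed.

Lemma conj_sum0 m (x : 'I_m -> R[i]) :
  \sum_i x i * conjc (x i) = 0 -> forall i, x i = 0.
Proof.
move=> /eqP; rewrite psumr_eq0; last by move=> i _; rewrite mul_conjC_ge0.
move=> /allP h i; have := h i; rewrite mem_index_enum => /(_ isT) /=.
by rewrite mul_conjC_eq0 => /eqP.
Qed.

Lemma sf_pos m (u : 'rV[K]_m) : \sum_i u 0 i * sf_cj (u 0 i) = 0 -> u = 0.
Proof.
move=> h; apply/rowP => i; rewrite mxE; apply: sfunP => z Dz; rewrite (sf0E Dz).
apply: (conj_sum0 (x := fun i => u 0 i z)) i.
have /= h' := congr1 (fun a : K => a z) h; rewrite (sf_sumE _ Dz) (sf0E Dz) in h'.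
rewrite -[RHS]h'.
by apply: eq_bigr => i _; rewrite (sfME _ _ Dz) (sf_cjE _ Dz).
Qed.

Definition sfd : dring K := DRing sf_ddD sf_ddM sf_cjD sf_cjM sf_cjK sf_ddC
  sf_halfP sf_pos.

Lemma sfddE a z : oset D z -> dd sfd a z = dz a z. Proof. exact: sf_ddE. Qed.
Lemma sfcjE a z : oset D z -> cj sfd a z = conjc (a z). Proof. exact: sf_cjE. Qed.
Lemma sfdbE a z : oset D z -> db sfd a z = conjc (dz (fun y => conjc (a y)) z).
Proof. exact: sf_cjdE. Qed.

Lemma sf_inv a : (forall z, oset D z -> a z != 0) ->
  exists2 b : K, a * b = 1 & forall z, oset D z -> b z = (a z)^-1.
Proof.
move=> a0; exists (mkS (csmV oD a0 (sf_smooth a))); last by move=> z; apply: mkSE.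
by apply: sfunP => z Dz; rewrite sfME // mkSE // sf1E // divff // a0.
Qed.

End SFun.

(** * Pointwise invariants of a map *)

Section Raw.
Context {R : realType} (m : nat).
Local Notation C := (R[i]).
Implicit Types (V W : plane R -> 'rV[C]_m) (F : plane R -> 'rV[R]_m).

Definition vconj (v : 'rV[C]_m) : 'rV[C]_m := map_mx conjc v.
Definition rdz V : plane R -> 'rV[C]_m := fun z => \row_j dz (fun x => V x 0 j) z.
Definition vdiff V z := forall j, cdiff (fun x => V x 0 j) z.
Definition vsm (D : set (plane R)) V := forall j, csm D (fun x => V x 0 j).
Definition cvec F : plane R -> 'rV[C]_m := fun z => map_mx (real_complex R) (F z).

(** Pointwise versions of df, F and A, built from the map alone. Unlike elements of [sfun D] they
    refer to no open set, so values in different charts can be compared. In [rA] the quotient <dp,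
    conj p>/F stands for dF/F. *)
Definition rP F := rdz (cvec F).
Definition rF F z : C := bdot (rP F z) (vconj (rP F z)).
Definition rA F z := rdz (rP F) z - (bdot (rdz (rP F) z) (vconj (rP F z)) / rF F z) *: rP F z.

Lemma rdz_ext (D : set (plane R)) V W z : open D -> D z -> (forall x, D x -> V x = W x) ->
  rdz V z = rdz W z.
Proof.
by move=> oD Dz VW; apply/rowP => j; rewrite !mxE; apply: (dz_ext oD Dz) => x Dx; rewrite VW.
Qed.

Section Eval.
Variable D : opn R.
Local Notation K := (sfun D).

Definition evv z (u : 'rV[K]_m) : 'rV[C]_m := map_mx (fun a : K => a z) u.

Lemma evv_bdot z (u v : 'rV[K]_m) : oset D z -> (bdot u v) z = bdot (evv z u) (evv z v).
Proof.
by move=> Dz; rewrite sf_sumE //; apply: eq_bigr => i _; rewrite sfME // !mxE.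
Qed.
Lemma evvD z (u v : 'rV[K]_m) : oset D z -> evv z (u + v) = evv z u + evv z v.
Proof. by move=> Dz; apply/rowP => i; rewrite !mxE sfDE. Qed.
Lemma evvN z (u : 'rV[K]_m) : oset D z -> evv z (- u) = - evv z u.
Proof. by move=> Dz; apply/rowP => i; rewrite !mxE sfNE. Qed.
Lemma evvZ z (a : K) (u : 'rV[K]_m) : oset D z -> evv z (a *: u) = a z *: evv z u.
Proof. by move=> Dz; apply/rowP => i; rewrite !mxE sfME. Qed.
Lemma evv_vc z (u : 'rV[K]_m) : oset D z -> evv z (vc (sfd D) u) = vconj (evv z u).
Proof. by move=> Dz; apply/rowP => i; rewrite !mxE sfcjE. Qed.
Lemma evv_vd z (u : 'rV[K]_m) V : oset D z -> (forall x, oset D x -> evv x u = V x) ->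
  evv z (vd (sfd D) u) = rdz V z.
Proof.
move=> Dz uV; apply/rowP => i; rewrite !mxE sfddE //.
by apply: (dz_ext (@oopen _ D) Dz) => x /uV <-; rewrite mxE.
Qed.
Lemma evvP (u v : 'rV[K]_m) : (forall z, oset D z -> evv z u = evv z v) -> u = v.
Proof.
move=> uv; apply/rowP => i; apply: sfunP => z /uv /rowP/(_ i).
by rewrite !mxE.
Qed.

Definition vecK V (hV : vsm D V) : 'rV[K]_m := \row_j mkS (hV j).
Lemma vecKE V (hV : vsm D V) z : oset D z -> evv z (vecK hV) = V z.
Proof. by move=> Dz; apply/rowP => i; rewrite !mxE mkSE. Qed.
Lemma evv_vsm (u : 'rV[K]_m) : vsm D (fun z => evv z u).
Proof.
move=> j; apply: (csm_ext (@oopen _ D)) (sf_smooth (u 0 j)) => z Dz.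
by rewrite mxE.
Qed.

End Eval.
End Raw.

Section SmoothOn.
Context {R : realType} (n : nat).
Local Notation C := R[i].
Implicit Types F : plane R -> 'rV[R]_n.+1.

Lemma der_coord F z v j : derivable F z v -> ('D_v F z) 0 j = 'D_v (fun x => F x 0 j) z.
Proof. by move=> dF; rewrite (derive_mx dF) mxE. Qed.

Lemma diff_coord F z j : differentiable F z -> differentiable (fun x => F x 0 j) z.
Proof.
move=> dF; apply: (@differentiable_comp _ _ _ _ F (fun M : 'rV[R]_n.+1 => M 0 j)) => //.
exact: differentiable_coord.
Qed.

Lemma smooth_on_D (D : set (plane R)) F v : smooth_on D F -> smooth_on D ('D_v F).
Proof. by move=> hF vs z Dz; have := hF (rcons vs v) z Dz; rewrite foldr_rcons. Qed.

Lemma smooth_on_ck (D : set (plane R)) (oD : open D) F j k : smooth_on D F ->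
  ck D k (fun x => F x 0 j).
Proof.
elim: k F => [|k IH] F hF.
  by split=> // z Dz; apply: diff_coord; apply: (hF [::]).
split=> [z Dz|w]; first by apply: diff_coord; apply: (hF [::]).
apply: (ck_ext oD) (IH _ (smooth_on_D w hF)) => z Dz.
by rewrite der_coord //; apply: diff_derivable; apply: (hF [::]).
Qed.

Lemma cvec_sm (D : set (plane R)) (oD : open D) F : smooth_on D F -> vsm D (cvec F).
Proof.
move=> hF j k; split.
  by apply: (ck_ext oD) (smooth_on_ck oD j k hF) => z _; rewrite /refun /cvec mxE.
apply: (ck_ext oD) (ck_cst D k 0) => z _; by rewrite /imfun /cvec mxE.
Qed.

Lemma smooth_sub (D E : set (plane R)) F : E `<=` D -> smooth_on D F -> smooth_on E F.
Proof. by move=> ED hF vs z /ED; apply: hF. Qed.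

Lemma rP_der F z : differentiable F z ->
  rP F z = (2^-1)%:C *: (map_mx (real_complex R) ('D_ex F z) -
                        'i *: map_mx (real_complex R) ('D_ey F z)).
Proof.
move=> dF; have dd := diff_derivable dF.
apply/rowP => j; rewrite !mxE dzE /cder.
have -> : refun (fun x => cvec F x 0 j) = fun x => F x 0 j.
  by apply/funext => x; rewrite /refun mxE.
have -> : imfun (fun x => cvec F x 0 j) = cst 0.
  by apply/funext => x; rewrite /imfun mxE.
rewrite !derive_cst; move: (der_coord j (dd ex)) (der_coord j (dd ey)).
by move: ('D_ex F z) ('D_ey F z) => a b -> ->.
Qed.

Lemma bdot_real (u v : 'rV[R]_n.+1) :
  bdot (map_mx (real_complex R) u) (map_mx (real_complex R) v) = (dot u v)%:C.
Proof. by rewrite rmorph_sum; apply: eq_bigr => i _; rewrite !mxE rmorphM. Qed.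

Lemma bdot_pair (K : comPzRingType) k (h i : K) (u v : 'rV[K]_k) :
  bdot (h *: (u - i *: v)) (h *: (u - i *: v)) =
    h * h * (bdot u u + i * i * bdot v v - i * (bdot u v *+ 2)) /\
  bdot (h *: (u - i *: v)) (h *: (u + i *: v)) =
    h * h * (bdot u u - i * i * bdot v v).
Proof. by rewrite !bdotE (bdotC v u); split; ring. Qed.

Lemma real_quarter : (4^-1)%:C = (2^-1)%:C * (2^-1)%:C :> R[i].
Proof. by rewrite -rmorphM /=; congr (_%:C); field. Qed.

Lemma vconj_pair (a b : 'rV[R]_n.+1) :
  vconj ((2^-1)%:C *: (map_mx (real_complex R) a - 'i *: map_mx (real_complex R) b)) =
    (2^-1)%:C *: (map_mx (real_complex R) a + 'i *: map_mx (real_complex R) b).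
Proof.
apply/rowP => j; rewrite !mxE.
by apply: complex_ext; rewrite /=; ring.
Qed.

Lemma rP_conf F z : differentiable F z ->
  bdot (rP F z) (rP F z) = (4^-1)%:C *
    ((induced_metric F z ex ex - induced_metric F z ey ey)%:C -
     'i * (induced_metric F z ex ey *+ 2)%:C).
Proof.
move=> dF; rewrite (rP_der dF) /induced_metric.
move: ('D_ex F z) ('D_ey F z) => a b.
have [-> _] := bdot_pair ((2^-1)%:C : C) 'i (map_mx (real_complex R) a)
  (map_mx (real_complex R) b).
rewrite !bdot_real real_quarter; move: (dot a a) (dot b b) (dot a b) => x y t.
by apply: complex_ext; rewrite /=; ring.
Qed.

Lemma rF_metric F z : differentiable F z ->
  rF F z = (4^-1 * (induced_metric F z ex ex + induced_metric F z ey ey))%:C.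
Proof.
move=> dF; rewrite /rF (rP_der dF) /induced_metric.
move: ('D_ex F z) ('D_ey F z) => a b.
rewrite vconj_pair.
have [_ ->] := bdot_pair ((2^-1)%:C : C) 'i (map_mx (real_complex R) a)
  (map_mx (real_complex R) b).
rewrite !bdot_real; move: (dot a a) (dot b b) => x y.
by apply: complex_ext; rewrite /=; field.
Qed.

End SmoothOn.

(** * Euclidean orthogonal projection *)

Section OrthProj.
Context {R : realType}.
Variable m : nat.
Implicit Types (u v w : 'rV[R]_m).

Lemma dot_mx u v : dot u v = (u *m v^T) 0 0.
Proof. by rewrite mxE; apply: eq_bigr => i _; rewrite mxE. Qed.

Lemma dotC u v : dot u v = dot v u.
Proof. by apply: eq_bigr => i _; rewrite mulrC. Qed.
Lemma dotDl u v w : dot (u + v) w = dot u w + dot v w.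
Proof. by rewrite -big_split; apply: eq_bigr => i _; rewrite mxE mulrDl. Qed.
Lemma dotZl a u v : dot (a *: u) v = a * dot u v.
Proof. by rewrite mulr_sumr; apply: eq_bigr => i _; rewrite mxE mulrA. Qed.
Lemma dotDr u v w : dot u (v + w) = dot u v + dot u w.
Proof. by rewrite dotC dotDl !(dotC u). Qed.
Lemma dotZr a u v : dot u (a *: v) = a * dot u v.
Proof. by rewrite dotC dotZl dotC. Qed.
Lemma dotNl u v : dot (- u) v = - dot u v.
Proof. by rewrite -scaleN1r dotZl mulN1r. Qed.
Lemma dotNr u v : dot u (- v) = - dot u v.
Proof. by rewrite dotC dotNl dotC. Qed.
Lemma dot0l u : dot 0 u = 0.
Proof. by rewrite -(scale0r 0) dotZl mul0r. Qed.
Lemma dot_ge0 u : 0 <= dot u u.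
Proof. by apply: sumr_ge0 => i _; rewrite -expr2 sqr_ge0. Qed.
Lemma dot_eq0 u : dot u u = 0 -> u = 0.
Proof.
move=> /eqP; rewrite psumr_eq0; last by move=> i _; rewrite -expr2 sqr_ge0.
move=> /allP h; apply/rowP => i; rewrite mxE; apply/eqP.
by have := h i; rewrite mem_index_enum => /(_ isT); rewrite /= mulf_eq0 orbb.
Qed.

Definition perp k (A : 'M[R]_(k, m)) v := v *m A^T = 0.

Lemma perpP k (A : 'M[R]_(k, m)) v :
  perp A v <-> forall w, (w <= A)%MS -> dot v w = 0.
Proof.
split=> [h w /submxP[D ->]|h].
  by rewrite dot_mx trmx_mul mulmxA h mul0mx mxE.
apply/rowP => i; rewrite [RHS]mxE.
have := h (row i A) (row_sub i A); rewrite dot_mx => <-.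
by rewrite !mxE; apply: eq_bigr => j _; rewrite !mxE.
Qed.

Lemma perp_sub k l (A : 'M[R]_(k, m)) (B : 'M[R]_(l, m)) v :
  (B <= A)%MS -> perp A v -> perp B v.
Proof. by move=> BA /perpP h; apply/perpP => w wB; apply: h; apply: submx_trans BA. Qed.

Lemma ker_capmx k (A : 'M[R]_(k, m)) : (kermx A^T :&: <<A>> = 0)%MS.
Proof.
apply/eqP; rewrite -submx0; apply/rV_subP => w; rewrite sub_capmx genmxE.
move=> /andP[/sub_kermxP h1 h2]; have /perpP/(_ w h2)/dot_eq0 -> : perp A w by [].
exact: sub0mx.
Qed.

Lemma ker_addsmx k (A : 'M[R]_(k, m)) v : (v <= kermx A^T + <<A>>)%MS.
Proof.
apply: submx_full; rewrite /row_full.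
have := mxrank_sum_cap (kermx A^T) <<A>>%MS.
rewrite ker_capmx mxrank0 addn0 mxrank_ker genmxE mxrank_tr => ->.
by rewrite subnK // rank_leq_col.
Qed.

Lemma orth_projD k (A : 'M[R]_(k, m)) v w :
  orth_proj A (v + w) = orth_proj A v + orth_proj A w.
Proof. by rewrite /orth_proj mulmxDl. Qed.

Lemma orth_projZ k (A : 'M[R]_(k, m)) a v : orth_proj A (a *: v) = a *: orth_proj A v.
Proof. by rewrite /orth_proj -scalemxAl. Qed.

Lemma orth_proj_perp k (A : 'M[R]_(k, m)) v : perp A (orth_proj A v).
Proof. by apply/sub_kermxP; exact: proj_mx_sub. Qed.

Lemma orth_proj_sub k (A : 'M[R]_(k, m)) v : (v - orth_proj A v <= A)%MS.
Proof.
have := proj_mx_compl_sub (ker_addsmx A v).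
by rewrite genmxE.
Qed.

Lemma orth_projE k (A : 'M[R]_(k, m)) v w :
  perp A w -> (v - w <= A)%MS -> orth_proj A v = w.
Proof.
move=> hw hvw; apply/eqP; rewrite -subr_eq0; apply/eqP; apply: dot_eq0.
set d := _ - _; have dA : (d <= A)%MS.
  have -> : d = (v - w) - (v - orth_proj A v).
    by rewrite /d opprB [RHS]addrC addrA subrK.
  by rewrite addmx_sub // eqmx_opp orth_proj_sub.
have /perpP : perp A d.
  by rewrite /perp mulmxBl (orth_proj_perp A v) hw subrr.
by apply.
Qed.

Lemma orth_proj0 k (A : 'M[R]_(k, m)) v : A = 0 -> orth_proj A v = v.
Proof.
move=> ->; apply: orth_projE; first by rewrite /perp trmx0 mulmx0.
by rewrite subrr sub0mx.
Qed.

End OrthProj.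

(** * From zero mean curvature to the harmonic map equation *)

Section LinearCombination.
Variables (K : idomainType) (m : nat).

Lemma lincomb_coef (L f p p' : 'rV[K]_m) (a b c F : K) :
  L = a *: f + b *: p + c *: p' -> F != 0 ->
  bdot f f = 1 -> bdot f p = 0 -> bdot f p' = 0 -> bdot p p = 0 -> bdot p' p' = 0 ->
  bdot p p' = F -> bdot L f = - F -> bdot L p = 0 -> bdot L p' = 0 ->
  L = - F *: f.
Proof.
move=> hL F0 ff fp fp' pp p'p' pp' Lf Lp Lp'.
have c0 : c = 0.
  apply/eqP; move/eqP: Lp; rewrite hL !bdotE fp pp (bdotC p') pp'.
  by rewrite !mulr0 !add0r mulf_eq0 (negPf F0) orbF.
have b0 : b = 0.
  apply/eqP; move/eqP: Lp'; rewrite hL !bdotE fp' p'p' pp'.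
  by rewrite !mulr0 !add0r addr0 mulf_eq0 (negPf F0) orbF.
rewrite c0 b0 !scale0r !addr0 in hL; rewrite hL; congr (_ *: _).
by rewrite -Lf hL bdotZl ff mulr1.
Qed.

End LinearCombination.

Section HarmIntro.
Context {R : realType} (D : opn R) (m : nat).
Local Notation K := (sfun D).
Local Notation S := (sfd D).
Variable f : 'rV[K]_m.
Local Notation p := (vd S f).

(** The last hypothesis is zero mean curvature in complex form. Conformality makes dbar df
    orthogonal to df and conj df, which removes the tangential coefficients, and <f, f> = 1 fixes
    the remaining one as -F. *)
Lemma harm_intro iF : vc S f = f -> bdot f f = 1 -> bdot p p = 0 ->
  bdot p (vc S p) * iF = 1 ->
  (forall z, oset D z -> exists a b c : R[i], evv z (vb S p) =
     a *: evv z f + b *: evv z p + c *: evv z (vc S p)) ->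
  harm S f (bdot p (vc S p)) iF.
Proof.
move=> fr ff pp hi hL; set F := bdot p (vc S p) in hi *.
have cF : cj S F = F by rewrite cj_bdot vcK bdotC.
have fp : bdot f p = 0.
  by apply: (@half_inj _ S); rewrite -{1}bdotC -d_bdot ff; exact: dd1.
have fp' : bdot f (vc S p) = 0 by rewrite -{1}fr -cj_bdot fp cj0.
have pp' : bdot (vc S p) (vc S p) = 0 by rewrite -cj_bdot pp cj0.
have fb : vb S f = vc S p by rewrite -{1}fr vb_vc.
have Lf : bdot (vb S p) f = - F.
  have := db_bdot S p f; rewrite (bdotC p f) fp db0 fb => /esym/eqP.
  by rewrite addr_eq0 => /eqP.
have Lp : bdot (vb S p) p = 0.
  by apply: (@half_inj _ S); rewrite -{2}bdotC -db_bdot pp; exact: db0.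
have Lp' : bdot (vb S p) (vc S p) = 0.
  have -> : vb S p = vc S (vb S p) by rewrite -vd_vc -fb vdb.
  by rewrite -cj_bdot Lp cj0.
split => //; apply: evvP => z Dz.
have [a [b [c e]]] := hL z Dz.
have ez (u v : 'rV[K]_m) x : bdot u v = x -> bdot (evv z u) (evv z v) = x z.
  by move=> <-; rewrite evv_bdot.
rewrite (evvZ _ _ Dz) (sfNE _ Dz).
have F0 : F z != 0.
  have := congr1 (fun a : K => a z) hi; rewrite (sfME _ _ Dz) (sf1E Dz).
  by move/eqP; apply: contraTneq => ->; rewrite mul0r eq_sym oner_eq0.
apply: (lincomb_coef e F0).
- by rewrite (ez _ _ _ ff) sf1E.
- by rewrite (ez _ _ _ fp) sf0E.
- by rewrite (ez _ _ _ fp') sf0E.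
- by rewrite (ez _ _ _ pp) sf0E.
- by rewrite (ez _ _ _ pp') sf0E.
- by rewrite -evv_bdot.
- by rewrite (ez _ _ _ Lf) sfNE.
- by rewrite (ez _ _ _ Lp) sf0E.
- by rewrite (ez _ _ _ Lp') sf0E.
Qed.

End HarmIntro.

Section LocalSurface.
Context {R : realType} (n : nat).
Implicit Types F : plane R -> 'rV[R]_n.+1.

Record conf_minimal (D : opn R) F : Prop := ConfMinimal {
  cm_smooth : smooth_on D F;
  cm_norm : forall z, oset D z -> dot (F z) (F z) = 1;
  cm_conf : forall z, oset D z -> induced_metric F z ex ex = induced_metric F z ey ey;
  cm_orth : forall z, oset D z -> induced_metric F z ex ey = 0;
  cm_pos : forall z, oset D z -> 0 < induced_metric F z ex ex;
  cm_mean : forall z, oset D z -> forall v w,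
    induced_metric F z v v = 1 -> induced_metric F z w w = 1 ->
    induced_metric F z v w = 0 -> second_ff F v v z + second_ff F w w z = 0
}.

Lemma derive_scale F z (a : R) v : differentiable F z -> 'D_(a *: v) F z = a *: 'D_v F z.
Proof. by move=> dF; rewrite !deriveE // linearZ. Qed.

Lemma derive_pair F z (v : plane R) : differentiable F z ->
  'D_v F z = v.1 *: 'D_ex F z + v.2 *: 'D_ey F z.
Proof.
move=> dF; rewrite !deriveE // -!linearZ -linearD; congr ('d F z _).
case: v => a b; apply: injective_projections.
  by change (a = a * 1 + b * 0); rewrite mulr1 mulr0 addr0.
by change (b = a * 0 + b * 1); rewrite mulr1 mulr0 add0r.
Qed.

Section OnDomain.
Variables (D : opn R) (F : plane R -> 'rV[R]_n.+1).
Hypothesis H : conf_minimal D F.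
Let oD := @oopen R D.

Lemma cm_diff z : oset D z -> differentiable F z.
Proof. by move=> Dz; apply: (cm_smooth H [::]). Qed.
Lemma cm_diff1 z v : oset D z -> differentiable ('D_v F) z.
Proof. by move=> Dz; apply: (cm_smooth H [:: v]). Qed.

Lemma second_ff_scale z a v : oset D z -> second_ff F (a *: v) (a *: v) z = a ^+ 2 *: second_ff F v v z.
Proof.
move=> Dz; rewrite /second_ff -orth_projZ; congr orth_proj.
have e : 'D_(a *: v) ('D_(a *: v) F) z = 'D_(a *: v) (fun x => a *: 'D_v F x) z.
  apply: near_eq_derive; apply: filterS (nearD oD Dz) => x Dx.
  by rewrite derive_scale //; apply: cm_diff.
rewrite e (@deriveZ _ _ _ ('D_v F) a z (a *: v) (diff_derivable (cm_diff1 v Dz))).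
by rewrite !deriveE; [rewrite linearZ scalerA expr2|apply: cm_diff1..].
Qed.

Lemma cm_laplacian z : oset D z -> exists a b c : R,
  'D_ex ('D_ex F) z + 'D_ey ('D_ey F) z = a *: F z + b *: 'D_ex F z + c *: 'D_ey F z.
Proof.
move=> Dz; have l0 := cm_pos H Dz; set l := induced_metric F z ex ex in l0.
pose s := (Num.sqrt l)^-1.
have s2 : s ^+ 2 * l = 1.
  by rewrite /s exprVn sqr_sqrtr ?ltW // mulVf // gt_eqF.
have sm v w : induced_metric F z (s *: v) (s *: w) = s ^+ 2 * induced_metric F z v w.
  by rewrite /induced_metric !derive_scale ?dotZl ?dotZr ?mulrA ?expr2 //; apply: cm_diff.
have := cm_mean H Dz (v := s *: ex) (w := s *: ey).
rewrite !sm (cm_orth H Dz) -(cm_conf H Dz) s2 mulr0 => /(_ erefl erefl erefl).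
rewrite !second_ff_scale // -scalerDr => /eqP; rewrite scaler_eq0 => /orP[|].
  by rewrite expf_eq0 /= => /eqP s0; move: s2; rewrite s0 expr0n mul0r => /eqP; rewrite eq_sym oner_eq0.
rewrite /second_ff -orth_projD => /eqP h.
have := orth_proj_sub (pos_tangent F z) ('D_ex ('D_ex F) z + 'D_ey ('D_ey F) z).
rewrite h subr0 => /sub_addsmxP[[u v] /= ->].
have /sub_addsmxP[[u1 u2] /= ->] : (u *m (F z + 'D_ex F z)%MS <= F z + 'D_ex F z)%MS.
  exact: submxMl.
exists (u1 0 0), (u2 0 0), (v 0 0).
by rewrite -!mul_scalar_mx -!mx11_scalar.
Qed.

Definition cmK : 'rV[sfun D]_n.+1 := vecK (cvec_sm oD (cm_smooth H)).
Local Notation f := cmK.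
Local Notation S := (sfd D).
Local Notation p := (vd S f).
Definition cmF : sfun D := bdot p (vc S p).

Lemma evv_f z : oset D z -> evv z f = cvec F z.
Proof. exact: vecKE. Qed.
Lemma evv_p z : oset D z -> evv z p = rP F z.
Proof. by move=> Dz; apply: evv_vd => // x; apply: evv_f. Qed.
Lemma ev_F z : oset D z -> cmF z = rF F z.
Proof. by move=> Dz; rewrite evv_bdot // evv_vc // evv_p. Qed.

Lemma cm_F z : oset D z -> rF F z = (2^-1 * induced_metric F z ex ex)%:C.
Proof.
move=> Dz; rewrite (rF_metric (cm_diff Dz)) -(cm_conf H Dz); congr (_%:C).
by field.
Qed.

Lemma cm_F_neq0 z : oset D z -> rF F z != 0.
Proof.
move=> Dz; rewrite cm_F // eq_complex /= eqxx andbT mulf_neq0 ?invr_eq0 //.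
by rewrite gt_eqF // (cm_pos H).
Qed.

Lemma cmF_inv : exists2 iF, cmF * iF = 1 & forall z, oset D z -> iF z = (rF F z)^-1.
Proof.
have h0 z : oset D z -> cmF z != 0 by move=> Dz; rewrite ev_F // cm_F_neq0.
have [iF h1 h2] := sf_inv h0.
by exists iF => // z Dz; rewrite h2 // ev_F.
Qed.

Lemma evv_L z : oset D z -> evv z (vb S p) =
  (4^-1)%:C *: map_mx (real_complex R) ('D_ex ('D_ex F) z + 'D_ey ('D_ey F) z).
Proof.
move=> Dz; rewrite -vdb; apply/rowP => j.
have -> : evv z (vd S (vb S f)) 0 j = dd S (db S (f 0 j)) z by rewrite 3!mxE.
have RE (u : 'rV[R]_n.+1) (c : R[i]) : (c *: map_mx (real_complex R) u) 0 j = c * (u 0 j)%:C.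
  by rewrite !mxE.
rewrite RE.
have e : dd S (db S (f 0 j)) z = (4^-1)%:C * (cder ex (cder ex (f 0 j)) z + cder ey (cder ey (f 0 j)) z).
  exact: sf_lap.
rewrite [LHS]e; congr (_ * _); rewrite {e}.
have fj x : oset D x -> f 0 j x = (F x 0 j)%:C.
  by move=> Dx; have /rowP/(_ j) := evv_f Dx; rewrite [LHS]mxE [RHS]mxE.
have e1 v x : oset D x -> cder v (f 0 j) x = ('D_v F x 0 j)%:C.
  move=> Dx; rewrite (cder_ext oD v Dx fj) /cder.
  rewrite (_ : imfun _ = cst 0) // derive_cst (der_coord j) //.
  by apply: diff_derivable; apply: cm_diff.
have e2 v : cder v (cder v (f 0 j)) z = ('D_v ('D_v F) z 0 j)%:C.
  rewrite (cder_ext oD v Dz (e1 v)) /cder.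
  rewrite (_ : imfun _ = cst 0) // derive_cst (der_coord j) //.
  by apply: diff_derivable; apply: cm_diff1.
apply: etrans (congr2 +%R (e2 ex) (e2 ey)) _.
have eD (Y Z : 'rV[R]_n.+1) : (Y 0 j)%:C + (Z 0 j)%:C = ((Y + Z) 0 j)%:C :> R[i].
  by rewrite mxE rmorphD.
exact: eD.
Qed.

Lemma cm_conf_K : bdot p p = 0.
Proof.
apply: sfunP => z Dz; rewrite evv_bdot // evv_p // sf0E //.
rewrite (rP_conf (cm_diff Dz)) (cm_conf H Dz) (cm_orth H Dz) subrr mul0rn.
by rewrite mulr0 subrr mulr0.
Qed.

Lemma cm_harm iF : cmF * iF = 1 -> harm S f cmF iF.
Proof.
move=> hi; apply: harm_intro => //.
- apply: evvP => z Dz; rewrite evv_vc // evv_f //.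
  by apply/rowP => j; rewrite !mxE; apply: complex_ext => //=; rewrite oppr0.
- apply: sfunP => z Dz; rewrite evv_bdot // evv_f // sf1E //.
  by rewrite /cvec bdot_real (cm_norm H).
- exact: cm_conf_K.
move=> z Dz; have [a [b [c e]]] := cm_laplacian Dz.
rewrite evv_L // e evv_vc // evv_f // evv_p // (rP_der (cm_diff Dz)) vconj_pair.
move: ('D_ex F z) ('D_ey F z) => X Y.
exists ((4^-1 * a)%:C), ((4^-1)%:C * (b%:C + 'i * c%:C)), ((4^-1)%:C * (b%:C - 'i * c%:C)).
rewrite /cvec; move: (F z) => Z.
apply/rowP => j; rewrite !mxE; move: (X 0 j) (Y 0 j) (Z 0 j) => x y t.
by apply: complex_ext; rewrite /=; field.
Qed.

End OnDomain.
End LocalSurface.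

(** * Holomorphic changes of coordinate *)

Section PointwiseDiff.
Context {R : realType}.
Implicit Types (u v : plane R -> R[i]) (z : plane R).

Lemma cdiffD u v z : cdiff u z -> cdiff v z -> cdiff (fun x => u x + v x) z.
Proof.
move=> [a b] [c d]; split.
  rewrite (_ : refun _ = fun x => refun u x + refun v x); last first.
    by apply/funext => x; apply: ReD.
  exact: differentiableD.
rewrite (_ : imfun _ = fun x => imfun u x + imfun v x); last first.
  by apply/funext => x; apply: ImD.
exact: differentiableD.
Qed.

Lemma cdiffM u v z : cdiff u z -> cdiff v z -> cdiff (fun x => u x * v x) z.
Proof.
move=> [a b] [c d]; split.
  rewrite (_ : refun _ = fun x => refun u x * refun v x - imfun u x * imfun v x); last first.
    by apply/funext => x; apply: ReM.
  by apply: differentiableB; apply: differentiableM.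
rewrite (_ : imfun _ = fun x => refun u x * imfun v x + imfun u x * refun v x); last first.
  by apply/funext => x; apply: ImM.
by apply: differentiableD; apply: differentiableM.
Qed.

Lemma cdiff_conj u z : cdiff u z -> cdiff (fun x => conjc (u x)) z.
Proof.
move=> [a b]; split.
  rewrite (_ : refun _ = refun u) //.
  by apply/funext => x; apply: ReJ.
rewrite (_ : imfun _ = fun x => - imfun u x); last first.
  by apply/funext => x; apply: ImJ.
exact: differentiableN.
Qed.

Lemma cdiff_cst (c : R[i]) z : cdiff (fun _ => c) z.
Proof. by split; apply: differentiable_cst. Qed.

Lemma cdiff_sum (I : finType) (u : I -> plane R -> R[i]) z :
  (forall i, cdiff (u i) z) -> cdiff (fun x => \sum_i u i x) z.
Proof.
move=> hu.
elim: (index_enum I) => [|i r IH].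
  rewrite (_ : (fun x => _) = fun=> 0); first exact: cdiff_cst.
  by apply/funext => x; rewrite big_nil.
rewrite (_ : (fun x => _) = fun x => u i x + \sum_(j <- r) u j x).
  exact: cdiffD.
by apply/funext => x; rewrite big_cons.
Qed.

Lemma cdiffV u z : u z != 0 -> cdiff u z -> cdiff (fun x => (u x)^-1) z.
Proof.
move=> u0 [a b].
pose N x := refun u x * refun u x + imfun u x * imfun u x.
have N0 : N z != 0.
  move: u0; apply: contra; rewrite /N -!expr2 paddr_eq0 ?sqr_ge0 //.
  by rewrite !expf_eq0 /= /refun /imfun eq_complex.
have dN : differentiable N z by apply: differentiableD; apply: differentiableM.
have dV : differentiable (fun x => (N x)^-1) z by apply: differentiableV.
split.
  rewrite (_ : refun _ = fun x => refun u x * (N x)^-1); first exact: differentiableM.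
  by apply/funext => x; rewrite /N /refun /imfun; case: (u x).
rewrite (_ : imfun _ = fun x => - (imfun u x * (N x)^-1)).
  by apply: differentiableN; apply: differentiableM.
by apply/funext => x; rewrite /N /refun /imfun; case: (u x).
Qed.

Lemma cdiff_bdot m (V W : plane R -> 'rV[R[i]]_m) z : vdiff V z -> vdiff W z ->
  cdiff (fun x => bdot (V x) (W x)) z.
Proof. by move=> hV hW; apply: cdiff_sum => i; apply: cdiffM. Qed.

Lemma vdiff_conj m (V : plane R -> 'rV[R[i]]_m) z : vdiff V z -> vdiff (fun x => vconj (V x)) z.
Proof.
move=> hV j; rewrite (_ : (fun x => _) = fun x => conjc (V x 0 j)).
  exact: cdiff_conj.
by apply/funext => x; rewrite mxE.
Qed.

Lemma rowZ m (c : R[i]) (v : 'rV[R[i]]_m) j : (c *: v) 0 j = c * v 0 j.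
Proof. by rewrite mxE. Qed.
Lemma rowD m (v w : 'rV[R[i]]_m) j : (v + w) 0 j = v 0 j + w 0 j.
Proof. by rewrite mxE. Qed.

Lemma rdzZ m (c : plane R -> R[i]) (V : plane R -> 'rV[R[i]]_m) z :
  cdiff c z -> vdiff V z ->
  rdz (fun x => c x *: V x) z = dz c z *: V z + c z *: rdz V z.
Proof.
move=> hc hV; apply/rowP => j; rewrite rowD !rowZ [LHS]mxE [rdz V z 0 j]mxE.
rewrite -(dzM hc (hV j)).
by have -> : (fun x => (c x *: V x) 0 j) = (fun x => c x * V x 0 j) by
  apply/funext => x; exact: rowZ.
Qed.

End PointwiseDiff.

Section Chain.
Context {R : realType}.
Variables (T : plane R -> plane R) (z : plane R).
Hypothesis dT : differentiable T z.
Hypothesis CR : forall v, 'D_(rotJ v) T z = rotJ ('D_v T z).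

(** The complex derivative T', read off from the x-derivative. *)
Definition cdT (x : plane R) : R[i] := Complex ('D_ex T x).1 ('D_ex T x).2.

Lemma dT_ey : 'D_ey T z = (- ('D_ex T z).2, ('D_ex T z).1).
Proof. by have := CR ex; rewrite /rotJ /ex /= oppr0. Qed.

Lemma diff_compT (a : plane R -> R) : differentiable a (T z) ->
  differentiable (fun x => a (T x)) z.
Proof. by move=> da; apply: differentiable_comp. Qed.

Lemma der_pairT (a : plane R -> R) v : differentiable a (T z) ->
  'D_v (fun x => a (T x)) z =
    ('D_v T z).1 * 'D_ex a (T z) + ('D_v T z).2 * 'D_ey a (T z).
Proof.
move=> da; rewrite deriveE; last exact: diff_compT.
have -> : 'd (fun x => a (T x)) z v = 'd a (T z) ('d T z v).
  have h : 'd (a \o T) z = 'd a (T z) \o 'd T z :> (plane R -> R) := diff_comp dT da.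
  exact: (congr1 (fun k => k v) h).
rewrite -(deriveE _ dT); case: ('D_v T z) => x y /=.
rewrite !deriveE //.
transitivity ('d a (T z) (x *: ex + y *: ey)).
  congr ('d a (T z) _); apply: injective_projections.
    by change (x = x * 1 + y * 0); rewrite mulr1 mulr0 addr0.
  by change (y = x * 0 + y * 1); rewrite mulr1 mulr0 add0r.
by rewrite linearD !linearZ.
Qed.

Lemma cdiff_compT u : cdiff u (T z) -> cdiff (fun x => u (T x)) z.
Proof. by move=> [h1 h2]; split; [exact: (diff_compT h1)|exact: (diff_compT h2)]. Qed.

Lemma dz_chain u : cdiff u (T z) -> dz (fun x => u (T x)) z = cdT z * dz u (T z).
Proof.
move=> [h1 h2]; rewrite !dzE /cder /cdT.
have e (a : plane R -> R) v : differentiable a (T z) ->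
  'D_v (fun x => a (T x)) z = ('D_v T z).1 * 'D_ex a (T z) + ('D_v T z).2 * 'D_ey a (T z).
  exact: der_pairT.
rewrite (e _ ex h1) (e _ ey h1) (e _ ex h2) (e _ ey h2) dT_ey /=.
move: ('D_ex T z).1 ('D_ex T z).2 => a b.
move: ('D_ex (refun u) (T z)) ('D_ey (refun u) (T z)) => x y.
move: ('D_ex (imfun u) (T z)) ('D_ey (imfun u) (T z)) => s t.
by apply: complex_ext; rewrite /=; ring.
Qed.

Lemma rdz_chain m (V : plane R -> 'rV[R[i]]_m) : vdiff V (T z) ->
  rdz (fun x => V (T x)) z = cdT z *: rdz V (T z).
Proof.
move=> hV; apply/rowP => j; rewrite rowZ [LHS]mxE [rdz V (T z) 0 j]mxE.
by rewrite -(dz_chain (hV j)).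
Qed.

End Chain.

Lemma vsm_rdz {R : realType} (D : set (plane R)) (oD : open D) m (V : plane R -> 'rV[R[i]]_m) :
  vsm D V -> vsm D (rdz V).
Proof.
move=> hV j; rewrite (_ : (fun x => _) = dz (fun x => V x 0 j)); first exact: csm_dz.
by apply/funext => x; rewrite mxE.
Qed.

Lemma vsm_diff {R : realType} (D : set (plane R)) m (V : plane R -> 'rV[R[i]]_m) z :
  vsm D V -> D z -> vdiff V z.
Proof. by move=> hV Dz j; apply: csm_diff (hV j) Dz. Qed.

Section Invariants.
Context {R : realType} (n : nat).
Variables (D : opn R) (F : plane R -> 'rV[R]_n.+1).
Hypothesis H : conf_minimal D F.
Let oD := @oopen R D.
Local Notation f := (cmK H).
Local Notation S := (sfd D).
Local Notation p := (vd S f).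
Variable iF : sfun D.
Hypothesis hi : cmF H * iF = 1.

Lemma ev_iF z : oset D z -> iF z = (rF F z)^-1.
Proof.
move=> Dz; have := congr1 (fun a : sfun D => a z) hi.
rewrite (sfME _ _ Dz) (sf1E Dz) (ev_F H Dz) => e.
by apply: (mulfI (cm_F_neq0 H Dz)); rewrite e divff // (cm_F_neq0 H Dz).
Qed.

Lemma evv_A z : oset D z -> evv z (vA S f (cmF H) iF) = rA F z.
Proof.
move=> Dz; have Hh := cm_harm hi.
have e : dd S (cmF H) = bdot (vd S p) (vc S p).
  rewrite d_bdot vd_vc (harm_lap Hh) vcZ bdotZr (harm_real Hh).
  by rewrite (bdotC p f) (dot_fp Hh) mulr0 addr0.
have ep : evv z (vd S p) = rdz (rP F) z.
  by apply: evv_vd => // x Dx; apply: evv_p.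
rewrite vAE (evvD _ _ Dz) (evvN _ Dz) (evvZ _ _ Dz) /lF (sfME _ _ Dz) e (ev_iF Dz).
by rewrite (evv_bdot _ _ Dz) (evv_vc _ Dz) (evv_p H Dz) ep.
Qed.

Lemma evv_dA z : oset D z -> evv z (vd S (vA S f (cmF H) iF)) = rdz (rA F) z.
Proof. by move=> Dz; apply: evv_vd => // x; apply: evv_A. Qed.

Lemma vsm_P : vsm D (rP F).
Proof. by apply: vsm_rdz => //; apply: cvec_sm => //; exact: cm_smooth H. Qed.

Lemma vsm_A : vsm D (rA F).
Proof.
move=> j; apply: (csm_ext oD) (evv_vsm (vA S f (cmF H) iF) j) => z Dz.
by rewrite evv_A.
Qed.

End Invariants.

(** Why A has weight 2: the term with T'' is a multiple of df, and passing to the normal part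
    removes it. *)
Lemma normal_part_scale (K : fieldType) m (P P' dP : 'rV[K]_m) (t t' dt : K) :
  t != 0 -> t' != 0 -> bdot P P' != 0 ->
  dt *: P + (t * t) *: dP -
    (bdot (dt *: P + (t * t) *: dP) (t' *: P') / (t * t' * bdot P P')) *: (t *: P) =
  (t * t) *: (dP - (bdot dP P' / bdot P P') *: P).
Proof.
move=> t0 t'0; rewrite !bdotE; move: (bdot P P') (bdot dP P') => a b a0.
apply/rowP => j; rewrite !mxE; move: (P 0 j) (dP 0 j) => x y.
by field; rewrite t0 t'0 a0.
Qed.

Lemma cubic_weight (K : comPzRingType) m (V U W : 'rV[K]_m) (r t e : K) :
  U = r *: W -> t = e * r + r * e ->
  t *: V + (r * r) *: U = (2%:R * r * e) *: V + (r ^+ 3) *: W.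
Proof. by move=> -> ->; rewrite scalerA; congr (_ *: _ + _ *: _); ring. Qed.

Section Transition.
Context {R : realType} (n : nat).
Variables (D D' : opn R) (F F' : plane R -> 'rV[R]_n.+1).
Hypotheses (H : conf_minimal D F) (H' : conf_minimal D' F').
Variables (E : set (plane R)) (T : plane R -> plane R).
Hypotheses (oE : open E) (ED : E `<=` D) (ET : forall z, E z -> oset D' (T z)).
Hypothesis dT : forall z, E z -> differentiable T z.
Hypothesis CR : forall z, E z -> forall v, 'D_(rotJ v) T z = rotJ ('D_v T z).
Hypothesis FT : forall z, E z -> F z = F' (T z).
Local Notation s := (cdT T).

Lemma cvec_diff z : oset D' z -> vdiff (cvec F') z.
Proof. by move=> Dz; apply: vsm_diff Dz; apply: cvec_sm (cm_smooth H'); exact: oopen. Qed.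

Lemma trans_P z : E z -> rP F z = s z *: rP F' (T z).
Proof.
move=> Ez; rewrite -(rdz_chain (dT Ez) (CR Ez) (cvec_diff (ET Ez))).
by apply: (rdz_ext oE Ez) => x Ex; rewrite /cvec FT.
Qed.

Lemma vconjZ m (a : R[i]) (u : 'rV[R[i]]_m) : vconj (a *: u) = conjc a *: vconj u.
Proof. by apply/rowP => j; rewrite !mxE rmorphM. Qed.

Lemma trans_F z : E z -> rF F z = s z * conjc (s z) * rF F' (T z).
Proof.
move=> Ez; rewrite /rF trans_P // vconjZ bdotZl bdotZr mulrA //.
Qed.

Lemma trans_s_neq0 z : E z -> s z != 0.
Proof.
move=> Ez; have := cm_F_neq0 H (ED Ez); rewrite trans_F //.
by apply: contraNneq => ->; rewrite !mul0r.
Qed.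

(** The hypotheses on T provide one derivative and the Cauchy-Riemann equations. That T' is again
    differentiable is read off from the surface: T' = <P, conj P'>/|P'|^2, where P is the derivative
    of F and P' that of F' at T. *)
Lemma trans_s_diff z : E z -> cdiff s z.
Proof.
move=> Ez.
pose P' x := rP F' (T x).
have dP : vdiff (rP F) z by apply: vsm_diff (vsm_P H) (ED Ez).
have dP' : vdiff P' z.
  by move=> j; apply: (cdiff_compT (dT Ez) (u := fun y => rP F' y 0 j));
    apply: vsm_diff (vsm_P H') (ET Ez) _.
have d1 : cdiff (fun x => bdot (rP F x) (vconj (P' x))) z.
  by apply: cdiff_bdot => //; apply: vdiff_conj.
have d2 : cdiff (fun x => bdot (P' x) (vconj (P' x))) z.
  by apply: cdiff_bdot => //; apply: vdiff_conj.
have F0 x : E x -> bdot (P' x) (vconj (P' x)) != 0.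
  by move=> Ex; exact: (cm_F_neq0 H' (ET Ex)).
have d3 := cdiffM d1 (cdiffV (F0 z Ez) d2).
have e x : E x -> bdot (rP F x) (vconj (P' x)) * (bdot (P' x) (vconj (P' x)))^-1 = s x.
  by move=> Ex; rewrite trans_P // bdotZl mulfK // F0.
case: d3 => d3 d4; split.
  apply: near_eq_differentiable d3.
  by apply: filterS (nearD oE Ez) => x Ex; rewrite /refun e.
apply: near_eq_differentiable d4.
by apply: filterS (nearD oE Ez) => x Ex; rewrite /imfun e.
Qed.

Lemma trans_dP z : E z -> rdz (rP F) z =
  dz s z *: rP F' (T z) + (s z * s z) *: rdz (rP F') (T z).
Proof.
move=> Ez.
apply: etrans (rdz_ext oE Ez (fun x Ex => trans_P Ex)) _.
have dP : vdiff (rP F') (T z) by apply: vsm_diff (vsm_P H') (ET Ez).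
rewrite rdzZ; [|exact: trans_s_diff|].
  by rewrite (rdz_chain (dT Ez) (CR Ez) dP) scalerA.
by move=> j; apply: (cdiff_compT (dT Ez) (u := fun y => rP F' y 0 j)).
Qed.

Lemma trans_A z : E z -> rA F z = (s z * s z) *: rA F' (T z).
Proof.
move=> Ez; rewrite /rA (trans_dP Ez) (trans_F Ez) (trans_P Ez) vconjZ.
apply: normal_part_scale; first exact: trans_s_neq0.
  by rewrite conjc_eq0; exact: trans_s_neq0.
exact: (cm_F_neq0 H' (ET Ez)).
Qed.

Lemma trans_dA z : E z -> rdz (rA F) z =
  (2%:R * s z * dz s z) *: rA F' (T z) + (s z ^+ 3) *: rdz (rA F') (T z).
Proof.
move=> Ez.
apply: etrans (rdz_ext oE Ez (fun x Ex => trans_A Ex)) _.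
have [iF' hi' _] := cmF_inv H'.
have dA : vdiff (rA F') (T z) by apply: vsm_diff (vsm_A hi') (ET Ez).
have ds := trans_s_diff Ez.
have dAT : vdiff (fun x => rA F' (T x)) z.
  by move=> j; apply: (cdiff_compT (dT Ez) (u := fun y => rA F' y 0 j)).
apply: etrans (rdzZ (cdiffM ds ds) dAT) _.
exact: (cubic_weight _ (rdz_chain (dT Ez) (CR Ez) dA) (dzM ds ds)).
Qed.

End Transition.

(** * Logarithmic derivatives at a maximum *)

Section SecondDerivativeTest.
Context {R : realType} {V : normedModType R}.

(** Were the second derivative positive, the first would be positive for small t > 0, and the mean
    value theorem would give a value above the maximum. *)
Lemma local_max_derive (u : V -> R) (v z : V) (D : set V) : open D -> D z ->
  (forall x, D x -> differentiable u x) -> differentiable ('D_v u) z ->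
  (forall x, D x -> u x <= u z) ->
  'D_v u z = 0 /\ 'D_v ('D_v u) z <= 0.
Proof.
move=> oD Dz du dU hmax; set U := 'D_v u in dU *.
have : nbhs z D by apply: open_nbhs_nbhs.
move=> /nbhs_norm_ball[r r0 Hr].
pose c := `|v| + 1.
have c0 : 0 < c by rewrite ltr_wpDl.
pose e := r / c; have e0 : 0 < e by rewrite divr_gt0.
have inD (t : R) : `|t| < e -> D (t *: v + z).
  rewrite /e ltr_pdivlMr // => ht; apply: Hr; rewrite normrZ.
  by apply: le_lt_trans ht; rewrite ler_wpM2l // /c ler_wpDr.
pose phi t := u (t *: v + z).
have dphi (t : R) : `|t| < e -> is_derive t 1 phi (U (t *: v + z)).
  by move=> /inD ht; apply: is_derive_line; apply: diff_derivable; apply: du.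
have phi0 : phi 0 = u z by rewrite /phi scale0r add0r.
have U0 : U z = 0.
  have := @derive1_at_max R phi (- e) e 0.
  rewrite in_itv /= oppr_lt0 e0 => /(_ _ _ isT) h.
  have d0 : is_derive (0 : R) 1 phi 0.
    apply: h; first lra.
      move=> t; rewrite in_itv /= => ht.
      by apply: (@ex_derive _ _ _ _ _ _ _ (dphi t _)); rewrite ltr_norml.
    move=> t; rewrite in_itv /= => ht; rewrite phi0.
    by apply: hmax; apply: inD; rewrite ltr_norml.
  have := dphi 0; rewrite normr0 => /(_ e0) d1.
  rewrite -(@derive_val _ _ _ _ _ _ _ d0) (@derive_val _ _ _ _ _ _ _ d1).
  by rewrite scale0r add0r.
split=> //; rewrite leNgt; apply/negP => L0.
set L := 'D_v U z in L0.
have L2 : 0 < L / 2 by rewrite divr_gt0.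
have dUv : derivable U z v by apply: diff_derivable.
have := derivable_nbhs dUv.
move=> /eqaddoP/(_ _ L2)/nbhs_norm_ball[s s0 Hs].
pose t := Num.min e s / 2.
have m0 : 0 < Num.min e s by rewrite lt_min e0.
have t0 : 0 < t by rewrite divr_gt0.
have /andP[te ts] : (t < e) && (t < s).
  by rewrite -lt_min /t gtr_pMr //; lra.
have Upos c' : 0 < c' -> c' <= t -> 0 < U (c' *: v + z).
  move=> c'0 c't; have cs : `|c'| < s by rewrite gtr0_norm // (le_lt_trans c't).
  have := Hs _ cs; rewrite addr0.
  rewrite -[X in `|X|]/(U (c' *: v + z) - (U z + c' * L)) U0 add0r (gtr0_norm c'0).
  rewrite ler_norml => /andP[h _].
  have : 0 < c' * L by rewrite mulr_gt0.
  by lra.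
have [||x] := @MVT R phi (fun t => U (t *: v + z)) 0 t t0.
- move=> x; rewrite in_itv /= => /andP[x0 xt]; apply: dphi.
  by rewrite gtr0_norm // (lt_trans xt).
- apply: derivable_within_continuous => x; rewrite in_itv /= => /andP[x0 xt].
  by apply: (@ex_derive _ _ _ _ _ _ _ (dphi x _)); rewrite ger0_norm // (le_lt_trans xt).
rewrite in_itv /= => /andP[x0 xt]; rewrite subr0 phi0 => h.
have hx := Upos x x0 (ltW xt).
have : phi t <= u z by apply: hmax; apply: inD; rewrite gtr0_norm.
have : 0 < U (x *: v + z) * t by rewrite mulr_gt0.
by lra.
Qed.
End SecondDerivativeTest.

Section MaxLogd.
Context {R : realType} (D : opn R).
Local Notation K := (sfun D).
Local Notation S := (sfd D).
Let oD := @oopen R D.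

(** At the maximum du = 0, so a = 0 there, and dbar(du) = (dbar a) u + a dbar u keeps only its first
    term; its left side is a quarter of the Laplacian. *)
Lemma max_logd (u a : K) z : oset D z -> logd S u a ->
  (forall x, oset D x -> Im (u x) = 0) ->
  (forall x, oset D x -> Re (u x) <= Re (u z)) -> 0 < Re (u z) ->
  Re (db S a z) <= 0.
Proof.
move=> Dz hu hIm hmax hpos.
have [[dU kU] [dI kI]] := sf_smooth u 1%N.
have dU2 v : differentiable ('D_v (refun u)) z by have [h _] := kU v; apply: h.
have [x1 x2] := local_max_derive oD Dz dU (dU2 ex) hmax.
have [y1 y2] := local_max_derive oD Dz dU (dU2 ey) hmax.
have cd v x : oset D x -> cder v u x = ('D_v (refun u) x)%:C.
  move=> Dx; rewrite /cder (der_ext oD v (u := imfun u) (v := cst 0) Dx) //.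
  by rewrite derive_cst.
have cd2 v : cder v (cder v u) z = ('D_v ('D_v (refun u)) z)%:C.
  rewrite (cder_ext oD v Dz (cd v)) /cder (_ : imfun _ = cst 0) // derive_cst.
  by [].
have uz : u z = (Re (u z))%:C by apply: complex_ext; rewrite //= hIm.
have uz0 : u z != 0 by rewrite uz eq_complex /= eqxx andbT gt_eqF.
have ev1 (b c : K) : b = c -> b z = c z by move=> ->.
have az : a z = 0.
  have := ev1 _ _ hu; rewrite (sfddE _ Dz) (sfME _ _ Dz) dzE !cd // x1 y1.
  rewrite !mulr0 subr0 mulr0 => /esym/eqP; rewrite mulf_eq0 (negPf uz0) orbF.
  by move/eqP.
have : db S (dd S u) z = db S a z * u z.
  rewrite hu (ev1 _ _ (dbM S a u)) (sfDE _ _ Dz) !(sfME _ _ Dz) az mul0r addr0.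
  by [].
rewrite (ev1 _ _ (esym (ddb S u))).
rewrite (sf_lap u Dz) !cd2 => h.
have := congr1 (@Re R) h; rewrite {1}uz.
move: x2 y2 hpos; move: ('D_ex _ z) ('D_ey _ z) (Re (u z)) (db S a z) => x y t b.
move=> hx hy ht; rewrite !ReM ReD /= ?mulr0 ?mul0r ?addr0 ?subr0 => e.
rewrite leNgt; apply/negP => b0.
have : 0 < Re b * t by rewrite mulr_gt0.
rewrite -e; lra.
Qed.

End MaxLogd.

Section Restriction.
Context {R : realType} (D D' : opn R).
Hypothesis sub : oset D' `<=` oset D.

Lemma csm_sub (u : plane R -> R[i]) : csm D u -> csm D' u.
Proof. by move=> hu n; have [h1 h2] := hu n; split; apply: ck_sub sub _. Qed.

Definition sf_res (u : sfun D) : sfun D' := mkS (csm_sub (sf_smooth u)).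

Lemma sf_resE u z : oset D' z -> sf_res u z = u z.
Proof. exact: mkSE. Qed.

Lemma sf_resM u v : sf_res (u * v) = sf_res u * sf_res v.
Proof.
apply: sfunP => z Dz; rewrite (sf_resE _ Dz) (sfME _ _ (sub Dz)) (sfME _ _ Dz).
by rewrite !(sf_resE _ Dz).
Qed.

Lemma sf_res_dd u : sf_res (dd (sfd D) u) = dd (sfd D') (sf_res u).
Proof.
apply: sfunP => z Dz; rewrite (sf_resE _ Dz) (sfddE _ (sub Dz)) (sfddE _ Dz).
by apply: (dz_ext (@oopen _ D') Dz) => x Dx; rewrite (sf_resE _ Dx).
Qed.

Lemma sf_res_cj u : sf_res (cj (sfd D) u) = cj (sfd D') (sf_res u).
Proof.
apply: sfunP => z Dz; rewrite (sf_resE _ Dz) (sfcjE _ (sub Dz)) (sfcjE _ Dz).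
by rewrite (sf_resE _ Dz).
Qed.

Lemma sf_res_db u : sf_res (db (sfd D) u) = db (sfd D') (sf_res u).
Proof. by rewrite /db sf_res_cj sf_res_dd sf_res_cj. Qed.

Lemma sf_res_logd u a : logd (sfd D) u a -> logd (sfd D') (sf_res u) (sf_res a).
Proof. by rewrite /logd -sf_res_dd => ->; exact: sf_resM. Qed.

End Restriction.

Section Coordinate.
Context {R : realType} (D : opn R) (q : plane R).
Local Notation K := (sfun D).
Local Notation S := (sfd D).
Let oD := @oopen R D.

Lemma ck_linear n (L : {linear plane R -> R}) (c : R) : continuous L ->
  ck D n (fun x => L x + c).
Proof.
move=> Lc; have dL x : differentiable L x by apply: linear_differentiable.
apply: (ckD oD); last exact: ck_cst.
case: n => [|n]; split=> // w.
rewrite (_ : 'D_w L = fun=> L w); first exact: ck_cst.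
by apply/funext => x; rewrite deriveE // diff_lin.
Qed.

Lemma fst_cont : continuous (fst : plane R -> R).
Proof. by move=> x; apply: cvg_fst. Qed.
Lemma snd_cont : continuous (snd : plane R -> R).
Proof. by move=> x; apply: cvg_snd. Qed.

Definition zeta_fun (x : plane R) : R[i] := (x.1 - q.1) +i* (x.2 - q.2).

Lemma csm_zeta : csm D zeta_fun.
Proof.
move=> n; split.
- apply: (ck_linear n (L := fst)); exact: fst_cont.
- apply: (ck_linear n (L := snd)); exact: snd_cont.
Qed.

Definition zeta : K := mkS csm_zeta.
Lemma zetaE z : oset D z -> zeta z = zeta_fun z.
Proof. exact: mkSE. Qed.

Lemma cder_zeta z w : oset D z -> cder w zeta z = w.1 +i* w.2.
Proof.
move=> Dz; rewrite (cder_ext oD w Dz (@zetaE)) /cder.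
have e (L : {linear plane R -> R}) (c : R) : continuous L -> 'D_w (fun x => L x + c) z = L w.
  move=> Lc; rewrite derD; [|exact: linear_differentiable|exact: differentiable_cst].
  by rewrite derive_cst addr0 deriveE ?diff_lin //; exact: linear_differentiable.
congr (_ +i* _).
  by apply: (e fst); exact: fst_cont.
by apply: (e snd); exact: snd_cont.
Qed.

Lemma dd_zeta : dd S zeta = 1.
Proof.
apply: sfunP => z Dz; rewrite (sfddE _ Dz) (sf1E Dz) dzE !cder_zeta //=.
by apply: complex_ext; rewrite /=; field.
Qed.

Lemma db_zeta : db S zeta = 0.
Proof.
apply: sfunP => z Dz; rewrite (sfdbE _ Dz) (sf0E Dz) dzE.
have dzt := sf_diff zeta Dz.
rewrite (cder_conj ex dzt) (cder_conj ey dzt) !cder_zeta //=.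
by apply: complex_ext; rewrite /=; field.
Qed.

(* The function 1 + |zeta|^2 is strictly log-subharmonic. *)
Lemma logd_bump iT : let T := 1 + zeta * cj S zeta in T * iT = 1 ->
  exists2 a, logd S T a & db S a = iT * iT.
Proof.
move=> T hT; exists (cj S zeta * iT).
  rewrite /logd ddD dd1 ddM dd_zeta -{1}(cjK S (dd S (cj S zeta))).
  rewrite -[cj S (dd S (cj S zeta))]/(db S zeta) db_zeta cj0.
  transitivity (cj S zeta * (T * iT)); first by rewrite hT; ring.
  by ring.
have dbT : db S T = zeta.
  by rewrite dbD db1 dbM db_zeta /db cjK dd_zeta cj1; ring.
have dbi : db S iT = - zeta * iT * iT.
  have h : db S (T * iT) = 0 by rewrite hT db1.
  move: h; rewrite dbM dbT addrC => /eqP; rewrite addr_eq0 => /eqP h.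
  by rewrite -[LHS]mul1r -hT mulrAC h; ring.
have dbc : db S (cj S zeta) = 1 by rewrite /db cjK dd_zeta cj1.
rewrite dbM dbi dbc; transitivity (iT * (T * iT) - zeta * cj S zeta * iT * iT).
  by rewrite hT; ring.
by rewrite /T; ring.
Qed.

End Coordinate.

(** * Maximum principle and unique continuation *)

Lemma continuous_for_exprn {R : realType} (T : topologicalType) (f : T -> R) x n :
  {for x, continuous f} -> {for x, continuous (fun y => f y ^+ n)}.
Proof.
move=> fc; elim: n => [|n IH].
  by rewrite (_ : (fun _ => _) = fun=> 1); [exact: cst_continuous|apply/funext => y].
rewrite (_ : (fun _ => _) = fun y => f y * f y ^+ n); first exact: cvgM.
by apply/funext => y; rewrite exprS.
Qed.

Lemma dd_sf_cst {R : realType} (D : opn R) (c : R[i]) : dd (sfd D) (sf_cst D c) = 0.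
Proof.
apply: sfunP => x Dx; rewrite (sfddE _ Dx) (sf0E Dx).
rewrite (dz_ext (@oopen _ D) Dx (v := fun=> c)); last first.
  by move=> t Dt; rewrite (sf_cstE _ Dt).
rewrite dzE /cder (_ : refun _ = cst (Re c)) // (_ : imfun _ = cst (Im c)) // !derive_cst.
by apply: complex_ext; rewrite /=; ring.
Qed.

Section ThreeCircles.
Context {R : realType}.

Definition sqdist (q x : plane R) : R := (x.1 - q.1) ^+ 2 + (x.2 - q.2) ^+ 2.

Lemma sqdist_cont q : continuous (sqdist q).
Proof.
move=> x; apply: cvgD; apply: cvgM; apply: cvgB;
  by [exact: fst_cont|exact: snd_cont|exact: cvg_cst].
Qed.

Lemma sqdist_ge0 q x : 0 <= sqdist q x.
Proof. by rewrite addr_ge0 ?sqr_ge0. Qed.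

Lemma sqdist_compact q a b : compact [set x | a <= sqdist q x <= b].
Proof.
have cB : compact ([set` `[q.1 - (1 + b), q.1 + (1 + b)]] `*`
                   [set` `[q.2 - (1 + b), q.2 + (1 + b)]]).
  by apply: compact_setX; exact: segment_compact.
apply: (subclosed_compact _ cB).
  rewrite (_ : [set x | _] = sqdist q @^-1` [set` `[a, b]]).
    by apply: closed_comp; [move=> x _; exact: sqdist_cont|exact: interval_closed].
  by apply/seteqP; split => x; rewrite /= in_itv.
have sq (t : R) : t ^+ 2 <= b -> - (1 + b) <= t <= 1 + b.
  move=> h; have := sqr_ge0 (t - 1); have := sqr_ge0 (t + 1); have := sqr_ge0 t.
  rewrite sqrrD sqrrB !expr1n mulr1; move: h; set s := t ^+ 2.
  by move=> *; apply/andP; split; lra.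
move=> x /= /andP[_]; rewrite /sqdist => h; rewrite !in_itv /=.
have := sqr_ge0 (x.1 - q.1); have := sqr_ge0 (x.2 - q.2) => h1 h2.
have /sq/andP[] : (x.1 - q.1) ^+ 2 <= b by lra.
have /sq/andP[] : (x.2 - q.2) ^+ 2 <= b by lra.
by move=> *; split; apply/andP; split; lra.
Qed.

Lemma bernoulli (d : R) k : 0 <= d -> 1 + d *+ k <= (1 + d) ^+ k.
Proof.
move=> d0; elim: k => [|k IH]; first by rewrite mulr0n expr0 addr0.
have h : 0 <= d *+ k by rewrite mulrn_wge0.
rewrite exprS mulrS; apply: le_trans (_ : (1 + d) * (1 + d *+ k) <= _); last first.
  by rewrite ler_pM2l //; lra.
have : 0 <= d * (d *+ k) by rewrite mulr_ge0.
by rewrite mulrDl mul1r mulrDr mulr1; lra.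
Qed.

Lemma real_monomial (h N b c : R) n k :
  h%:C * (1 + N%:C) ^+ n * (b%:C * c%:C) ^+ k =
  (h * (1 + N) ^+ n * (b * c) ^+ k)%:C :> R[i].
Proof.
have -> : 1 + N%:C = (1 + N)%:C :> R[i] by apply: complex_ext; rewrite //= addr0.
have -> : b%:C * c%:C = (b * c)%:C :> R[i] by rewrite rmorphM.
by rewrite -!rmorphXn -!rmorphM.
Qed.

Lemma Re_inv_sqr (N : R) : Re ((1 + N%:C)^-1 * (1 + N%:C)^-1) = (1 + N) ^- 2.
Proof.
have -> : 1 + N%:C = (1 + N)%:C :> R[i] by apply: complex_ext; rewrite //= addr0.
by rewrite -fmorphV -rmorphM /= -exprVn expr2.
Qed.

Lemma zeta_norm (D : opn R) q (z : plane R) : oset D z ->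
  (zeta D q * cj (sfd D) (zeta D q)) z = (sqdist q z)%:C.
Proof.
move=> Dz; rewrite (sfME _ _ Dz) (sfcjE _ Dz) (zetaE q Dz).
by apply: complex_ext; rewrite /= /sqdist; ring.
Qed.

(* Apply the maximum principle on an annulus to h (1 + |zeta|^2)^M (b/|zeta|^2)^k
   and let k tend to infinity. *)
Lemma three_circles (q : plane R) (a b C : R) (h : plane R -> R) :
  0 < a -> 0 <= C ->
  (forall x, sqdist q x <= b -> {for x, continuous h}) ->
  (forall x, sqdist q x <= b -> 0 <= h x) ->
  (forall x, sqdist q x <= a -> h x = 0) ->
  (forall x, a < sqdist q x < b -> 0 < h x ->
     exists (D : opn R) (u l : sfun D), [/\ oset D x, logd (sfd D) u l,
       forall y, oset D y -> u y = (h y)%:C & - C <= Re (db (sfd D) l x)]) ->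
  forall x, sqdist q x < b -> h x = 0.
Proof.
move=> a0 C0 hc h0 ha hl x0 x0b; apply/eqP; rewrite eq_le (h0 x0 (ltW x0b)) andbT.
rewrite leNgt; apply/negP => hx0.
have ax0 : a < sqdist q x0.
  by rewrite ltNge; apply/negP => /ha h'; rewrite h' ltxx in hx0.
have b0 : 0 < b by apply: lt_trans x0b; apply: lt_trans ax0.
pose A := [set x | a <= sqdist q x <= b].
have Ax0 : A x0 by rewrite /A /= !ltW.
have cA : compact A by exact: sqdist_compact.
have A0 : A !=set0 by exists x0.
(* On the disc [sqdist q x <= b] each factor 1 + |zeta|^2 contributes at least (1 + b)^-2 to dbar d
   log, so Mn of them outweigh the bound -C. *)
have [Mn hMn] : exists Mn : nat, C * (1 + b) ^+ 2 < Mn%:R.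
  by exists (Num.bound (C * (1 + b) ^+ 2)); apply: archi_boundP; rewrite mulr_ge0 ?sqr_ge0.
pose w k x := h x * (1 + sqdist q x) ^+ Mn * (b * (sqdist q x)^-1) ^+ k.
have wc k : {within A, continuous (w k)}.
  apply: continuous_in_subspaceT => x; rewrite inE /A /= => /andP[ax xb].
  have dx : {for x, continuous (sqdist q)} by exact: sqdist_cont.
  have c1 : {for x, continuous (fun y => b * (sqdist q y)^-1)}.
    apply: cvgM; first exact: cvg_cst.
    by apply: cvgV => //; rewrite gt_eqF // (lt_le_trans a0).
  have c2 : {for x, continuous (fun y => 1 + sqdist q y)}.
    by apply: cvgD => //; exact: cvg_cst.
  have c3 := @continuous_for_exprn R _ _ x k c1.
  have c4 := @continuous_for_exprn R _ _ x Mn c2.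
  have c5 : {for x, continuous h} by exact: hc.
  exact: cvgM (cvgM c5 c4) c3.
(* On the outer circle b/|zeta|^2 = 1, so the maximum m for exponent 0 bounds [w k] there for every
   k. *)
have [y0 Ay0 hy0] := compact_EVT_max A0 cA (wc 0%N).
set m := w 0%N y0 in hy0.
have hm0 : 0 <= m.
  apply: le_trans (hy0 x0 _); last by rewrite inE.
  rewrite /w expr0 mulr1 mulr_ge0 ?(ltW hx0) // exprn_ge0 //.
  by have := sqdist_ge0 q x0; lra.
have N0 : 0 < sqdist q x0 by apply: lt_trans ax0.
pose d := b / sqdist q x0 - 1.
have d0 : 0 < d by rewrite /d subr_gt0 ltr_pdivlMr // mul1r.
(* At x0 the ratio b/|zeta|^2 is 1 + d > 1. For large k the value at x0 exceeds m, so the maximum is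
   not on the outer circle; on the inner one h = 0. *)
have [k hk] : exists k : nat, m / h x0 < (1 + d) ^+ k.
  have [k hk] : exists k : nat, m / h x0 / d < k%:R.
    by exists (Num.bound (m / h x0 / d)); apply: archi_boundP; rewrite !divr_ge0 // ltW.
  exists k; apply: lt_le_trans (bernoulli k (ltW d0)).
  by rewrite ltr_pdivrMr // in hk; rewrite -mulr_natl; lra.
have [y Ay hy] := compact_EVT_max A0 cA (wc k).
have wx0 : m < w k x0.
  rewrite ltr_pdivrMr // mulrC in hk; apply: (lt_le_trans hk).
  have -> : 1 + d = b * (sqdist q x0)^-1 by rewrite /d; ring.
  rewrite /w ler_wpM2r ?exprn_ge0 ?mulr_ge0 ?invr_ge0 ?sqdist_ge0 ?(ltW b0) //.
  rewrite ler_peMr ?(ltW hx0) // exprn_ege1 //.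
  by have := sqdist_ge0 q x0; lra.
have wy : m < w k y by apply: lt_le_trans wx0 (hy x0 _); rewrite inE.
have /andP[ay yb] : a <= sqdist q y <= b by move: Ay; rewrite inE.
have yb' : sqdist q y < b.
  rewrite lt_neqAle yb andbT; apply/eqP => e.
  have := hy0 y Ay; rewrite leNgt => /negP; apply; apply: lt_le_trans wy _.
  by rewrite /w e mulfV ?gt_eqF // expr1n expr0.
have hy1 : 0 < h y.
  rewrite lt_neqAle h0 // andbT; apply/eqP => e.
  by move: wy; rewrite /w -e !mul0r ltNge hm0.
have ay' : a < sqdist q y.
  by rewrite ltNge; apply/negP => /ha e; rewrite e ltxx in hy1.
have [|D [u [l [Dy hul hu hdb]]]] := hl y _ hy1; first by rewrite ay' yb'.
pose O := oset D `&` (sqdist q @^-1` [set` `]a, b[]).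
have oO : open O.
  apply: openI; first exact: oopen.
  by apply: open_comp; [move=> x _; exact: sqdist_cont|exact: interval_open].
pose D' := Opn oO.
have sub : oset D' `<=` oset D by move=> x [].
have D'y : oset D' y by split => //; rewrite /= in_itv /= ay' yb'.
have inA x : oset D' x -> a < sqdist q x < b by move=> [_]; rewrite /= in_itv.
pose z := zeta D' q; pose S := sfd D'.
have zz x : oset D' x -> (z * cj S z) x = (sqdist q x)%:C by exact: zeta_norm.
have z0 x : oset D' x -> z x != 0.
  move=> Dx; have := zz x Dx; rewrite (sfME _ _ Dx) => e; apply/eqP => e0.
  move: e; rewrite e0 mul0r => /(congr1 (@Re R)) /= /esym e.
  by have /andP[] := inA x Dx; rewrite e ltNge (ltW a0).
have T0 x : oset D' x -> (1 + z * cj S z) x != 0.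
  move=> Dx; rewrite (sfDE _ _ Dx) (sf1E Dx) zz // eq_complex /= addr0 eqxx andbT.
  by rewrite gt_eqF //; have := sqdist_ge0 q x; lra.
have [iz hz hiz] := sf_inv z0.
have [iT hT hiT] := sf_inv T0.
have diz : db S iz = 0.
  have e : db S (z * iz) = 0 by rewrite hz db1.
  move: e; rewrite dbM (db_zeta D' q) mul0r add0r => e.
  by rewrite -[LHS]mul1r -hz mulrAC e mul0r.
(* 1/zeta is holomorphic on the annulus, so the k-th power adds nothing to dbar d log and k is
   free. *)
have [lz hlz dlz] : exists2 lz, logd S (iz * cj S iz) lz & db S lz = 0.
  by apply: (@logd_holomorphic _ S iz z); rewrite // mulrC.
have [lT hlT dlT] := logd_bump hT.
have hlb : logd S (sf_cst D' b%:C) 0.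
  by rewrite /logd mul0r dd_sf_cst.
pose U := sf_res sub u * (1 + z * cj S z) ^+ Mn * (sf_cst D' b%:C * (iz * cj S iz)) ^+ k.
have hU := logdM (logdM (sf_res_logd sub hul) (logdX Mn hlT)) (logdX k (logdM hlb hlz)).
have Uw x : oset D' x -> U x = (w k x)%:C.
  move=> Dx; rewrite /U !(sfME _ _ Dx) !(sfXE _ _ Dx) !(sfME _ _ Dx) (sfDE _ _ Dx).
  rewrite (sf1E Dx) zz // (sf_resE sub _ Dx) hu; last by case: Dx.
  rewrite (sf_cstE _ Dx) (sfcjE _ Dx) hiz //.
  have -> : (z x)^-1 * conjc (z x)^-1 = ((sqdist q x)^-1)%:C.
    have := zz x Dx; rewrite (sfME _ _ Dx) (sfcjE _ Dx) => e.
    by rewrite fmorphV /= -invfM e fmorphV.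
  exact: real_monomial.
have := max_logd D'y hU; rewrite (Uw y D'y) /=.
have pI x : oset D' x -> Im (U x) = 0 by move=> Dx; rewrite Uw.
have pM x : oset D' x -> Re (U x) <= w k y.
  move=> Dx; rewrite Uw //=; apply: hy; rewrite inE.
  by have /andP[h1 h2] := inA x Dx; rewrite /A /= !ltW.
move=> /(_ pI pM (le_lt_trans hm0 wy)).
have -> : Re (db S (sf_res sub l + lT *+ Mn + (0 + lz) *+ k) y) =
    Re (db (sfd D) l y) + ((1 + sqdist q y) ^- 2) *+ Mn.
  rewrite dbD dbD !dbMn dbD dlz db0 addr0 mul0rn addr0 dlT.
  rewrite (sfDE _ _ D'y) -(sf_res_db sub) (sf_resE sub _ D'y) ReD; congr (_ + _).
  elim: (Mn) => [|j IH]; first by rewrite !mulr0n (sf0E D'y).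
  rewrite !mulrS (sfDE _ _ D'y) ReD IH; congr (_ + _).
  rewrite (sfME _ _ D'y) hiT // (sfDE _ _ D'y) (sf1E D'y) zz //.
  exact: Re_inv_sqr.
apply/negP; rewrite -ltNge.
apply: lt_le_trans (_ : - C + ((1 + sqdist q y) ^- 2) *+ Mn <= _); last by rewrite lerD2r.
rewrite addrC subr_gt0.
have s0 := sqdist_ge0 q y.
have p1 : 0 < (1 + sqdist q y) ^+ 2 by rewrite exprn_gt0 //; lra.
rewrite -mulr_natl ltr_pdivlMr //; apply: le_lt_trans hMn.
by rewrite ler_wpM2l // lerXn2r ?nnegrE; lra.
Qed.

End ThreeCircles.

Section Charts.
Context {R : realType} {M : topologicalType} (c : chart R M).

Lemma chart_inv_at z : chart_cod c z -> {for z, continuous (chart_inv c)}.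
Proof.
move=> cz; have : {within chart_cod c, continuous (chart_inv c)} by exact: chart_inv_cont.
rewrite (continuous_open_subspace _ (@chart_cod_open _ _ c)) => h.
by apply: h; rewrite inE.
Qed.

Lemma chart_map_at p : chart_dom c p -> {for p, continuous (chart_map c)}.
Proof.
move=> cp; have : {within chart_dom c, continuous (chart_map c)} by exact: chart_map_cont.
rewrite (continuous_open_subspace _ (@chart_dom_open _ _ c)) => h.
by apply: h; rewrite inE.
Qed.

Lemma near_chart_inv z (A : set M) : chart_cod c z -> nbhs (chart_inv c z) A ->
  nbhs z (chart_inv c @^-1` A).
Proof. by move=> cz; apply: chart_inv_at. Qed.

Lemma near_chart_map p (A : set (plane R)) : chart_dom c p -> nbhs (chart_map c p) A ->
  nbhs p (chart_map c @^-1` A).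
Proof. by move=> cp; apply: chart_map_at. Qed.

Lemma near_dom p : chart_dom c p -> \forall q \near p, chart_dom c q.
Proof. by move=> cp; apply: open_nbhs_nbhs; split => //; exact: chart_dom_open. Qed.

Lemma near_cod z : chart_cod c z -> \forall x \near z, chart_cod c x.
Proof. by move=> cz; apply: open_nbhs_nbhs; split => //; exact: chart_cod_open. Qed.

End Charts.

Section SqDist.
Context {R : realType}.
Implicit Types q x z : plane R.

Lemma near_sqdist z (P : set (plane R)) : nbhs z P ->
  exists2 e : R, 0 < e & forall x, sqdist z x < e -> P x.
Proof.
move=> /nbhs_norm_ball[e e0 He]; exists (e ^+ 2); first by rewrite exprn_gt0.
move=> x hx; rewrite -(subrK z x); apply: He.
have lt_e (t s : R) : t ^+ 2 + s ^+ 2 < e ^+ 2 -> `|t| < e.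
  move=> h; rewrite -(@ltr_pXn2r _ 2) ?nnegrE ?normr_ge0 ?(ltW e0) //.
  by rewrite real_normK ?num_real //; apply: le_lt_trans h; rewrite lerDl sqr_ge0.
rewrite prod_normE /= gt_max (lt_e _ (x.2 - z.2)) //=.
by apply: (lt_e _ (x.1 - z.1)); rewrite addrC.
Qed.

Lemma sqdist_near q z e : sqdist q z < e -> \forall x \near z, sqdist q x < e.
Proof.
move=> h; apply: (@sqdist_cont R q z [set t | t < e]).
by apply: open_nbhs_nbhs; split => //; exact: open_lt.
Qed.

Lemma sqdist_triangle z q x : sqdist z x <= 2 * sqdist z q + 2 * sqdist q x.
Proof.
rewrite /sqdist; move: z.1 z.2 q.1 q.2 x.1 x.2 => a b c d e f.
have := sqr_ge0 (2 * c - a - e); have := sqr_ge0 (2 * d - b - f); nra.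
Qed.

Lemma sqdistC z q : sqdist z q = sqdist q z.
Proof. by rewrite /sqdist; ring. Qed.

End SqDist.

Section Global.
Context {R : realType} {M : topologicalType} (X : riemann_surface R M).

(** Compactness provides a maximum; if it were positive, strict subharmonicity of log w would
    contradict [max_logd] there. *)
Lemma max_principle (w : M -> R) : compact [set: M] -> continuous w ->
  (forall p, 0 <= w p) ->
  (forall c z, atlas X c -> chart_cod c z -> 0 < w (chart_inv c z) ->
    exists (D : opn R) (u l : sfun D), [/\ oset D z, logd (sfd D) u l,
      forall y, oset D y -> u y = (w (chart_inv c y))%:C & 0 < Re (db (sfd D) l z)]) ->
  forall p, w p = 0.
Proof.
move=> cM wc w0 hw p0.
have [p _ hp] : exists2 p, p \in [set: M] & forall q, q \in [set: M] -> w q <= w p.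
  apply: compact_EVT_max => //; first by exists p0.
  by apply: continuous_subspaceT.
have {}hp q : w q <= w p by apply: hp; rewrite inE.
have [c ac cp] := atlas_cover X p.
suff : w p <= 0 by move=> h; apply/eqP; rewrite eq_le w0 (le_trans (hp p0) h).
rewrite leNgt; apply/negP => wp.
have cz := chart_map_cod cp; have pz := chart_mapK cp.
have [|D [u [l [Dz hul hu hl]]]] := hw c _ ac cz; first by rewrite pz.
have := max_logd Dz hul; rewrite (hu _ Dz) /= pz => /(_ _ _ wp) h.
have : Re (db (sfd D) l (chart_map c p)) <= 0.
  by apply: h => x Dx; rewrite (hu _ Dx) /= ?hp.
by rewrite leNgt hl.
Qed.

(** The set of points near which h vanishes is open by definition; [three_circles], centred at a
    point of this set close to a limit point, shows that it is closed. *)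
Lemma unique_continuation (h : M -> R) : continuous h -> (forall p, 0 <= h p) ->
  (forall c z, atlas X c -> chart_cod c z -> exists C : R, 0 <= C /\
    \forall x \near z, 0 < h (chart_inv c x) ->
      exists (D : opn R) (u l : sfun D), [/\ oset D x, logd (sfd D) u l,
        forall y, oset D y -> u y = (h (chart_inv c y))%:C &
        - C <= Re (db (sfd D) l x)]) ->
  (exists p : M, \forall q \near p, h q = 0) -> forall p, h p = 0.
Proof.
move=> hc h0 hh [p0 hp0].
pose Z := [set p : M | \forall q \near p, h q = 0].
have oZ : open Z.
  rewrite openE => p Zp; rewrite /interior /=.
  by move: Zp; rewrite /Z /= => /near_join.
have cZ : closed Z.
  move=> p clp; have [c ac cp] := atlas_cover X p.
  have cz := chart_map_cod cp; have pz := chart_mapK cp; set z := chart_map c p in cz pz.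
  have [C [C0 hC]] := hh c z ac cz.
  have [e e0 He] := near_sqdist (filterI hC (near_cod cz)).
  (* If sqdist z q < e/8, the disc about q of squared radius e/4 contains z, and by
     [sqdist_triangle] squared distances to z in it are below 2 e/8 + 2 e/4 < e. *)
  have e8 : 0 < e / 8 by rewrite divr_gt0.
  have : nbhs p (chart_dom c `&` chart_map c @^-1` [set x | sqdist z x < e / 8]).
    apply: filterI; first exact: near_dom.
    apply: near_chart_map => //; apply: sqdist_near.
    by rewrite /sqdist !subrr expr0n /= addr0.
  move=> /clp[p' [Zp' [cp' /= hq]]]; set q := chart_map c p' in hq.
  have cq := chart_map_cod cp'; have pq := chart_mapK cp'.
  have : nbhs q (chart_inv c @^-1` [set p | h p = 0]).
    by apply: near_chart_inv => //; rewrite pq.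
  move=> /near_sqdist[a a0 Ha].
  have b0 : 0 < e / 4 by rewrite divr_gt0.
  have inN x : sqdist q x <= e / 4 -> sqdist z x < e.
    by move=> hx; have := sqdist_triangle z q x; lra.
  have hcz x : sqdist q x <= e / 4 -> chart_cod c x by move=> /inN/He[].
  have hzero := @three_circles R q (a / 2) (e / 4) C (h \o chart_inv c).
  have {}hzero x : sqdist q x < e / 4 -> h (chart_inv c x) = 0.
    apply: hzero => //.
    - by rewrite divr_gt0.
    - move=> y /hcz cy; apply: continuous_comp; first exact: chart_inv_at.
      exact: hc.
    - by move=> y _; exact: h0.
    - move=> y hy; have hy' : sqdist q y < a by lra.
      exact: (Ha y hy').
    - move=> y /andP[_ hy]; apply: (He _ (inN _ _)).1; exact: ltW.
  have zq : sqdist q z < e / 4 by rewrite sqdistC; lra.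
  rewrite /Z /=.
  have : nbhs p (chart_dom c `&` chart_map c @^-1` [set x | sqdist q x < e / 4]).
    by apply: filterI; [exact: near_dom|apply: near_chart_map => //; apply: sqdist_near].
  by apply: filterS => p'' [cp'' /= /hzero]; rewrite (chart_mapK cp'').
have : Z = [set: M].
  apply: (surface_connected X); first by exists p0.
    by exists Z => //; rewrite setTI.
  by exists Z => //; rewrite setTI.
by move=> ZT p; have : Z p by [rewrite ZT]; apply: (@nbhs_singleton _ p).
Qed.

End Global.

(** * Fundamental forms and curvature ellipses *)

Section RealPart.
Context {R : realType}.

Definition tz (w : plane R) : R[i] := w.1 +i* w.2.
Definition vRe m (V : 'rV[R[i]]_m) : 'rV[R]_m := map_mx (fun t : R[i] => Re t) V.

Lemma vReD m (V W : 'rV[R[i]]_m) : vRe (V + W) = vRe V + vRe W.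
Proof. by apply/rowP => j; rewrite !mxE ReD. Qed.
Lemma vReN m (V : 'rV[R[i]]_m) : vRe (- V) = - vRe V.
Proof. by apply/rowP => j; rewrite !mxE ReN. Qed.
Lemma vReJ m (V : 'rV[R[i]]_m) : vRe (vconj V) = vRe V.
Proof. by apply/rowP => j; rewrite !mxE ReJ. Qed.
Lemma vReZJ m (t : R[i]) (V : 'rV[R[i]]_m) : vRe (conjc t *: vconj V) = vRe (t *: V).
Proof. by rewrite -[RHS]vReJ vconjZ. Qed.
Lemma vRe_cvec m F (z : plane R) : vRe (cvec F z) = F z :> 'rV[R]_m.
Proof. by apply/rowP => j; rewrite !mxE. Qed.

Lemma dot_Re m (V W : 'rV[R[i]]_m) :
  dot (vRe V) (vRe W) = 2^-1 * Re (bdot V W + bdot V (vconj W)).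
Proof.
rewrite -bdotDr /bdot /dot (big_morph _ (@ReD R) erefl) mulr_sumr.
apply: eq_bigr => i _; rewrite !mxE.
by rewrite ReM ReD ImD ReJ ImJ; field.
Qed.

Lemma cder_tz w (u : plane R -> R[i]) z : cdiff u z ->
  cder w u z = tz w * dz u z + conjc (tz w) * conjc (dz (fun y => conjc (u y)) z).
Proof.
move=> du; have [d1 d2] := du.
rewrite !dzE (cder_conj ex du) (cder_conj ey du).
have e (a : plane R -> R) : differentiable a z ->
    'D_w a z = w.1 * 'D_ex a z + w.2 * 'D_ey a z.
  move=> da; rewrite !deriveE // -[w.1 * _]/(w.1 *: _) -[w.2 * _]/(w.2 *: _).
  rewrite -!linearZ -linearD; congr ('d a z _).
  case: w => x y; apply: injective_projections.
    by change (x = x * 1 + y * 0); rewrite mulr1 mulr0 addr0.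
  by change (y = x * 0 + y * 1); rewrite mulr1 mulr0 add0r.
have -> : cder w u z = (w.1)%:C * cder ex u z + (w.2)%:C * cder ey u z.
  rewrite /cder (e _ d1) (e _ d2).
    move: ('D_ex (refun u) z) ('D_ex (imfun u) z) ('D_ey (refun u) z) ('D_ey (imfun u) z).
    by move=> a b a' b'; apply: complex_ext; rewrite /=; ring.
move: (cder ex u z) (cder ey u z) => [a b] [a' b']; rewrite /tz.
by apply: complex_ext; rewrite /=; field.
Qed.

Section Field.
Context {D : opn R} {m : nat}.
Local Notation S := (sfd D).
Implicit Type u : 'rV[sfun D]_m.+1.

Lemma diff_rowfun (G : plane R -> 'rV[R]_m.+1) z :
  (forall j, differentiable (fun x => G x 0 j) z) -> differentiable G z.
Proof.
move=> h.
have -> : G = fun x => \sum_j (G x 0 j *: delta_mx 0 j).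
  by apply/funext => x; rewrite {1}(row_sum_delta (G x)).
elim: (index_enum _) => [|i r IH].
  rewrite (_ : (fun x => _) = fun=> 0); first exact: differentiable_cst.
  by apply/funext => x; rewrite big_nil.
rewrite (_ : (fun x => _) =
  (fun x => G x 0 i *: delta_mx 0 i) + fun x => \sum_(j <- r) (G x 0 j *: delta_mx 0 j)).
  by apply: differentiableD => //; exact: differentiableZl.
by apply/funext => x; rewrite big_cons.
Qed.

Lemma diff_Re u z : oset D z -> differentiable (fun x => vRe (evv x u)) z.
Proof.
move=> Dz; apply: diff_rowfun => j.
rewrite (_ : (fun x => _) = refun (u 0 j)); first exact: (sf_diff (u 0 j) Dz).1.
by apply/funext => x; rewrite !mxE.
Qed.

Lemma der_Re u z w : oset D z ->
  'D_w (fun x => vRe (evv x u)) z =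
    vRe (tz w *: evv z (vd S u) + conjc (tz w) *: evv z (vb S u)).
Proof.
move=> Dz; apply/rowP => j.
have dG := diff_Re u Dz.
rewrite (der_coord j (diff_derivable dG)).
rewrite (_ : (fun x => vRe (evv x u) 0 j) = refun (u 0 j)); last first.
  by apply/funext => x; rewrite !mxE.
have := congr1 (fun t : R[i] => Re t) (cder_tz w (sf_diff (u 0 j) Dz)).
rewrite {1}/cder [Re (_ +i* _)]/= => ->.
by rewrite mxE rowD !rowZ !(mxE map_mx_key) (sfddE _ Dz) (sfdbE _ Dz).
Qed.

End Field.
End RealPart.

Lemma dot_sum3 {R : realType} m (u a b c : 'rV[R]_m) :
  dot u a = 0 -> dot u b = 0 -> dot u c = 0 -> dot u (a + b + c) = 0.
Proof. by move=> ha hb hc; rewrite !dotDr ha hb hc !addr0. Qed.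

Lemma cj_sf_cst {R : realType} (D : opn R) (t : R[i]) :
  cj (sfd D) (sf_cst D t) = sf_cst D (conjc t).
Proof. by apply: sfunP => x Dx; rewrite (sfcjE _ Dx) !(sf_cstE _ Dx). Qed.

Lemma db_sf_cst {R : realType} (D : opn R) (t : R[i]) : db (sfd D) (sf_cst D t) = 0.
Proof. by rewrite /db cj_sf_cst dd_sf_cst cj0. Qed.

Section FundamentalForms.
Context {R : realType} (n : nat).
Variables (D : opn R) (F : plane R -> 'rV[R]_n.+1).
Hypothesis H : conf_minimal D F.
Let oD := @oopen R D.
Local Notation f := (cmK H).
Local Notation S := (sfd D).
Local Notation p := (vd S f).
Variable iF : sfun D.
Hypothesis hi : cmF H * iF = 1.
Local Notation k := (kF S (cmF H) iF).
Local Notation A := (vA S f (cmF H) iF).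
Let Hh := cm_harm hi.

Lemma cm_Re x : oset D x -> F x = vRe (evv x f).
Proof. by move=> Dx; rewrite evv_f // vRe_cvec. Qed.

Lemma der_F w x : oset D x -> 'D_w F x = vRe ((2%:R * tz w) *: evv x p).
Proof.
move=> Dx.
have -> : 'D_w F x = 'D_w (fun y => vRe (evv y f)) x.
  by apply: near_eq_derive; apply: filterS (nearD oD Dx) => y Dy; rewrite cm_Re.
rewrite (der_Re f w Dx) -(vcp Hh) (evv_vc _ Dx) vReD vReZJ -vReD -scalerDl.
by congr (vRe (_ *: _)); ring.
Qed.

Lemma second_der v w x : oset D x -> 'D_v ('D_w F) x =
  vRe ((2%:R * tz v * tz w) *: evv x (vd S p) +
       (2%:R * conjc (tz v) * tz w) *: evv x (vb S p)).
Proof.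
move=> Dx.
have -> : 'D_v ('D_w F) x = 'D_v (fun y => vRe (evv y (sf_cst D (2%:R * tz w) *: p))) x.
  apply: near_eq_derive; apply: filterS (nearD oD Dx) => y Dy.
  by rewrite der_F // (evvZ _ _ Dy) (sf_cstE _ Dy).
rewrite (der_Re _ v Dx) vdZ vbZ.
rewrite dd_sf_cst db_sf_cst !scale0r !add0r !(evvZ _ _ Dx) !(sf_cstE _ Dx) !scalerA.
have e1 (a b : R[i]) : a * (2%:R * b) = 2%:R * a * b by ring.
by rewrite !e1.
Qed.

Lemma tangent_sub (t : R[i]) x : oset D x ->
  (vRe (t *: evv x p) <= pos_tangent F x)%MS.
Proof.
move=> Dx.
have -> : vRe (t *: evv x p) = 'D_(Re t / 2, Im t / 2) F x.
  rewrite der_F //; congr (vRe (_ *: _)).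
  by apply: complex_ext; rewrite /tz /=; field.
rewrite derive_pair; last exact: (cm_diff H Dx).
rewrite /pos_tangent -/ex -/ey addmx_sub //; apply: scalemx_sub.
  exact: submx_trans (addsmxSr _ _) (addsmxSl _ _).
exact: addsmxSr.
Qed.

Lemma position_sub (a : R) x : (a *: F x <= pos_tangent F x)%MS.
Proof.
by apply: scalemx_sub; exact: submx_trans (addsmxSl _ _) (addsmxSl _ _).
Qed.

Lemma perp_tangent (V : 'rV[R[i]]_n.+1) x : oset D x -> bdot V (evv x f) = 0 ->
  bdot V (evv x p) = 0 -> bdot V (vconj (evv x p)) = 0 -> perp (pos_tangent F x) (vRe V).
Proof.
move=> Dx Vf Vp Vpb; apply/perpP => w /sub_addsmxP[[w1 w2] /= ->].
have /sub_addsmxP[[w3 w4] /= ->] : (w1 *m (F x + 'D_(1%R, 0%R) F x)%MS <= F x + 'D_(1%R, 0%R) F x)%MS.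
  exact: submxMl.
have e (c : 'M[R]_1) (u : 'rV[R]_n.+1) : dot (vRe V) u = 0 -> dot (vRe V) (c *m u) = 0.
  by move=> h; rewrite [c]mx11_scalar mul_scalar_mx dotZr h mulr0.
have eD y : dot (vRe V) ('D_y F x) = 0.
  rewrite der_F // dot_Re vconjZ !bdotZr Vp Vpb !mulr0 addr0 mulr0 //.
have eF : dot (vRe V) (F x) = 0.
  have ef : vconj (evv x f) = evv x f by rewrite -(evv_vc _ Dx) (harm_real Hh).
  by rewrite cm_Re // dot_Re ef Vf addr0 mulr0.
by apply: dot_sum3; apply: e; [exact: eF|exact: eD|exact: eD].
Qed.

Lemma second_ff_aux (a b c l : R[i]) (P V f' : 'rV[R[i]]_n.+1) :
  vRe (a *: (l *: P + V) + b *: (c *: f')) - vRe (a *: V) =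
  vRe ((a * l) *: P) + vRe ((b * c) *: f').
Proof.
rewrite -vReN -!vReD; congr vRe; apply/rowP => j; rewrite !mxE.
by ring.
Qed.

(** The mixed second derivative dbar df = -F f is along the position vector, and dp = l p + A has
    normal part A; only the (2,0) part and its conjugate survive. *)
Lemma second_ffE v w x : oset D x ->
  second_ff F v w x = vRe ((2%:R * tz v * tz w) *: evv x A).
Proof.
move=> Dx; rewrite /second_ff; apply: orth_projE.
  apply: perp_tangent => //; rewrite bdotZl.
  - by rewrite -(evv_bdot _ _ Dx) bdotC (dot_Af Hh) (sf0E Dx) mulr0.
  - by rewrite -(evv_bdot _ _ Dx) bdotC (dot_Ap Hh) (sf0E Dx) mulr0.
  - by rewrite -(evv_vc _ Dx) -(evv_bdot _ _ Dx) bdotC (dot_Apb Hh) (sf0E Dx) mulr0.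
rewrite second_der // (vdp S f (cmF H) iF) (harm_lap Hh) !(evvD _ _ Dx) !(evvZ _ _ Dx) second_ff_aux.
apply: addmx_sub; first exact: tangent_sub.
have -> (t : R[i]) : vRe (t *: evv x f) = Re t *: F x.
  rewrite evv_f //; apply/rowP => j; rewrite !mxE ReM /=.
  by move: (F x 0 j) => a; ring.
exact: position_sub.
Qed.

End FundamentalForms.

Section Span.
Context {R : realType} (m : nat).
Implicit Types V W : 'rV[R[i]]_m.

Definition span2 V : 'M[R]_m := (vRe V + vRe ('i *: V))%MS.

Lemma vRe_split (t : R[i]) V :
  vRe (t *: V) = Re t *: vRe V + Im t *: vRe ('i *: V).
Proof. by apply/rowP => j; rewrite !mxE !(ReM, ImM) /=; ring. Qed.

Lemma span2_sub (t : R[i]) V : (vRe (t *: V) <= span2 V)%MS.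
Proof.
rewrite vRe_split; apply: addmx_sub; apply: scalemx_sub; [exact: addsmxSl|exact: addsmxSr].
Qed.

Lemma perp_span2 V W : bdot W V = 0 -> bdot W (vconj V) = 0 -> perp (span2 V) (vRe W).
Proof.
move=> h1 h2; apply/perpP => w /sub_addsmxP[[w1 w2] /= ->].
rewrite [w1]mx11_scalar [w2]mx11_scalar !mul_scalar_mx dotDr !dotZr !dot_Re vconjZ.
by rewrite !bdotZr h1 h2 !mulr0 !addr0 !mulr0 addr0.
Qed.

Lemma sum_span2 (T : finType) (c : T -> R[i]) V t1 t2 :
  c t1 = 2%:R -> c t2 = 2%:R * 'i ->
  (\sum_t <<vRe (c t *: V)>> :=: span2 V)%MS.
Proof.
move=> h1 h2; apply/eqmxP/andP; split.
  by apply/sumsmx_subP => t _; rewrite genmxE span2_sub.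
rewrite addsmx_sub; apply/andP; split.
  have -> : vRe V = 2^-1 *: vRe (c t1 *: V).
    by rewrite h1; apply/rowP => j; rewrite !mxE ReM /=; field.
  by apply: scalemx_sub; apply: (sumsmx_sup t1) => //; rewrite genmxE.
have -> : vRe ('i *: V) = 2^-1 *: vRe (c t2 *: V).
  by rewrite h2; apply/rowP => j; rewrite !mxE !(ReM, ImM) /=; field.
by apply: scalemx_sub; apply: (sumsmx_sup t2) => //; rewrite genmxE.
Qed.

Lemma rank_pair (a b : 'rV[R]_m) : dot a a * dot b b != dot a b ^+ 2 -> \rank (a + b)%MS = 2.
Proof.
move=> h; rewrite addsmxE; set X := col_mx a b; apply/eqP; apply/row_freeP.
set d := dot a a * dot b b - dot a b ^+ 2; have d0 : d != 0 by rewrite subr_eq0.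
(* X^T times the inverse of the Gram matrix X X^T, whose determinant is d. *)
exists (X^T *m (d^-1 *: block_mx (dot b b)%:M (- dot a b)%:M (- dot a b)%:M (dot a a)%:M)).
have e : X *m X^T = block_mx (dot a a)%:M (dot a b)%:M (dot a b)%:M (dot b b)%:M.
  rewrite tr_col_mx mul_col_row; congr block_mx; rewrite [LHS]mx11_scalar -dot_mx //.
  by rewrite dotC.
rewrite mulmxA e -scalemxAr mulmx_block -!scalar_mxM -!raddfD /=.
rewrite (scalar_mx_block 1 1) scale_block_mx !scale_scalar_mx.
have z1 : dot a a * - dot a b + dot a b * dot a a = 0 by ring.
have z2 : dot a b * dot b b + dot b b * - dot a b = 0 by ring.
rewrite z1 z2 mulr0 raddf0; congr block_mx; congr (_%:M);
  by rewrite -(mulVf d0) /d; ring.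
Qed.

(** The Gram determinant of Re V and Re iV is (|V|^4 - |<V, V>|^2)/4. *)
Lemma rank_span2 V : bdot V V * conjc (bdot V V) != bdot V (vconj V) ^+ 2 ->
  \rank (span2 V) = 2.
Proof.
move=> h; apply: rank_pair; rewrite !dot_Re vconjZ !bdotE.
have : bdot V (vconj V) = conjc (bdot V (vconj V)).
  rewrite bdotC /bdot rmorph_sum; apply: eq_bigr => i _; rewrite mxE.
  move: (V 0 i) => [a b]; apply: complex_ext; rewrite /=; ring.
move: h; move: (bdot V V) (bdot V (vconj V)) => [x y] [N N'].
rewrite /conjc => h [] N0; have {}N0 : N' = 0 by lra.
move: h; rewrite N0; apply: contra => /eqP.
rewrite /= => h; rewrite eq_complex /=; apply/andP; split; apply/eqP; [lra|ring].
Qed.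

End Span.

Lemma cdiff_near_neq0 {R : realType} (u : plane R -> R[i]) z : cdiff u z -> u z != 0 ->
  \forall y \near z, u y != 0.
Proof.
move=> [d1 d2] u0.
have hN : {for z, continuous (fun x => refun u x * refun u x + imfun u x * imfun u x)}.
  apply: differentiable_continuous.
  by apply: differentiableD; apply: differentiableM.
have N0 : refun u z * refun u z + imfun u z * imfun u z > 0.
  rewrite -!expr2 lt_def addr_ge0 ?sqr_ge0 // andbT.
  move: u0; apply: contra; rewrite paddr_eq0 ?sqr_ge0 //.
  by rewrite !expf_eq0 /= /refun /imfun eq_complex.
have h : \forall y \near z, 0 < refun u y * refun u y + imfun u y * imfun u y.
  apply: (hN [set t | 0 < t]).
  by apply: open_nbhs_nbhs; split => //; exact: open_gt.
apply: filterS h => y; apply: contraTneq => uy.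
by rewrite /refun /imfun uy /= !mul0r addr0 ltxx.
Qed.

Lemma sf_near_neq0 {R : realType} (D : opn R) (u : sfun D) z : oset D z -> u z != 0 ->
  \forall y \near z, u y != 0.
Proof. by move=> Dz; apply: cdiff_near_neq0; exact: sf_diff. Qed.

Section NormalFlag.
Context {R : realType} (n : nat).
Implicit Types F : plane R -> 'rV[R]_n.+1.

Lemma nabla_perp F vs z : perp (pos_tangent F z) (nabla_second_ff F vs z).
Proof.
case: vs => [|X1 [|X2 us]]; rewrite /nabla_second_ff /perp ?mul0mx //.
case: (lastP us) => [|us' X]; first exact: orth_proj_perp.
by rewrite -cats1 foldl_cat /=; exact: orth_proj_perp.
Qed.

Lemma flag_sub_ker F j z : (normal_flag F j z <= kermx (pos_tangent F z)^T)%MS.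
Proof.
elim: j => [|j IH] /=; first exact: sub0mx.
rewrite addsmx_sub IH /=; apply/sumsmx_subP => t _; rewrite genmxE.
set x := nabla_second_ff F _ z.
rewrite -[orth_proj _ x](subKr x); apply: addmx_sub; last rewrite eqmx_opp.
  by apply/sub_kermxP; exact: nabla_perp.
exact: submx_trans (orth_proj_sub _ _) IH.
Qed.

Lemma flag_mono F i j z : (i <= j)%N -> (normal_flag F i z <= normal_flag F j z)%MS.
Proof.
move=> /subnK <-; elim: (j - i)%N => [|d IH] //; apply: submx_trans IH _.
exact: addsmxSl.
Qed.

(** A higher form is normal to the surface and orthogonal to the flag; once the tangent space and
    the flag fill the ambient space, nothing is left for it. *)
Lemma higher_ff0 F j vs z :
  (forall v, perp (pos_tangent F z) v -> perp (normal_flag F j z) v -> v = 0) ->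
  (j <= size vs - 2)%N -> higher_ff F vs z = 0.
Proof.
move=> full hj; apply: full.
  rewrite /higher_ff; set x := nabla_second_ff F _ z.
  rewrite -[orth_proj _ x](subKr x) /perp mulmxBl (nabla_perp F vs z) sub0r.
  apply/eqP; rewrite oppr_eq0; apply/eqP/sub_kermxP.
  exact: submx_trans (orth_proj_sub _ _) (flag_sub_ker _ _ _).
exact: perp_sub (flag_mono _ _ hj) (orth_proj_perp _ _).
Qed.

End NormalFlag.

Section FundamentalForms.
Context {R : realType} (n : nat).
Variables (D : opn R) (F : plane R -> 'rV[R]_n.+1).
Hypothesis H : conf_minimal D F.
Let oD := @oopen R D.
Local Notation f := (cmK H).
Local Notation S := (sfd D).
Local Notation p := (vd S f).
Variables iF ik : sfun D.
Hypothesis hi : cmF H * iF = 1.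
Local Notation k := (kF S (cmF H) iF).
Hypothesis Hk : k * ik = 1.
Local Notation A := (vA S f (cmF H) iF).
Local Notation B := (vB S f (cmF H) iF ik).
Hypothesis HPhi : bdot A A = 0.
Let Hh := cm_harm hi.

(** dbar A = -k p is tangential, and dA is normal because <p, dA> = -<A, A> = 0, so the projection
    keeps exactly the terms with dA and its conjugate. *)
Lemma nabla3E X1 X2 X3 x : oset D x ->
  nabla_second_ff F [:: X1; X2; X3] x = vRe ((2%:R * tz X1 * tz X2 * tz X3) *: evv x (vd S A)).
Proof.
move=> Dx; rewrite /= /normal_connection.
have -> : 'D_X3 (second_ff F X2 X1) x =
    'D_X3 (fun y => vRe (evv y (sf_cst D (2%:R * tz X2 * tz X1) *: A))) x.
  apply: near_eq_derive; apply: filterS (nearD oD Dx) => y Dy.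
  by rewrite (second_ffE hi _ _ Dy) (evvZ _ _ Dy) (sf_cstE _ Dy).
rewrite (der_Re _ X3 Dx) vdZ vbZ dd_sf_cst db_sf_cst !scale0r !add0r.
rewrite !(evvZ _ _ Dx) !(sf_cstE _ Dx) (vbA Hh) (evvZ _ _ Dx) (sfNE _ Dx) !scalerA.
have -> : tz X3 * (2%:R * tz X2 * tz X1) = 2%:R * tz X1 * tz X2 * tz X3 by ring.
apply: orth_projE.
  apply: (perp_tangent hi) => //; rewrite bdotZl.
  - rewrite -(evv_bdot _ _ Dx) (bdotC _ f).
    have h := d_bdot S f A; rewrite (dot_Af Hh) dd0 (dot_Ap Hh) add0r in h.
    by rewrite -h (sf0E Dx) mulr0.
  - rewrite -(evv_bdot _ _ Dx) (bdotC _ p).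
    have h := d_bdot S p A; rewrite (dot_Ap Hh) dd0 (vdp S f (cmF H) iF) in h.
    rewrite bdotDl bdotZl (dot_Ap Hh) HPhi mulr0 addr0 add0r in h.
    by rewrite -h (sf0E Dx) mulr0.
  - rewrite -(evv_vc _ Dx) -(evv_bdot _ _ Dx) (bdotC _ (vc S p)).
    have h := d_bdot S (vc S p) A; rewrite (dot_Apb Hh) dd0 (vdpb Hh) in h.
    rewrite bdotZl (dot_Af Hh) mulr0 add0r in h.
    by rewrite -h (sf0E Dx) mulr0.
rewrite vReD [X in (X - _)%R]addrC addrK.
exact: (tangent_sub hi).
Qed.

Lemma nabla2E X1 X2 x : oset D x ->
  nabla_second_ff F [:: X1; X2] x = vRe ((2%:R * tz X1 * tz X2) *: evv x A).
Proof.
by move=> Dx; rewrite /= (second_ffE hi _ _ Dx) -mulrA (mulrC (tz X2)) mulrA.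
Qed.

Definition coef j (t : j.-tuple 'I_2) : R[i] := 2%:R * \prod_(i <- t) tz (coord_field R i).

Lemma map_tuple2 (T : Type) (h : 'I_2 -> T) (t : 2.-tuple 'I_2) :
  exists a b, t = [:: a; b] :> seq _ /\ [seq h i | i <- t] = [:: h a; h b].
Proof. by case: t => [[|a [|b []]]] //= _; exists a, b. Qed.

Lemma map_tuple3 (T : Type) (h : 'I_2 -> T) (t : 3.-tuple 'I_2) :
  exists a b c, t = [:: a; b; c] :> seq _ /\ [seq h i | i <- t] = [:: h a; h b; h c].
Proof. by case: t => [[|a [|b [|c []]]]] //= _; exists a, b, c. Qed.

Lemma tz_coord0 : tz (coord_field R 0) = 1.
Proof. by []. Qed.
Lemma tz_coord1 : tz (coord_field R (lift ord0 ord0)) = 'i.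
Proof. by []. Qed.

Lemma higher2E X1 X2 x : oset D x ->
  higher_ff F [:: X1; X2] x = vRe ((2%:R * tz X1 * tz X2) *: evv x A).
Proof. by move=> Dx; rewrite /higher_ff orth_proj0 // nabla2E. Qed.

Lemma normal_space1E x : oset D x -> (normal_space F 1 x :=: span2 (evv x A))%MS.
Proof.
move=> Dx; rewrite /normal_space.
have -> : (\sum_(t : 2.-tuple 'I_2) <<higher_ff F [seq coord_field R i | i <- t] x>> =
  \sum_(t : 2.-tuple 'I_2) <<vRe (coef t *: evv x A)>>)%MS.
  apply: eq_bigr => t _; congr (<<_>>)%MS.
  have [a [b [e ->]]] := map_tuple2 (coord_field R) t.
  by rewrite higher2E // /coef e !big_cons big_nil mulr1 mulrA.
apply: (@sum_span2 _ _ _ (@coef 2) _ [tuple 0; 0] [tuple 0; lift ord0 ord0]);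
  by rewrite /coef !big_cons big_nil ?tz_coord0 ?tz_coord1 !mulr1 ?mul1r.
Qed.

Lemma normal_flag1E x : oset D x -> (normal_flag F 1 x :=: span2 (evv x A))%MS.
Proof.
move=> Dx; apply: eqmx_trans (normal_space1E Dx).
rewrite /normal_space /=.
have -> : (\sum_(t : 2.-tuple 'I_2) <<higher_ff F [seq coord_field R i | i <- t] x>> =
  \sum_(t : 2.-tuple 'I_2) <<orth_proj (GRing.zero : 'M[R]_n.+1)
     (nabla_second_ff F [seq coord_field R i | i <- t] x)>>)%MS.
  by apply: eq_bigr => t _; rewrite /higher_ff size_map size_tuple.
by apply/eqmxP/andP; split; [rewrite addsmx_sub sub0mx submx_refl|exact: addsmxSr].
Qed.

Lemma perp_eqmx j l (P : 'M[R]_(j, n.+1)) (Q : 'M[R]_(l, n.+1)) v :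
  (P :=: Q)%MS -> perp P v -> perp Q v.
Proof. by move=> e; apply: perp_sub; rewrite e. Qed.

Lemma third_orth X1 X2 X3 x : oset D x ->
  orth_proj (normal_flag F 1 x) (nabla_second_ff F [:: X1; X2; X3] x) =
    vRe ((2%:R * tz X1 * tz X2 * tz X3) *: evv x B).
Proof.
move=> Dx; rewrite nabla3E //; move: (2%:R * _ * _ * _) => t.
have fe := normal_flag1E Dx.
apply: orth_projE.
  apply: (perp_eqmx (eqmx_sym fe)); apply: perp_span2; rewrite bdotZl.
    by rewrite -(evv_bdot _ _ Dx) bdotC (dot_BA _ HPhi) (sf0E Dx) mulr0.
  by rewrite -(evv_vc _ Dx) -(evv_bdot _ _ Dx) (dot_BAb Hh Hk) (sf0E Dx) mulr0.
rewrite (vdA S f _ _ ik) (evvD _ _ Dx) (evvZ _ _ Dx) scalerDr vReD addrK scalerA fe.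
exact: span2_sub.
Qed.

Lemma higher3E X1 X2 X3 x : oset D x ->
  higher_ff F [:: X1; X2; X3] x = vRe ((2%:R * tz X1 * tz X2 * tz X3) *: evv x B).
Proof. exact: third_orth. Qed.

Lemma normal_space2E x : oset D x -> (normal_space F 2 x :=: span2 (evv x B))%MS.
Proof.
move=> Dx; rewrite /normal_space.
have -> : (\sum_(t : 3.-tuple 'I_2) <<higher_ff F [seq coord_field R i | i <- t] x>> =
  \sum_(t : 3.-tuple 'I_2) <<vRe (coef t *: evv x B)>>)%MS.
  apply: eq_bigr => t _; congr (<<_>>)%MS.
  have [a [b [c [e ->]]]] := map_tuple3 (coord_field R) t.
  by rewrite higher3E // /coef e !big_cons big_nil mulr1 !mulrA.
apply: (@sum_span2 _ _ _ (@coef 3) _ [tuple 0; 0; 0] [tuple 0; 0; lift ord0 ord0]);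
  by rewrite /coef !big_cons big_nil ?tz_coord0 ?tz_coord1 !mulr1 ?mul1r.
Qed.

Lemma normal_flag2_sub x : oset D x ->
  (span2 (evv x A) <= normal_flag F 2 x)%MS /\ (span2 (evv x B) <= normal_flag F 2 x)%MS.
Proof.
move=> Dx; split; first by rewrite -(normal_flag1E Dx); exact: flag_mono.
rewrite -(normal_space2E Dx); apply: submx_trans (addsmxSr (normal_flag F 1 x) _).
apply/sumsmx_subP => t _; apply: (sumsmx_sup t) => //.
by rewrite /higher_ff size_map size_tuple.
Qed.

(* The second curvature ellipse is nondegenerate where [disc] does not vanish. *)
Definition disc : sfun D := bdot B B * cj S (bdot B B) - bdot B (vc S B) ^+ 2.

Hypothesis Hfull : forall x, oset D x -> disc x != 0 -> forall v, perp (pos_tangent F x) v ->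
  perp (span2 (evv x A)) v -> perp (span2 (evv x B)) v -> v = 0.

Lemma rank_normal_space x j : oset D x -> disc x != 0 -> (1 <= j)%N ->
  \rank (normal_space F j x) = if (j <= 2)%N then 2 else 0.
Proof.
move=> Dx d0; case: j => [|[|[|j]]] // _ /=.
- rewrite (normal_space1E Dx); apply: rank_span2.
  rewrite -(evv_vc _ Dx) -!(evv_bdot _ _ Dx) HPhi (sf0E Dx) mul0r eq_sym expf_eq0 /=.
  rewrite (gauss Hh) (sfME _ _ Dx) mulf_neq0 //.
    have := congr1 (fun u : sfun D => u x) Hk; rewrite (sfME _ _ Dx) (sf1E Dx).
    by move/eqP; apply: contraTneq => ->; rewrite mul0r eq_sym oner_eq0.
  by rewrite (ev_F H Dx) (cm_F_neq0 H Dx).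
- rewrite (normal_space2E Dx); apply: rank_span2.
  rewrite -(evv_vc _ Dx) -!(evv_bdot _ _ Dx) -(sfcjE _ Dx) -(sfME _ _ Dx) -(sfXE _ _ Dx).
  by rewrite -subr_eq0 -(sfNE _ Dx) -(sfDE _ _ Dx).
have e0 (t : j.+4.-tuple 'I_2) : higher_ff F [seq coord_field R i | i <- t] x = 0.
  apply: (@higher_ff0 R n F 2); last by rewrite size_map size_tuple.
  by move=> v h1 h2; apply: (Hfull Dx d0 h1);
    apply: perp_sub h2; have [] := normal_flag2_sub Dx.
rewrite /normal_space; apply/eqP; rewrite mxrank_eq0; apply/eqP.
by apply: big1 => t _; rewrite e0 genmx0.
Qed.

(** Isotropy speaks of regular points, so regularity has to be established first. Here it holds
    because [disc] stays nonzero nearby and fixes all ranks. *)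
Lemma regular_disc z : oset D z -> disc z != 0 -> regular_at F z.
Proof.
move=> Dz d0 j j1.
have hn : \forall y \near z, oset D y /\ disc y != 0.
  by apply: filterI; [exact: nearD|exact: sf_near_neq0].
by apply: filterS hn => y [Dy dy]; rewrite !rank_normal_space.
Qed.

End FundamentalForms.

Section Circle.
Context {R : realType} (m : nat).

(** Subtracting |x - c|^2 = rho^2 and |-x - c|^2 = rho^2 gives <x, c> = 0, so |x| is determined
    without locating the centre. *)
Lemma circle_antipodal (E : set 'rV[R]_m) : is_circle E ->
  exists s, forall x, E x -> E (- x) -> dot x x = s.
Proof.
move=> [c [u [v [rho [_ uu vv uv ->]]]]]; exists (rho ^+ 2 - dot c c).
have h x : (exists2 t, True & c + rho *: (cos t *: u + sin t *: v) = x) ->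
    dot x x - 2 * dot x c + dot c c = rho ^+ 2.
  move=> [t _ <-]; rewrite !(dotDl, dotDr, dotZl, dotZr) (dotC v u) uu vv uv.
  rewrite (dotC u c) (dotC v c); have := cos2Dsin2 t; move: (cos t) (sin t) => a b e.
  transitivity (rho ^+ 2 * (a ^+ 2 + b ^+ 2)); first by ring.
  by rewrite e mulr1.
move=> x [t1 _ h1] [t2 _ h2].
have e1 : dot x x - 2 * dot x c + dot c c = rho ^+ 2 by apply: h; exists t1.
have e2 : dot (- x) (- x) - 2 * dot (- x) c + dot c c = rho ^+ 2 by apply: h; exists t2.
move: e2; rewrite !(dotNl, dotNr); move: e1.
by move: (dot x x) (dot x c) (dot c c) => a b d; lra.
Qed.

Definition expi (t : R) : R[i] := cos t +i* sin t.

Lemma expiD s t : expi (s + t) = expi s * expi t.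
Proof. by rewrite /expi cosD sinD; apply: complex_ext; rewrite /=; ring. Qed.

Lemma expi_norm t : expi t * conjc (expi t) = 1.
Proof.
rewrite /expi; apply: complex_ext; rewrite /=; last by ring.
by rewrite -(cos2Dsin2 t); ring.
Qed.

(* Opposite points of a circle centred anywhere have the same length as all the
   others; this is applied to the parameters 0, pi/2 and pi/4. *)
Lemma cubic_ellipse (V : 'rV[R[i]]_m) (t : R[i]) (E : set 'rV[R]_m) : t != 0 ->
  (forall phi, 0 <= phi < 2 * pi -> E (vRe ((2%:R * (expi phi * t) ^+ 3) *: V))) ->
  is_circle E -> bdot V V = 0.
Proof.
move=> t0 hE /circle_antipodal[s hs].
have p0 : 0 < pi :> R := pi_gt0 R.
pose T := t ^+ 6 * bdot V V; pose N := (t * conjc t) ^+ 3 * bdot V (vconj V).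
(* The cube changes sign with its argument, so -x lies on the ellipse along with x. *)
have opp phi : expi (phi + pi) = - expi phi.
  by rewrite expiD /expi cospi sinpi; apply: complex_ext; rewrite /=; ring.
have d phi : 0 <= phi < pi -> 2 * Re (expi phi ^+ 6 * T + N) = s.
  move=> /andP[h1 h2].
  have E1 : E (vRe ((2%:R * (expi phi * t) ^+ 3) *: V)).
    by apply: hE; rewrite h1 /=; lra.
  have E2 : E (- vRe ((2%:R * (expi phi * t) ^+ 3) *: V)).
    have -> : - vRe ((2%:R * (expi phi * t) ^+ 3) *: V) =
        vRe ((2%:R * (expi (phi + pi) * t) ^+ 3) *: V).
      by rewrite opp -vReN -scaleNr; congr (vRe (_ *: _)); ring.
    by apply: hE; apply/andP; split; lra.
  rewrite -(hs _ E1 E2) dot_Re vconjZ !bdotE.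
  have -> : 2%:R * (expi phi * t) ^+ 3 * (2%:R * (expi phi * t) ^+ 3 * bdot V V) =
     2%:R * (2%:R * (expi phi ^+ 6 * T)) by rewrite /T; ring.
  have -> : 2%:R * (expi phi * t) ^+ 3 * (conjc (2%:R * (expi phi * t) ^+ 3) * bdot V (vconj V)) =
     2%:R * (2%:R * N).
    have -> (x y : R[i]) : conjc (2%:R * (x * y) ^+ 3) = 2%:R * (conjc x * conjc y) ^+ 3.
      by case: x y => [a b] [a' b']; apply: complex_ext; rewrite /=; ring.
    transitivity (2%:R * (2%:R * ((expi phi * conjc (expi phi)) ^+ 3 * N))).
      by rewrite /N; ring.
    by rewrite expi_norm expr1n mul1r.
  move: (expi phi ^+ 6 * T) N => [a b] [a' b'].
  by rewrite /=; field.
have e0 : expi 0 = 1 by rewrite /expi cos0 sin0.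
have e2 : expi (pi / 2) = 'i by rewrite /expi cos_pihalf sin_pihalf.
have e4 : expi (pi / 4) ^+ 2 = 'i.
  by rewrite expr2 -expiD -e2; congr expi; field.
have := d 0; rewrite e0 lexx p0 => /(_ isT).
have := d (pi / 2); rewrite e2 => /(_ _).
have := d (pi / 4).
(* The sixth powers at 0, pi/2 and pi/4 are 1, -1 and -i. Equal lengths give Re T = -Re T = Im T,
   hence T = 0. *)
have -> : expi (pi / 4) ^+ 6 = - 'i.
  transitivity ((expi (pi / 4) ^+ 2) ^+ 3); first by ring.
  by rewrite e4; apply: complex_ext; rewrite /=; ring.
have -> : 'i ^+ 6 = -1 :> R[i] by apply: complex_ext; rewrite /=; ring.
rewrite expr1n => h1 h2 h3.
have {}h1 : 2 * Re (- 'i * T + N) = s by apply: h1; apply/andP; split; lra.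
have {}h2 : 2 * Re (-1 * T + N) = s by apply: h2; apply/andP; split; lra.
have T0 : T = 0.
  clear d; move: h1 h2 h3; clearbody T N; move: T N => [a b] [a' b'] /= h1 h2 h3.
  by apply: complex_ext; rewrite /=; lra.
by move/eqP: T0; rewrite mulf_eq0 expf_eq0 /= (negPf t0) => /eqP.
Qed.

End Circle.

Section Ellipse.
Context {R : realType} (n : nat).
Variables (D : opn R) (F : plane R -> 'rV[R]_n.+1).
Hypothesis H : conf_minimal D F.
Local Notation f := (cmK H).
Local Notation S := (sfd D).
Variables iF ik : sfun D.
Hypothesis hi : cmF H * iF = 1.
Local Notation k := (kF S (cmF H) iF).
Hypothesis Hk : k * ik = 1.
Local Notation A := (vA S f (cmF H) iF).
Local Notation B := (vB S f (cmF H) iF ik).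
Hypothesis HPhi : bdot A A = 0.

Lemma circle_BB z Z : oset D z -> induced_metric F z Z Z = 1 ->
  is_circle (curvature_ellipse F 2 z Z) -> bdot B B z = 0.
Proof.
move=> Dz Z1 hc; rewrite (evv_bdot _ _ Dz).
apply: (@cubic_ellipse R n.+1 _ (tz Z)) hc.
  apply/eqP => t0; move: Z1.
  rewrite /induced_metric (der_F hi Z Dz) t0 mulr0 scale0r.
  have -> : vRe 0 = 0 :> 'rV[R]_n.+1 by apply/rowP => j; rewrite !mxE.
  by rewrite dot0l => /eqP; rewrite eq_sym oner_eq0.
move=> phi hphi; exists phi => //.
rewrite (higher3E hi Hk HPhi _ _ _ Dz); congr (vRe (_ *: _)).
have -> : tz (cos phi *: Z + sin phi *: rotJ Z) = expi phi * tz Z.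
  case: Z {Z1} => a b; apply: complex_ext; rewrite /tz /expi /rotJ /=.
    by change (cos phi * a + sin phi * - b = cos phi * a - sin phi * b); ring.
  by change (cos phi * b + sin phi * a = cos phi * b + sin phi * a).
by ring.
Qed.

End Ellipse.

(** * Pseudoholomorphic curves in a chart *)

Section Pseudoholomorphic.
Context {R : realType}.
Variables (D : opn R) (G : plane R -> 'rV[R]_(6.+1)).
Hypothesis Gs : smooth_on D G.
Hypothesis GJ : forall z, oset D z -> forall v, cayley_im ('D_(rotJ v) G z)
                  = cayley_mul (cayley_im (G z)) (cayley_im ('D_v G z)).

Lemma cross_der z v : oset D z -> dot (G z) ('D_v G z) = 0 /\
  'D_(rotJ v) G z = cross (G z) ('D_v G z).
Proof.
move=> Dz; have := GJ Dz v; rewrite /cayley_im /cayley_mul /=.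
move: ('D_(rotJ v) G z) ('D_v G z) (G z) => a b c [/eqP h ->].
rewrite mul0r sub0r eq_sym oppr_eq0 in h.
by rewrite (eqP h) !scale0r !add0r.
Qed.

Lemma rotJ_ex : rotJ (ex : plane R) = ey.
Proof. by rewrite /rotJ /ex /= oppr0. Qed.
Lemma rotJ_ey : rotJ (ey : plane R) = -1 *: ex.
Proof.
rewrite /rotJ /ex /ey /=; apply: injective_projections.
  by change (-1 = -1 * 1 :> R); rewrite mulr1.
by change (0 = -1 * 0 :> R); rewrite mulr0.
Qed.

Lemma cross_xy z : oset D z -> 'D_ey G z = rcross (G z) ('D_ex G z) /\
  - 'D_ex G z = rcross (G z) ('D_ey G z).
Proof.
move=> Dz; split; first by have [_] := cross_der ex Dz; rewrite rotJ_ex.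
have [_] := cross_der ey Dz; rewrite rotJ_ey derive_scale; last exact: (Gs [::] Dz).
by rewrite scaleN1r.
Qed.

Lemma pseudohol_conf z : oset D z -> induced_metric G z ex ex = induced_metric G z ey ey /\
  induced_metric G z ex ey = 0.
Proof.
move=> Dz; have [h1 h2] := cross_xy Dz; rewrite /induced_metric.
move: ('D_ex G z) ('D_ey G z) (G z) h1 h2 => a b c h1 h2; split.
  rewrite {1}(_ : a = - rcross c b); last by rewrite -h2 opprK.
  rewrite dotNl -[dot _ _]/(bdot (rcross c b) a) rcrossC bdotNl opprK rcross_triple.
  by rewrite -h1.
rewrite {1}(_ : a = - rcross c b); last by rewrite -h2 opprK.
rewrite dotNl -[dot _ _]/(bdot (rcross c b) b) rcross_triple rcross_self.
by rewrite bdot0r oppr0.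
Qed.

End Pseudoholomorphic.

Section Evaluation.
Context {R : realType} (D : opn R).

Lemma evv_rcross z (u v : 'rV[sfun D]_7) : oset D z ->
  evv z (rcross u v) = rcross (evv z u) (evv z v).
Proof.
move=> Dz; apply/rowP => j.
by rewrite !mxE !(sfDE _ _ Dz, sfNE _ Dz, sfME _ _ Dz).
Qed.

Lemma evv_comb0 m (w v0 v1 v2 v3 v4 v5 v6 : 'rV[sfun D]_m) (c0 c1 c2 c3 c4 c5 c6 d1 d2 d3 : sfun D) x :
  oset D x -> w = c0 *: v0 + d1 *: (c2 *: v1 + c1 *: v2) + d2 *: (c4 *: v3 + c3 *: v4) +
    d3 *: (c6 *: v5 + c5 *: v6) ->
  c0 x = 0 -> c1 x = 0 -> c2 x = 0 -> c3 x = 0 -> c4 x = 0 -> c5 x = 0 -> c6 x = 0 ->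
  evv x w = 0.
Proof.
move=> Dx -> h0 h1 h2 h3 h4 h5 h6.
rewrite !(evvD _ _ Dx) !(evvZ _ _ Dx) !(evvD _ _ Dx) !(evvZ _ _ Dx).
by rewrite h0 h1 h2 h3 h4 h5 h6 !scale0r !addr0 !scaler0 !addr0.
Qed.

Lemma map_rcross (a b : 'rV[R]_7) :
  rcross (map_mx (real_complex R) a) (map_mx (real_complex R) b) =
  map_mx (real_complex R) (rcross a b).
Proof. by apply/rowP => j; rewrite !mxE !(rmorphD, rmorphN, rmorphM). Qed.

End Evaluation.

Section G2Surface.
Context {R : realType}.
Variables (D : opn R) (G : plane R -> 'rV[R]_(6.+1)).
Hypothesis H : conf_minimal D G.
Hypothesis GJ : forall z, oset D z -> forall v, cayley_im ('D_(rotJ v) G z)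
                  = cayley_mul (cayley_im (G z)) (cayley_im ('D_v G z)).
Local Notation f := (cmK H).
Local Notation S := (sfd D).
Local Notation p := (vd S f).
Local Notation ii := (sf_cst D 'i).

Lemma ii2 : ii * ii = -1.
Proof.
apply: sfunP => z Dz; rewrite (sfME _ _ Dz) (sfNE _ Dz) (sf1E Dz) (sf_cstE _ Dz).
by apply: complex_ext; rewrite /=; ring.
Qed.
Lemma cjii : cj S ii = - ii.
Proof.
apply: sfunP => z Dz; rewrite cj_sf_cst (sfNE _ Dz) !(sf_cstE _ Dz).
by apply: complex_ext; rewrite /=; ring.
Qed.
Lemma dii : dd S ii = 0. Proof. exact: dd_sf_cst. Qed.

Lemma rcross_fp : rcross f p = ii *: p.
Proof.
apply: evvP => z Dz; rewrite (evv_rcross _ _ Dz) (evvZ _ _ Dz) (sf_cstE _ Dz).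
rewrite (evv_f H Dz) (evv_p H Dz) (rP_der (cm_diff H Dz)) /cvec.
have [h1 h2] := cross_xy (cm_smooth H) GJ Dz.
move: ('D_ex G z) ('D_ey G z) (G z) h1 h2 => a b c h1 h2.
rewrite rcrossZr rcrossDr -scaleNr rcrossZr !map_rcross -h1 -h2.
apply/rowP => j; rewrite !mxE; move: (a 0 j) (b 0 j) => x y.
by apply: complex_ext; rewrite /=; ring.
Qed.

Variables iF ik : sfun D.
Hypothesis hi : cmF H * iF = 1.
Local Notation k := (kF S (cmF H) iF).
Hypothesis Hk : k * ik = 1.
Local Notation A := (vA S f (cmF H) iF).
Local Notation B := (vB S f (cmF H) iF ik).
Local Notation q := (qF S (cmF H) iF ik).
Local Notation nn := (vN S f (cmF H) iF).
Let Hh := cm_harm hi.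

Lemma g2_Phi : bdot A A = 0.
Proof. exact: (pseudohol_Phi ii2 dii _ _ rcross_fp). Qed.

Lemma real_orth m (w : 'rV[R]_m) (V : 'rV[R[i]]_m) :
  (forall t, dot w (vRe (t *: V)) = 0) -> bdot (map_mx (real_complex R) w) V = 0.
Proof.
move=> h.
have e t : dot w (vRe (t *: V)) = Re (t * bdot (map_mx (real_complex R) w) V).
  rewrite -bdotZr /bdot (big_morph _ (@ReD R) erefl) /dot; apply: eq_bigr => i _.
  by rewrite !mxE; case: t (V 0 i) => [a b] [a' b']; rewrite /=; ring.
have := h (- 'i); have := h 1; rewrite !e mul1r.
move: (bdot _ _) => [a b] /= -> h2; apply: complex_ext => //=; lra.
Qed.

Lemma conj_orth m (w : 'rV[R]_m) (V : 'rV[R[i]]_m) :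
  bdot (map_mx (real_complex R) w) V = 0 -> bdot (map_mx (real_complex R) w) (vconj V) = 0.
Proof.
move=> h; have -> : map_mx (real_complex R) w = vconj (map_mx (real_complex R) w).
  by apply/rowP => j; rewrite !mxE; apply: complex_ext => //=; rewrite oppr0.
have -> (u v : 'rV[R[i]]_m) : bdot (vconj u) (vconj v) = conjc (bdot u v).
  by rewrite /bdot rmorph_sum; apply: eq_bigr => i _; rewrite !mxE rmorphM.
by rewrite h conjc0.
Qed.

(** [frame_disc] turns orthogonality to B and its conjugate into orthogonality to n; then every
    coefficient in [frame_expand] vanishes at x. *)
Lemma g2_full x : oset D x -> disc H iF ik x != 0 -> forall v, perp (pos_tangent G x) v ->
  perp (span2 (evv x A)) v -> perp (span2 (evv x B)) v -> v = 0.
Proof.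
move=> Dx d0 v /perpP hT /perpP hA /perpP hB.
(* The vector is made a constant field, so that the identities of the ring apply and can be
   evaluated at x. *)
pose w : 'rV[sfun D]_7 := \row_j sf_cst D (v 0 j)%:C.
have ew : evv x w = map_mx (real_complex R) v.
  by apply/rowP => j; rewrite !mxE (sf_cstE _ Dx).
have wf : bdot w f x = 0.
  rewrite (evv_bdot _ _ Dx) ew (evv_f H Dx) bdot_real -(scale1r (G x)).
  by rewrite (hT _ (position_sub G 1 x)).
have o V : bdot (evv x w) (evv x V) = 0 -> bdot w V x = 0 /\ bdot w (vc S V) x = 0.
  move=> h; split; first by rewrite (evv_bdot _ _ Dx).
  by rewrite (evv_bdot _ _ Dx) (evv_vc _ Dx) ew conj_orth // -ew.
have [wp wpb] : bdot w p x = 0 /\ bdot w (vc S p) x = 0.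
  by apply: o; rewrite ew; apply: real_orth => t; apply: hT; exact: (tangent_sub hi).
have [wA wAb] : bdot w A x = 0 /\ bdot w (vc S A) x = 0.
  by apply: o; rewrite ew; apply: real_orth => t; apply: hA; exact: span2_sub.
have [wB wBb] : bdot w B x = 0 /\ bdot w (vc S B) x = 0.
  by apply: o; rewrite ew; apply: real_orth => t; apply: hB; exact: span2_sub.
have [wn wnb] : bdot w nn x = 0 /\ bdot w (vc S nn) x = 0.
  apply: o; rewrite -(evv_bdot _ _ Dx).
  have h : bdot w nn ^+ 2 * disc H iF ik =
      - (cj S (bdot B (vc S nn)) * bdot w B - bdot B nn * bdot w (vc S B)) ^+ 2.
    exact: (frame_disc ii2 dii cjii Hh Hk rcross_fp w).
  move: (disc H iF ik) d0 h => dsc d0 h.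
  have := congr1 (fun u : sfun D => u x) h.
  rewrite (sfME _ _ Dx) (sfXE _ _ Dx) (sfNE _ Dx) (sfXE _ _ Dx) (sfDE _ _ Dx) (sfNE _ Dx).
  rewrite (sfME _ (bdot w B) Dx) (sfME _ (bdot w (vc S B)) Dx) wB wBb.
  rewrite !mulr0 subrr expr0n oppr0 => /eqP.
  by rewrite mulf_eq0 expf_eq0 (negPf d0) orbF => /eqP.
have e := evv_comb0 Dx (frame_expand ii2 dii cjii Hh Hk rcross_fp w)
  wf wp wpb wA wAb wn wnb; rewrite ew in e.
apply/rowP => j; have := congr1 (fun V : 'rV[R[i]]_7 => Re (V 0 j)) e.
by rewrite !mxE.
Qed.

Hypothesis Hcircle : forall z Z, oset D z -> regular_at G z -> induced_metric G z Z Z = 1 ->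
  is_circle (curvature_ellipse G 2 z Z).

(* Where the second curvature ellipse is degenerate, [g2_identity] gives q = F;
   elsewhere the point is regular and the ellipse is a circle. *)
Lemma g2_dichotomy z : oset D z ->
  (q z = cmF H z /\ (bdot B B * cj S (bdot B B)) z = ((q * (k * cmF H)) ^+ 2) z) \/
  ((q + q) z = cmF H z /\ bdot B B z = 0).
Proof.
move=> Dz; have id0 := g2_identity ii2 dii cjii Hh Hk rcross_fp.
have F0 : cmF H z != 0 by rewrite (ev_F H Dz) (cm_F_neq0 H Dz).
have k0 : k z != 0.
  have := congr1 (fun u : sfun D => u z) Hk; rewrite (sfME _ _ Dz) (sf1E Dz).
  by move/eqP; apply: contraTneq => ->; rewrite mul0r eq_sym oner_eq0.
have two0 : 2%:R != 0 :> R[i] by rewrite pnatr_eq0.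
have two (u : sfun D) : (2%:R * u) z = 2%:R * u z.
  by rewrite !mulr_natl !mulr2n (sfDE _ _ Dz).
have {}id0 : 2%:R * (q z * (k z * cmF H z)) * (cmF H z * (k z * cmF H z)) =
    (cmF H z * (k z * cmF H z)) ^+ 2 + (bdot B B * cj S (bdot B B)) z.
  have := congr1 (fun u : sfun D => u z) id0.
  rewrite -mulrA two [in X in _ = X -> _](sfDE _ _ Dz) (sfXE _ _ Dz).
  by rewrite !(sfME _ _ Dz) mulrA.
have [d0|d0] := eqVneq (disc H iF ik z) 0; [left|right].
  have e : (bdot B B * cj S (bdot B B)) z = ((q * (k * cmF H)) ^+ 2) z.
    apply/eqP; rewrite -subr_eq0; apply/eqP; move: d0; rewrite /disc.
    by rewrite (dot_BBb Hh Hk) (sfDE _ _ Dz) (sfNE _ Dz).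
  split => //; move: id0; rewrite e (sfXE _ _ Dz) !(sfME _ _ Dz).
  move: (q z) (k z) (cmF H z) k0 F0 => a b c b0 c0 h.
  (* With |<B, B>| = |B|^2 the identity becomes a perfect square, (k F)^2 (q - F)^2 = 0. *)
  have : (b * c) ^+ 2 * (a - c) ^+ 2 = 0.
    transitivity ((c * (b * c)) ^+ 2 + (a * (b * c)) ^+ 2 - 2%:R * (a * (b * c)) * (c * (b * c))).
      by ring.
    by rewrite h subrr.
  by move/eqP; rewrite mulf_eq0 !expf_eq0 /= mulf_eq0 (negPf b0) (negPf c0) subr_eq0 => /eqP.
have rz := regular_disc hi Hk g2_Phi g2_full Dz d0.
have [Z hZ] : exists Z, induced_metric G z Z Z = 1.
  have l0 := cm_pos H Dz; pose s := (Num.sqrt (induced_metric G z ex ex))^-1.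
  exists (s *: ex); rewrite /induced_metric (derive_scale _ _ (cm_diff H Dz)).
  rewrite dotZl dotZr mulrA -expr2 /s exprVn sqr_sqrtr ?ltW //.
  by rewrite mulVf // gt_eqF.
have B0 := circle_BB hi Hk g2_Phi Dz hZ (Hcircle Dz rz hZ); split => //.
move: id0; rewrite (sfME _ _ Dz) B0 mul0r addr0 (sfDE q q Dz).
move: (q z) (k z) (cmF H z) k0 F0 => a b c b0 c0 h.
have : (b * c) * (c * (b * c)) * (a + a - c) = 0.
  transitivity (2%:R * (a * (b * c)) * (c * (b * c)) - (c * (b * c)) ^+ 2); first by ring.
  by rewrite h subrr.
move/eqP; rewrite !mulf_eq0 (negPf b0) (negPf c0) /= subr_eq0 => /eqP //.
Qed.

End G2Surface.

(** * Invariants of a surface *)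

Section RawInvariants.
Context {R : realType} (n : nat).
Implicit Types F : plane R -> 'rV[R]_n.+1.

(** This is k/F. Here and in [rtheta], [rtheta2] the powers 2, 4, 6 of 1/F match the weights of
    |A|^2, |<A, A>|^2 and, where <A, A> = 0, |<dA, dA>|^2. *)
Definition rkappa F z : R[i] := bdot (rA F z) (vconj (rA F z)) * (rF F z)^-1 ^+ 2.
Definition rtheta F z : R[i] :=
  bdot (rA F z) (rA F z) * conjc (bdot (rA F z) (rA F z)) * (rF F z)^-1 ^+ 4.
Definition rtheta2 F z : R[i] :=
  bdot (rdz (rA F) z) (rdz (rA F) z) * conjc (bdot (rdz (rA F) z) (rdz (rA F) z)) *
  (rF F z)^-1 ^+ 6.

Section Transition.
Variables (D D' : opn R) (F F' : plane R -> 'rV[R]_n.+1).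
Hypotheses (H : conf_minimal D F) (H' : conf_minimal D' F').
Variables (E : set (plane R)) (T : plane R -> plane R).
Hypotheses (oE : open E) (ED : E `<=` D) (ET : forall z, E z -> oset D' (T z)).
Hypothesis dT : forall z, E z -> differentiable T z.
Hypothesis CR : forall z, E z -> forall v, 'D_(rotJ v) T z = rotJ ('D_v T z).
Hypothesis FT : forall z, E z -> F z = F' (T z).
Local Notation s := (cdT T).

Lemma trans_rkappa z : E z -> rkappa F z = rkappa F' (T z).
Proof.
move=> Ez; have s0 := trans_s_neq0 H H' oE ED ET dT CR FT Ez.
have F0 := cm_F_neq0 H' (ET Ez).
rewrite /rkappa (trans_A H H' oE ED ET dT CR FT Ez) (trans_F H' oE ET dT CR FT Ez).
move: (rA F' (T z)) => V; rewrite vconjZ !bdotE; move: (bdot _ _) (rF F' (T z)) (s z) s0 F0 => a b t t0 b0.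
have tc0 : conjc t != 0 by rewrite conjc_eq0.
have -> : conjc (t * t) = conjc t * conjc t by rewrite rmorphM.
by field; rewrite t0 b0 tc0.
Qed.

Lemma trans_rtheta z : E z -> rtheta F z = rtheta F' (T z).
Proof.
move=> Ez; have s0 := trans_s_neq0 H H' oE ED ET dT CR FT Ez.
have F0 := cm_F_neq0 H' (ET Ez).
rewrite /rtheta (trans_A H H' oE ED ET dT CR FT Ez) (trans_F H' oE ET dT CR FT Ez).
move: (rA F' (T z)) => V; rewrite !bdotE.
move: (bdot _ _) (rF F' (T z)) (s z) s0 F0 => a b t t0 b0.
have tc0 : conjc t != 0 by rewrite conjc_eq0.
have -> : conjc (t * t * (t * t * a)) = conjc t * conjc t * (conjc t * conjc t * conjc a).
  by rewrite !rmorphM.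
by field; rewrite t0 b0 tc0.
Qed.

(** A change of coordinate adds a multiple of A to dA; it drops out of <dA, dA> because <A, A> = <A,
    dA> = 0. *)
Lemma theta2_weight (V W W' : 'rV[R[i]]_n.+1) (a b t r : R[i]) :
  V = r *: W' + t ^+ 3 *: W -> a = t * conjc t * b -> bdot W' W' = 0 -> bdot W' W = 0 ->
  t != 0 -> b != 0 ->
  bdot V V * conjc (bdot V V) * a^-1 ^+ 6 = bdot W W * conjc (bdot W W) * b^-1 ^+ 6.
Proof.
move=> -> -> h1 h2 t0 b0; rewrite !bdotE (bdotC W W') h1 h2 !mulr0 !add0r.
move: (bdot _ _) => x; have tc0 : conjc t != 0 by rewrite conjc_eq0.
have -> : conjc (t ^+ 3 * (t ^+ 3 * x)) = (conjc t) ^+ 3 * ((conjc t) ^+ 3 * conjc x).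
  by rewrite !exprS !expr0 !rmorphM !rmorph1.
by field; rewrite t0 b0 tc0.
Qed.

Lemma trans_rtheta2 z : E z -> bdot (rA F' (T z)) (rA F' (T z)) = 0 ->
  bdot (rA F' (T z)) (rdz (rA F') (T z)) = 0 -> rtheta2 F z = rtheta2 F' (T z).
Proof.
move=> Ez h1 h2; have s0 := trans_s_neq0 H H' oE ED ET dT CR FT Ez.
have F0 := cm_F_neq0 H' (ET Ez).
exact: (theta2_weight (trans_dA H H' oE ED ET dT CR FT Ez)
  (trans_F H' oE ET dT CR FT Ez) h1 h2 s0 F0).
Qed.

End Transition.
End RawInvariants.

Section GlobalFunctions.
Context {R : realType} {M : topologicalType} (X : riemann_surface R M).

Definition chD (c : chart R M) : opn R := Opn (@chart_cod_open _ _ c).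

Definition conf_surface n (f : M -> 'rV[R]_n.+1) :=
  forall c, atlas X c -> conf_minimal (chD c) (in_chart f c).

Lemma minimal_conf n (f : M -> 'rV[R]_n.+1) : minimal_surface X f ->
  (forall c z, atlas X c -> chart_cod c z ->
    induced_metric (in_chart f c) z ex ex = induced_metric (in_chart f c) z ey ey /\
    induced_metric (in_chart f c) z ex ey = 0) -> conf_surface f.
Proof.
move=> [[fn fs] fi fm] fc c ac; split.
- exact: fs.
- by move=> z _; exact: fn.
- by move=> z cz; have [] := fc c z ac cz.
- by move=> z cz; have [] := fc c z ac cz.
- move=> z cz; rewrite /induced_metric lt_def dot_ge0 andbT.
  apply/eqP => /dot_eq0 h; have := fi c z ac cz ex.
  rewrite h eqxx => /(_ _)/negP; apply => //.
  by apply/eqP => -[] /eqP; rewrite oner_eq0.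
- by move=> z cz; exact: fm.
Qed.

Section Charts.
Variables (c d : chart R M).
Hypotheses (ac : atlas X c) (ad : atlas X d).

Definition overlap : set (plane R) := chart_cod c `&` chart_inv c @^-1` chart_dom d.
Definition transit : plane R -> plane R := chart_map d \o chart_inv c.

Lemma overlap_open : open overlap.
Proof.
rewrite openE => z [cz dz]; rewrite /interior; apply: filterI; first exact: near_cod.
by apply: near_chart_inv => //; exact: near_dom.
Qed.
Lemma overlap_sub : overlap `<=` chart_cod c.
Proof. by move=> z []. Qed.
Lemma transit_cod z : overlap z -> chart_cod d (transit z).
Proof. by move=> [_ h]; exact: chart_map_cod. Qed.
Lemma transit_diff z : overlap z -> differentiable transit z.
Proof. by move=> h; have [] := atlas_holomorphic ac ad h. Qed.
Lemma transit_CR z : overlap z -> forall v, 'D_(rotJ v) transit z = rotJ ('D_v transit z).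
Proof. by move=> h; have [] := atlas_holomorphic ac ad h. Qed.
Lemma transit_chart n (f : M -> 'rV[R]_n.+1) z : overlap z ->
  in_chart f c z = in_chart f d (transit z).
Proof. by move=> [_ h]; rewrite /in_chart /transit /= chart_mapK. Qed.

End Charts.

Definition chart_at p : chart R M := s2val (cid2 (atlas_cover X p)).
Lemma chart_at_atlas p : atlas X (chart_at p).
Proof. by rewrite /chart_at; case: (cid2 _). Qed.
Lemma chart_at_dom p : chart_dom (chart_at p) p.
Proof. by rewrite /chart_at; case: (cid2 _). Qed.

Section Glue.
Variables (n : nat) (f : M -> 'rV[R]_n.+1).
Variable phi : (plane R -> 'rV[R]_n.+1) -> plane R -> R[i].
Hypothesis phi_trans : forall c d, atlas X c -> atlas X d -> forall z, overlap c d z ->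
  phi (in_chart f c) z = phi (in_chart f d) (transit c d z).
Hypothesis phi_smooth : forall c, atlas X c -> exists u : sfun (chD c),
  cj (sfd (chD c)) u = u /\ forall z, chart_cod c z -> u z = phi (in_chart f c) z.

(** The chart at p is an arbitrary choice; [phi_trans] makes the value independent of it. *)
Definition glob p : R := Re (phi (in_chart f (chart_at p)) (chart_map (chart_at p) p)).

Lemma globE c z : atlas X c -> chart_cod c z ->
  phi (in_chart f c) z = (glob (chart_inv c z))%:C.
Proof.
move=> ac cz; rewrite /glob; set p := chart_inv c z.
have h : overlap c (chart_at p) z by split => //; exact: chart_at_dom.
rewrite -[chart_map _ p]/(transit c (chart_at p) z).
rewrite -(phi_trans ac (chart_at_atlas p) h).
have [u [hu uE]] := phi_smooth ac.
have := congr1 (fun v : sfun (chD c) => v z) hu; rewrite (sfcjE (D := chD c) _ cz) (uE _ cz).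
by case: (phi _ _) => a b [] hb; apply: complex_ext => //=; lra.
Qed.

Lemma glob_cont : continuous glob.
Proof.
move=> p; have [c ac cp] := atlas_cover X p; have cz := chart_map_cod cp.
have [u [_ uE]] := phi_smooth ac.
have h : {for chart_map c p, continuous (refun u)}.
  by apply: differentiable_continuous; exact: (@sf_diff _ (chD c) u _ cz).1.
have e : \forall q \near p, refun u (chart_map c q) = glob q.
  apply: filterS (near_dom cp) => q cq; have cq' := chart_map_cod cq.
  by rewrite /refun (uE _ cq') (globE ac cq') /= chart_mapK.
have e0 : refun u (chart_map c p) = glob p by exact: (nbhs_singleton e).
rewrite /continuous_at -e0; apply: cvg_trans.
  exact: (near_eq_cvg e).
exact: (continuous_comp (chart_map_at cp) h).
Qed.

End Glue.
End GlobalFunctions.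

Section LocalValues.
Context {R : realType} (n : nat).
Variables (D : opn R) (F : plane R -> 'rV[R]_n.+1).
Hypothesis H : conf_minimal D F.
Local Notation f := (cmK H).
Local Notation S := (sfd D).
Variable iF : sfun D.
Hypothesis hi : cmF H * iF = 1.
Local Notation k := (kF S (cmF H) iF).
Local Notation A := (vA S f (cmF H) iF).
Let Hh := cm_harm hi.

Lemma ev_kappa z : oset D z -> (k * iF) z = rkappa F z.
Proof.
move=> Dz; have -> : k * iF = bdot A (vc S A) * iF ^+ 2.
  rewrite (gauss Hh); transitivity (k * iF * (cmF H * iF)); first by rewrite hi mulr1.
  by ring.
rewrite (sfME _ _ Dz) (sfXE _ _ Dz) (evv_bdot _ _ Dz) (evv_vc _ Dz).
by rewrite (evv_A hi Dz) (ev_iF hi Dz).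
Qed.

Definition thetaK : sfun D := bdot A A * cj S (bdot A A) * iF ^+ 4.
Lemma ev_theta z : oset D z -> thetaK z = rtheta F z.
Proof.
move=> Dz; rewrite /thetaK (sfME _ (iF ^+ 4) Dz) (sfXE _ _ Dz) (sfME _ _ Dz) (sfcjE _ Dz) (evv_bdot _ _ Dz).
by rewrite (evv_A hi Dz) (ev_iF hi Dz).
Qed.

Definition theta2K : sfun D := bdot (vd S A) (vd S A) * cj S (bdot (vd S A) (vd S A)) * iF ^+ 6.
Lemma ev_theta2 z : oset D z -> theta2K z = rtheta2 F z.
Proof.
move=> Dz; rewrite /theta2K (sfME _ (iF ^+ 6) Dz) (sfXE _ _ Dz) (sfME _ _ Dz) (sfcjE _ Dz) (evv_bdot _ _ Dz).
by rewrite (evv_dA hi Dz) (ev_iF hi Dz).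
Qed.

Lemma cj_kappaK : cj S (k * iF) = k * iF.
Proof. by rewrite cjM (cjk Hh) (cjiF Hh). Qed.
Lemma cj_square (u v : sfun D) j : cj S v = v -> cj S (u * cj S u * v ^+ j) = u * cj S u * v ^+ j.
Proof.
move=> hv; rewrite !cjM cjK (mulrC (cj S u)); congr (_ * _).
by elim: j => [|j IH]; rewrite ?expr0 ?cj1 // !exprS cjM IH hv.
Qed.
Lemma cj_thetaK : cj S thetaK = thetaK.
Proof. exact: (cj_square _ _ (cjiF Hh)). Qed.
Lemma cj_theta2K : cj S theta2K = theta2K.
Proof. exact: (cj_square _ _ (cjiF Hh)). Qed.

End LocalValues.

Lemma conf_minimal_sub {R : realType} n (D D' : opn R) (F : plane R -> 'rV[R]_n.+1) :
  oset D' `<=` oset D -> conf_minimal D F -> conf_minimal D' F.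
Proof.
move=> h [h1 h2 h3 h4 h5 h6]; split.
- exact: smooth_sub h1.
- by move=> z /h; exact: h2.
- by move=> z /h; exact: h3.
- by move=> z /h; exact: h4.
- by move=> z /h; exact: h5.
- by move=> z /h; exact: h6.
Qed.

Section Invariants.
Context {R : realType} {M : topologicalType} (X : riemann_surface R M).

Section OneSurface.
Variables (n : nat) (f : M -> 'rV[R]_n.+1).
Hypothesis hf : conf_surface X f.

Definition kappa : M -> R := glob X f (@rkappa R n).
Definition theta : M -> R := glob X f (@rtheta R n).
Definition theta2 : M -> R := glob X f (@rtheta2 R n).

Lemma trans_kappa c d : atlas X c -> atlas X d -> forall z, overlap c d z ->
  rkappa (in_chart f c) z = rkappa (in_chart f d) (transit c d z).
Proof.
move=> ac ad z h; apply: (trans_rkappa (hf ac) (hf ad) (@overlap_open _ _ c d)) h.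
- exact: overlap_sub.
- exact: transit_cod.
- exact: (transit_diff ac ad).
- exact: (transit_CR ac ad).
- exact: transit_chart.
Qed.

Lemma trans_theta c d : atlas X c -> atlas X d -> forall z, overlap c d z ->
  rtheta (in_chart f c) z = rtheta (in_chart f d) (transit c d z).
Proof.
move=> ac ad z h; apply: (trans_rtheta (hf ac) (hf ad) (@overlap_open _ _ c d)) h.
- exact: overlap_sub.
- exact: transit_cod.
- exact: (transit_diff ac ad).
- exact: (transit_CR ac ad).
- exact: transit_chart.
Qed.

Lemma smooth_kappa c : atlas X c -> exists u : sfun (chD c),
  cj (sfd (chD c)) u = u /\ forall z, chart_cod c z -> u z = rkappa (in_chart f c) z.
Proof.
move=> ac; have [iF hi _] := cmF_inv (hf ac).
exists (kF (sfd (chD c)) (cmF (hf ac)) iF * iF); split; first exact: cj_kappaK.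
by move=> z cz; apply: ev_kappa.
Qed.

Lemma smooth_theta c : atlas X c -> exists u : sfun (chD c),
  cj (sfd (chD c)) u = u /\ forall z, chart_cod c z -> u z = rtheta (in_chart f c) z.
Proof.
move=> ac; have [iF hi _] := cmF_inv (hf ac).
by exists (thetaK (hf ac) iF); split; [exact: cj_thetaK|move=> z cz; apply: ev_theta].
Qed.

Lemma smooth_theta2 c : atlas X c -> exists u : sfun (chD c),
  cj (sfd (chD c)) u = u /\ forall z, chart_cod c z -> u z = rtheta2 (in_chart f c) z.
Proof.
move=> ac; have [iF hi _] := cmF_inv (hf ac).
by exists (theta2K (hf ac) iF); split; [exact: cj_theta2K|move=> z cz; apply: ev_theta2].
Qed.

Lemma kappaE c z : atlas X c -> chart_cod c z ->
  rkappa (in_chart f c) z = (kappa (chart_inv c z))%:C.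
Proof. exact: (globE trans_kappa smooth_kappa). Qed.
Lemma kappa_cont : continuous kappa.
Proof. exact: (glob_cont trans_kappa smooth_kappa). Qed.
Lemma thetaE c z : atlas X c -> chart_cod c z ->
  rtheta (in_chart f c) z = (theta (chart_inv c z))%:C.
Proof. exact: (globE trans_theta smooth_theta). Qed.
Lemma theta_cont : continuous theta.
Proof. exact: (glob_cont trans_theta smooth_theta). Qed.

Section NullPhi.
Hypothesis Phi0 : forall c z, atlas X c -> chart_cod c z ->
  bdot (rA (in_chart f c) z) (rA (in_chart f c) z) = 0.

Lemma trans_theta2 c d : atlas X c -> atlas X d -> forall z, overlap c d z ->
  rtheta2 (in_chart f c) z = rtheta2 (in_chart f d) (transit c d z).
Proof.
move=> ac ad z h; have hT := transit_cod h.
apply: (trans_rtheta2 (hf ac) (hf ad) (@overlap_open _ _ c d)) h _ _.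
- exact: overlap_sub.
- exact: transit_cod.
- exact: (transit_diff ac ad).
- exact: (transit_CR ac ad).
- exact: transit_chart.
- exact: Phi0.
have [iF hi _] := cmF_inv (hf ad).
rewrite -(evv_A hi hT) -(evv_dA hi hT) -(evv_bdot (D := chD d) _ _ hT).
rewrite dot_AdA ?(sf0E (D := chD d) hT) //.
apply: sfunP => y Dy; rewrite (evv_bdot _ _ Dy) (evv_A hi Dy) (sf0E Dy).
exact: Phi0.
Qed.

Lemma theta2E c z : atlas X c -> chart_cod c z ->
  rtheta2 (in_chart f c) z = (theta2 (chart_inv c z))%:C.
Proof. exact: (globE trans_theta2 smooth_theta2). Qed.
Lemma theta2_cont : continuous theta2.
Proof. exact: (glob_cont trans_theta2 smooth_theta2). Qed.

End NullPhi.

Lemma kappa_ge0 p : 0 <= kappa p.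
Proof.
have [c ac cp] := atlas_cover X p; have cz := chart_map_cod cp.
have := kappaE ac cz; rewrite chart_mapK // /rkappa (cm_F (hf ac) cz).
have -> (V : 'rV[R[i]]_n.+1) : bdot V (vconj V) = (\sum_i (Re (V 0 i) ^+ 2 + Im (V 0 i) ^+ 2))%:C.
  rewrite rmorph_sum; apply: eq_bigr => i _; rewrite mxE.
  by case: (V 0 i) => a b; apply: complex_ext; rewrite /=; ring.
rewrite -fmorphV -rmorphXn -rmorphM => -[<-].
by rewrite mulr_ge0 ?exprn_even_ge0 // sumr_ge0 // => i _; rewrite addr_ge0 ?sqr_ge0.
Qed.

End OneSurface.

Lemma kappa_isometric n m (f : M -> 'rV[R]_n.+1) (g : M -> 'rV[R]_m.+1) :
  conf_surface X f -> conf_surface X g -> isometric X f g -> kappa f = kappa g.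
Proof.
move=> hf hg fg; apply/funext => p.
have [c ac cp] := atlas_cover X p; have cz := chart_map_cod cp.
have eF : cmF (hf c ac) = cmF (hg c ac).
  apply: sfunP => z Dz; rewrite !ev_F // (cm_F (hf c ac) Dz) (cm_F (hg c ac) Dz).
  by rewrite (fg c z ac Dz).
have [iF hi _] := cmF_inv (hf c ac).
have hi' : cmF (hg c ac) * iF = 1 by rewrite -eF.
have := kappaE hf ac cz; have := kappaE hg ac cz; rewrite chart_mapK //.
rewrite -(ev_kappa hi (D := chD c) cz) -(ev_kappa hi' (D := chD c) cz) eF => -> [].
by [].
Qed.

End Invariants.

Section Positivity.
Context {R : realType} (n : nat).
Variables (D : opn R) (F : plane R -> 'rV[R]_n.+1).
Hypothesis H : conf_minimal D F.
Local Notation f := (cmK H).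
Local Notation S := (sfd D).
Variables iF ik : sfun D.
Hypothesis hi : cmF H * iF = 1.
Local Notation k := (kF S (cmF H) iF).
Hypothesis Hk : k * ik = 1.
Local Notation A := (vA S f (cmF H) iF).
Local Notation B := (vB S f (cmF H) iF ik).
Local Notation q := (qF S (cmF H) iF ik).
Let Hh := cm_harm hi.

Lemma bdot_conj_real m (V : 'rV[R[i]]_m) :
  exists2 r : R, 0 <= r & bdot V (vconj V) = r%:C.
Proof.
exists (\sum_i (Re (V 0 i) ^+ 2 + Im (V 0 i) ^+ 2)).
  by apply: sumr_ge0 => i _; rewrite addr_ge0 ?sqr_ge0.
rewrite rmorph_sum; apply: eq_bigr => i _; rewrite mxE.
by case: (V 0 i) => a b; apply: complex_ext; rewrite /=; ring.
Qed.

Lemma h2_pos x : oset D x -> exists2 r : R, 0 < r & (k * cmF H) x = r%:C.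
Proof.
move=> Dx; have := bdot_conj_real (evv x A).
rewrite -(evv_vc _ Dx) -(evv_bdot _ _ Dx) (gauss Hh) => -[r r0 e]; exists r => //.
rewrite lt_def r0 andbT; apply/eqP => r00; move: e; rewrite r00 (sfME _ _ Dx) => /eqP.
rewrite mulf_eq0 (ev_F H Dx) (negPf (cm_F_neq0 H Dx)) orbF => /eqP k0.
have := congr1 (fun u : sfun D => u x) Hk; rewrite (sfME _ _ Dx) (sf1E Dx) k0 mul0r.
by move/eqP; rewrite eq_sym oner_eq0.
Qed.

(** From |B|^2 = q |A|^2 and |A|^2 > 0. *)
Lemma q_ge0 x : oset D x -> 0 <= Re (q x).
Proof.
move=> Dx; have := bdot_conj_real (evv x B).
rewrite -(evv_vc _ Dx) -(evv_bdot _ _ Dx) (dot_BBb Hh Hk) => -[r r0].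
have [h h0 e] := h2_pos Dx; rewrite (sfME _ _ Dx) e.
case: (q x) => a b; rewrite /= => /(congr1 (fun t : R[i] => Re t)) /=.
by rewrite mulr0 subr0 => er; rewrite -(@pmulr_lge0 _ h) // er.
Qed.

Lemma F_gt0 x : oset D x -> 0 < Re (cmF H x).
Proof.
move=> Dx; rewrite (ev_F H Dx) (cm_F H Dx) /=.
by rewrite mulr_gt0 ?invr_gt0 // (cm_pos H).
Qed.

End Positivity.

Lemma ev_laplacian {R : realType} (D : opn R) (a b d : sfun D) x : oset D x ->
  (a - b *+ 3 + d *+ 2) x = a x - (b x + b x + b x) + (d x + d x).
Proof.
move=> Dx; rewrite !mulrS !mulr0n !addr0 !(sfDE _ _ Dx) (sfNE _ Dx) !(sfDE _ _ Dx).
by rewrite !addrA.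
Qed.

(** * Density and connectedness of the set of non-umbilic points *)

Section Connectivity.
Context {R : realType} {M : topologicalType} (X : riemann_surface R M).
Variables (n : nat) (f : M -> 'rV[R]_n.+1).
Hypothesis hf : conf_surface X f.
Local Notation kap := (kappa X f).

Section Domain.
Variables (W : set M).
Hypotheses (oW : open W) (W0 : forall p, W p -> kap p != 0).
Variable c : chart R M.
Hypothesis ac : atlas X c.

Lemma wD_open : open (chart_cod c `&` chart_inv c @^-1` W).
Proof.
rewrite openE => z [cz kz]; rewrite /interior; apply: filterI; first exact: near_cod.
by apply: near_chart_inv => //; apply: open_nbhs_nbhs.
Qed.
Definition wD : opn R := Opn wD_open.

Lemma wD_cod : oset wD `<=` oset (chD c).
Proof. by move=> z []. Qed.
Definition wH : conf_minimal wD (in_chart f c) := conf_minimal_sub wD_cod (hf ac).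

Lemma wD_frame : exists iF ik, [/\ cmF wH * iF = 1, kF (sfd wD) (cmF wH) iF * ik = 1 &
  forall y, oset wD y -> (kF (sfd wD) (cmF wH) iF * iF) y = (kap (chart_inv c y))%:C].
Proof.
have [iF hi _] := cmF_inv wH.
have e y : oset wD y -> (kF (sfd wD) (cmF wH) iF * iF) y = (kap (chart_inv c y))%:C.
  by move=> Dy; rewrite (ev_kappa hi Dy) (kappaE hf ac) //; case: Dy.
have k0 y : oset wD y -> kF (sfd wD) (cmF wH) iF y != 0.
  move=> Dy; apply/eqP => h0; have := e y Dy; rewrite (sfME _ _ Dy) h0 mul0r => -[] h.
  by have := W0 Dy.2; rewrite -h eqxx.
have [ik hk _] := sf_inv k0.
by exists iF, ik.
Qed.

End Domain.

(* [unique_continuation] applied to kappa outside V, extended by zero: the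
   umbilic-free part of the surface is connected and dense. *)
Lemma kappa_uc (V : set M) : open V -> open [set p | kap p != 0 /\ ~ V p] ->
  (exists p : M, \forall q \near p, V q \/ kap q = 0) -> forall p, kap p != 0 -> V p.
Proof.
move=> oV oW [p0 hp0]; set W := [set p | _] in oW.
pose h p := if pselect (V p) is left _ then 0 else kap p.
have k0 := kappa_ge0 hf; have kc := kappa_cont hf.
have h0 p : 0 <= h p by rewrite /h; case: pselect.
have hk p : h p <= kap p by rewrite /h; case: pselect.
have hc : continuous h.
  (* At a zero of kappa, h is squeezed between 0 and kappa; elsewhere it is locally 0 or locally
     kappa, since V and W are open. *)
  move=> p; rewrite /continuous_at; have [kp|kp] := eqVneq (kap p) 0.
    have -> : h p = 0 by apply/eqP; rewrite eq_le h0 -kp hk.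
    have hkp : kap @ nbhs p --> (0 : R) by rewrite -kp; exact: kc.
    have hcp : (fun=> 0) @ nbhs p --> (0 : R) by exact: cvg_cst.
    apply: (squeeze_cvgr _ hcp hkp).
    by apply: nearW => q; rewrite h0 hk.
  have [Vp|Vp] := pselect (V p).
    have -> : h p = 0 by rewrite /h; case: pselect.
    apply: cvg_near_cst; apply: filterS (open_nbhs_nbhs (conj oV Vp)) => q Vq.
    by rewrite /h; case: pselect.
  have -> : h p = kap p by rewrite /h; case: pselect.
  apply: cvg_trans (kc p); apply: near_eq_cvg.
  have Wp : W p by [].
  apply: filterS (open_nbhs_nbhs (conj oW Wp)) => q [_ Vq].
  by rewrite /h; case: pselect.
have hW p : 0 < h p -> W p.
  rewrite /h; case: pselect => [_|Vp kp]; first by rewrite ltxx.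
  by split => //; rewrite gt_eqF.
have W0 p : W p -> kap p != 0 by case.
suff hz p : h p = 0.
  move=> p kp; have := hz p; rewrite /h; case: pselect => // _ e.
  by rewrite e eqxx in kp.
move: p; apply: (unique_continuation hc h0); last first.
  exists p0; apply: filterS hp0 => q [Vq|kq]; first by rewrite /h; case: pselect.
  by apply/eqP; rewrite eq_le h0 -kq hk.
move=> c z ac cz; have [iF0 hi0 _] := cmF_inv (hf ac).
pose K0 : sfun (chD c) := kF (sfd (chD c)) (cmF (hf ac)) iF0.
have hK : {for z, continuous (refun K0)}.
  by apply: differentiable_continuous; exact: (@sf_diff _ (chD c) K0 _ cz).1.
(* For log kappa, dbar d is q - 3k + 2F with q >= 0 and F > 0, so three times a local upper bound of
   k serves as C. *)
exists (3 * `|refun K0 z + 1|); split; first by rewrite mulr_ge0.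
have near_K : \forall x \near z, refun K0 x < refun K0 z + 1.
  apply: (hK [set t | t < refun K0 z + 1]).
  by apply: open_nbhs_nbhs; split; [exact: open_lt|rewrite /= ltrDl].
apply: filterS (filterI near_K (near_cod cz)) => x [Kx cx] hx.
have Wx := hW _ hx.
have [iF [ik [hi hk' e]]] := wD_frame oW W0 ac.
have Dx : oset (wD oW c) x by [].
have [a ha dba] := logd_kappa hi hk'.
exists (wD oW c), (kF (sfd (wD oW c)) (cmF (wH oW ac)) iF * iF), a; split => //.
  move=> y Dy; rewrite e // /h; case: pselect => // Vy.
  by case: Dy => _ [_ /(_ Vy)].
rewrite dba.
have q0 := q_ge0 hi hk' Dx; have F0 := F_gt0 (wH oW ac) Dx.
have eK : kF (sfd (wD oW c)) (cmF (wH oW ac)) iF x = K0 x.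
  have e1 : (kF (sfd (wD oW c)) (cmF (wH oW ac)) iF * iF) x = (K0 * iF0) x.
    by rewrite (ev_kappa hi Dx) (ev_kappa hi0 (D := chD c) cx).
  move: e1; rewrite (sfME _ _ Dx) (sfME (D := chD c) _ _ cx).
  rewrite (ev_iF hi Dx) (ev_iF hi0 (D := chD c) cx) => /mulIf; apply.
  by rewrite invr_eq0 (cm_F_neq0 (hf ac) cx).
rewrite (ev_laplacian _ _ _ Dx).
rewrite eK !(ReD, ReN); move: Kx; rewrite /refun.
have := ler_norm (Re (K0 z) + 1); move: q0 F0.
by move: (Re _) (Re _) (Re _) (Re _) `|_| => t1 t2 t3 t4 t5 *; lra.
Qed.

(** [kappa_uc] with V empty: if kappa vanished on some neighbourhood, it would vanish everywhere. *)
Lemma kappa_dense (p0 : M) : kap p0 != 0 -> forall (p : M) (P : set M), nbhs p P ->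
  exists2 r, P r & kap r != 0.
Proof.
move=> k0 p P nP; apply: contrapT => h.
have : set0 p0 => //; apply: (@kappa_uc set0) k0.
- exact: open0.
- rewrite openE => r [kr _]; rewrite /interior.
  apply: filterS (_ : \forall q \near r, kap q != 0); first by move=> q; split.
  apply: (kappa_cont hf (t := [set t | t != 0])).
  by apply: open_nbhs_nbhs; split => //; exact: open_neq.
exists p; apply: filterS nP => q Pq; right; apply/eqP; apply: contrapT => /negP kq.
by apply: h; exists q.
Qed.

End Connectivity.

(** * Propagation of linear relations *)

Section Glue.
Context {R : realType} {M : topologicalType} (k : nat) (h : M -> 'rV[R]_k) (U : set M).
Hypothesis hc : forall i, continuous (fun p => h p 0 i).
Hypothesis Udense : forall (p : M) (P : set M), nbhs p P -> exists2 r, P r & U r.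
Hypothesis Uconn : forall V : set M, V `<=` U -> open V -> open [set p | U p /\ ~ V p] ->
  V !=set0 -> U `<=` V.
Variable l : nat.
Hypothesis oU : open U.
Hypothesis loc : forall p, U p -> exists2 N, nbhs p N & forall w : 'M[R]_(k, l),
  forall r, N r -> (\forall s \near r, h s *m w = 0) -> forall s, N s -> h s *m w = 0.

(** By [loc], the points of U near which the relation holds form an open and relatively closed
    subset, hence all of U; density of U and continuity of h do the rest. *)
Lemma glue_linear (w : 'M[R]_(k, l)) (p0 : M) : (\forall s \near p0, h s *m w = 0) ->
  forall p, h p *m w = 0.
Proof.
move=> hp0; pose V := U `&` [set p | \forall s \near p, h s *m w = 0].
have oV : open V.
  apply: openI => //; rewrite openE => p; rewrite /interior /= => /near_join.
  exact.
have oW : open [set p | U p /\ ~ V p].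
  rewrite openE => p [Up Vp]; rewrite /interior.
  have [N nN hN] := loc Up.
  have nU : nbhs p U by apply: open_nbhs_nbhs.
  apply: filterS (filterI nU nN) => r [Ur Nr]; split => // -[_ Vr].
  apply: Vp; split => //; apply: filterS nN => s; exact: hN Nr Vr s.
have V0 : V !=set0.
  have := hp0 => /near_join hp0'.
  by have [r hr Ur] := Udense hp0'; exists r; split.
have UV := Uconn (@subIsetl _ _ _) oV oW V0.
have Uz p : U p -> h p *m w = 0 by move=> /UV[_]; exact: nbhs_singleton.
move=> p; apply/rowP => j; rewrite [RHS]mxE.
have cj' : continuous (fun p => (h p *m w) 0 j).
  have -> : (fun p => (h p *m w) 0 j) = fun p => \sum_i h p 0 i * w i j.
    by apply/funext => q; rewrite mxE.
  elim: (index_enum _) => [|i r IH] q.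
    rewrite (_ : (fun p => _) = fun=> 0); first exact: cvg_cst.
    by apply/funext => x; rewrite big_nil.
  rewrite (_ : (fun p => _) = fun p => h p 0 i * w i j + \sum_(i <- r) h p 0 i * w i j).
    apply: cvgD; last exact: IH.
    by apply: cvgM; [exact: hc|exact: cvg_cst].
  by apply/funext => x; rewrite big_cons.
apply/eqP; apply: contrapT => /negP e.
have : nbhs p [set q | (h q *m w) 0 j != 0].
  apply: (cj' p [set t | t != 0]).
  by apply: open_nbhs_nbhs; split => //; exact: open_neq.
by move=> /Udense[r /= hr /Uz hz]; move: hr; rewrite hz mxE eqxx.
Qed.

End Glue.

Lemma conf_surface_cont {R : realType} {M : topologicalType} (X : riemann_surface R M) n
    (f : M -> 'rV[R]_n.+1) : conf_surface X f -> forall i, continuous (fun p => f p 0 i).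
Proof.
move=> hf i p; have [c ac cp] := atlas_cover X p; have cz := chart_map_cod cp.
have h : {for chart_map c p, continuous (fun z => in_chart f c z 0 i)}.
  apply: differentiable_continuous; apply: diff_coord.
  exact: (cm_diff (hf c ac) cz).
have e : \forall q \near p, in_chart f c (chart_map c q) 0 i = f q 0 i.
  by apply: filterS (near_dom cp) => q cq; rewrite /in_chart /= chart_mapK.
have e0 : in_chart f c (chart_map c p) 0 i = f p 0 i by exact: (nbhs_singleton e).
rewrite /continuous_at -e0; apply: cvg_trans; first exact: (near_eq_cvg e).
exact: (continuous_comp (chart_map_at cp) h).
Qed.

Section Constant.
Context {R : realType} (D : opn R).
Local Notation S := (sfd D).

Lemma closed_const (u : sfun D) z (e : R) : (forall x, sqdist z x < e -> oset D x) ->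
  dd S u = 0 -> db S u = 0 -> forall x, sqdist z x < e -> u x = u z.
Proof.
move=> hD du bu x hx.
have cd v y : oset D y -> cder v u y = 0.
  move=> Dy; rewrite (cder_tz v (sf_diff u Dy)) -(sfddE _ Dy) -(sfdbE _ Dy) du bu.
  by rewrite (sf0E Dy) !mulr0 addr0.
pose w := x - z.
have inD (t : R) : 0 <= t <= 1 -> oset D (t *: w + z).
  move=> /andP[t0 t1]; apply: hD; apply: le_lt_trans hx.
  have -> : sqdist z (t *: w + z) = t ^+ 2 * sqdist z x.
    rewrite /sqdist /w.
    change ((t * (x.1 - z.1) + z.1 - z.1) ^+ 2 + (t * (x.2 - z.2) + z.2 - z.2) ^+ 2 =
      t ^+ 2 * ((x.1 - z.1) ^+ 2 + (x.2 - z.2) ^+ 2)).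
    by move: x.1 x.2 z.1 z.2 => x1 x2 z1 z2; ring.
  rewrite ler_piMl ?addr_ge0 ?sqr_ge0 //.
  by rewrite expr_le1.
have cst (a : plane R -> R) : (forall y, oset D y -> differentiable a y) ->
    (forall y, oset D y -> 'D_w a y = 0) -> a x = a z.
  move=> da d0.
  have dl (t : R) : 0 <= t <= 1 -> is_derive t 1 (fun t : R => a (t *: w + z)) 0.
    move=> ht; rewrite -(d0 _ (inD t ht)); apply: is_derive_line.
    by apply: diff_derivable; apply: da; exact: inD.
  have [||xi _] := @MVT R (fun t : R => a (t *: w + z)) (fun=> 0) 0 1 ltr01.
  - by move=> t; rewrite in_itv /= => /andP[t0 t1]; apply: dl; rewrite !ltW.
  - apply: derivable_within_continuous => t; rewrite in_itv /= => ht.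
    exact: (@ex_derive _ _ _ _ _ _ _ (dl t ht)).
  rewrite mul0r scale1r scale0r add0r subrK => /eqP.
  by rewrite subr_eq0 => /eqP.
apply: complex_ext.
  apply: (cst (refun u)) => y Dy; first exact: (sf_diff u Dy).1.
  by have := congr1 (fun t : R[i] => Re t) (cd w y Dy).
apply: (cst (imfun u)) => y Dy; first exact: (sf_diff u Dy).2.
by have := congr1 (fun t : R[i] => Im t) (cd w y Dy).
Qed.

End Constant.

Section Vanishing.
Context {R : realType} (D : opn R).
Local Notation S := (sfd D).
Variable y : plane R.
Hypothesis Dy : oset D y.

Definition vanish (a : sfun D) : Prop := \forall x \near y, a x = 0.

Let near_DP (P : plane R -> Prop) : (forall x, oset D x -> P x) -> \forall x \near y, P x.
Proof. by move=> h; apply: filterS (nearD (@oopen _ D) Dy) => x; apply: h. Qed.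

Lemma vanishD a b : vanish a -> vanish b -> vanish (a + b).
Proof.
move=> ha hb; have hD : \forall x \near y, oset D x by apply: near_DP.
apply: filterS (filterI hD (filterI ha hb)) => x [Dx [ax bx]].
by rewrite (sfDE _ _ Dx) ax bx addr0.
Qed.

Lemma vanishM a b : vanish b -> vanish (a * b).
Proof.
move=> hb; have hD : \forall x \near y, oset D x by apply: near_DP.
by apply: filterS (filterI hD hb) => x [Dx bx]; rewrite (sfME _ _ Dx) bx mulr0.
Qed.

Lemma vanish_cj a : vanish a -> vanish (cj S a).
Proof.
move=> hb; have hD : \forall x \near y, oset D x by apply: near_DP.
by apply: filterS (filterI hD hb) => x [Dx bx]; rewrite (sfcjE _ Dx) bx conjc0.
Qed.

Lemma vanish_dd a : vanish a -> vanish (dd S a).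
Proof.
move=> /near_join ha; have hD : \forall x \near y, oset D x by apply: near_DP.
apply: filterS (filterI hD ha) => x [Dx hx]; rewrite (sfddE _ Dx).
have e v : cder v a x = 0.
  rewrite /cder; have hz (h : R[i] -> R) : h 0 = 0 -> 'D_v (fun t => h (a t)) x = 0.
    move=> h0; rewrite -(derive_cst (0 : R) v x); apply: near_eq_derive.
    by apply: filterS hx => t ->.
  by rewrite /refun /imfun !hz.
by rewrite dzE !e mulr0 subrr mulr0.
Qed.

Lemma vanish_at a : vanish a -> a y = 0.
Proof. exact: nbhs_singleton. Qed.

End Vanishing.

Section Rigid.
Context {R : realType}.

Lemma closed_matrix (D : opn R) a b (T : 'M[sfun D]_(a, b)) z e :
  (forall x, sqdist z x < e -> oset D x) -> 0 < e ->
  (forall i j, dd (sfd D) (T i j) = 0) -> (forall i j, cj (sfd D) (T i j) = T i j) ->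
  exists P : 'M[R]_(a, b), forall x, sqdist z x < e -> forall i j, T i j x = (P i j)%:C.
Proof.
move=> hD e0 dT cT; exists (\matrix_(i, j) Re (T i j z)) => x hx i j.
rewrite mxE (closed_const hD (dT i j) (db_real (cT i j) (dT i j)) hx).
have Dz : oset D z by apply: hD; rewrite /sqdist !subrr expr0n addr0.
have := congr1 (fun u : sfun D => u z) (cT i j); rewrite (sfcjE _ Dz).
by case: (T i j z) => t t' [] h; apply: complex_ext => //=; lra.
Qed.

Definition cstK (D : opn R) a b (w : 'M[R]_(a, b)) : 'M[sfun D]_(a, b) :=
  map_mx (fun t => sf_cst D t%:C) w.

Lemma dd_cstK (D : opn R) a b (w : 'M[R]_(a, b)) i j : dd (sfd D) (cstK D w i j) = 0.
Proof. by rewrite mxE dd_sf_cst. Qed.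
Lemma cj_cstK (D : opn R) a b (w : 'M[R]_(a, b)) i j :
  cj (sfd D) (cstK D w i j) = cstK D w i j.
Proof.
by rewrite mxE cj_sf_cst; congr sf_cst; apply: complex_ext => //=; rewrite oppr0.
Qed.

Lemma mul_cstK (D : opn R) a b l (T : 'M[sfun D]_(a, b)) (P : 'M[R]_(a, b))
    (w : 'M[R]_(b, l)) x i j : oset D x -> (forall i j, T i j x = (P i j)%:C) ->
  (T *m cstK D w) i j x = ((P *m w) i j)%:C.
Proof.
move=> Dx hT; rewrite !mxE (sf_sumE _ Dx) rmorph_sum; apply: eq_bigr => s _.
by rewrite (sfME _ _ Dx) hT mxE (sf_cstE _ Dx) rmorphM.
Qed.

Variables (M : topologicalType) (X : riemann_surface R M).
Variables (n : nat) (f : M -> 'rV[R]_n.+1) (c : chart R M).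
Variables (D : opn R) (H : conf_minimal D (in_chart f c)).
Hypothesis Dc : oset D `<=` chart_cod c.
Local Notation fK := (cmK H).

Lemma cmK_entry x j : oset D x -> fK 0 j x = (f (chart_inv c x) 0 j)%:C.
Proof. by move=> Dx; have /rowP/(_ j) := evv_f H Dx; rewrite !mxE. Qed.

Lemma mul_transfer b (T : 'M[sfun D]_(n.+1, b)) (P : 'M[R]_(n.+1, b)) (u : 'rV[sfun D]_b) x j :
  oset D x -> (forall i j, T i j x = (P i j)%:C) -> fK *m T = u ->
  u 0 j x = ((f (chart_inv c x) *m P) 0 j)%:C.
Proof.
move=> Dx hT <-; rewrite !mxE (sf_sumE _ Dx) rmorph_sum; apply: eq_bigr => s _.
by rewrite (sfME _ _ Dx) hT cmK_entry // rmorphM.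
Qed.

(** On the ball T is a constant P, and f = f P. A relation f w = 0 near one point is inherited by T
    and becomes P w = 0, so f w = f P w = 0 on the whole ball. *)
Lemma local_rigid l (T : 'M[sfun D]_n.+1) z e :
  (forall x, sqdist z x < e -> oset D x) -> 0 < e ->
  (forall i j, dd (sfd D) (T i j) = 0) -> (forall i j, cj (sfd D) (T i j) = T i j) ->
  fK *m T = fK ->
  (forall y (w : 'M[R]_(n.+1, l)), oset D y -> kills (vanish y) (cstK D w) fK ->
     kills_mx (vanish y) (cstK D w) T) ->
  forall (w : 'M[R]_(n.+1, l)) y, sqdist z y < e ->
    (\forall x \near y, f (chart_inv c x) *m w = 0) ->
    forall x, sqdist z x < e -> f (chart_inv c x) *m w = 0.
Proof.
move=> hD e0 dT cT fT kT w y hy hw x hx.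
have [P hP] := closed_matrix hD e0 dT cT.
have Dy := hD _ hy.
have ew s : oset D s -> forall j, (fK *m cstK D w) 0 j s = ((f (chart_inv c s) *m w) 0 j)%:C.
  move=> Ds j; apply: mul_cstK => // i j'; rewrite ord1; exact: cmK_entry.
have hk : kills (vanish y) (cstK D w) fK.
  move=> j; apply: filterS (filterI (nearD (@oopen _ D) Dy) hw) => s [Ds hs].
  by rewrite ew // hs mxE.
have Pw : P *m w = 0.
  apply/matrixP => i j; have := vanish_at (kT y w Dy hk i j).
  by rewrite (mul_cstK w i j Dy (hP _ hy)) => -[->]; rewrite mxE.
have fP : f (chart_inv c x) = f (chart_inv c x) *m P.
  apply/rowP => j; have := mul_transfer j (hD _ hx) (hP _ hx) fT.
  by rewrite (cmK_entry _ (hD _ hx)) => -[].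
by rewrite fP -mulmxA Pw mulmx0.
Qed.

End Rigid.

Lemma substantial_linear {R : realType} {M : topologicalType} n (f : M -> 'rV[R]_n.+1) l
    (w : 'M[R]_(n.+1, l)) : substantial f -> (forall p, f p *m w = 0) -> w = 0.
Proof.
move=> sf h; apply/eqP; rewrite -mxrank_eq0; apply/negPn/negP => w0; apply: sf.
exists (kermx w); last by move=> p; apply/sub_kermxP.
by rewrite mxrank_ker ltn_subrL lt0n w0.
Qed.

Section Reducible.
Context {R : realType} {M : topologicalType} (X : riemann_surface R M).
Variables (n : nat) (f : M -> 'rV[R]_n.+1).
Hypothesis hf : conf_surface X f.

(** [T] abstracts the orthogonal projector onto an osculating space of dimension t that does not
    vary. The last clause says that T inherits the constant linear relations of f. *)
Record rigid_at (t : nat) (p : M) : Prop := RigidAt {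
  rigid_ex : exists (c : chart R M) (D : opn R) (H : conf_minimal D (in_chart f c))
      (T : 'M[sfun D]_n.+1),
    [/\ chart_dom c p, oset D (chart_map c p) & oset D `<=` chart_cod c] /\
    [/\ forall i j, dd (sfd D) (T i j) = 0, forall i j, cj (sfd D) (T i j) = T i j,
        cmK H *m T = cmK H, \tr T = t%:R &
        forall y l (w : 'M[R]_(n.+1, l)), oset D y -> kills (vanish y) (cstK D w) (cmK H) ->
          kills_mx (vanish y) (cstK D w) T]
}.

Lemma chart_ball (c : chart R M) p e : chart_dom c p -> 0 < e ->
  nbhs p (chart_dom c `&` chart_map c @^-1` [set x | sqdist (chart_map c p) x < e]).
Proof.
move=> cp e0; apply: filterI; first exact: near_dom.
by apply: near_chart_map => //; apply: sqdist_near; rewrite /sqdist !subrr expr0n addr0.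
Qed.

Lemma rigid_loc l t p : rigid_at t p -> exists2 N, nbhs p N & forall w : 'M[R]_(n.+1, l),
  forall r, N r -> (\forall s \near r, f s *m w = 0) -> forall s, N s -> f s *m w = 0.
Proof.
move=> [[c [D [H [T [[cp Dp Dc] [dT cT fT _ kT]]]]]]].
have [e e0 He] := near_sqdist (nearD (@oopen _ D) Dp).
exists (chart_dom c `&` chart_map c @^-1` [set x | sqdist (chart_map c p) x < e]).
  exact: chart_ball.
move=> w r [cr /= hr] hw s [cs /= hs]; rewrite -(chart_mapK cs).
apply: (local_rigid He e0 dT cT fT (fun y => @kT y l) hr) => //.
apply: (near_chart_inv (A := [set s | f s *m w = 0]) (chart_map_cod cr)).
by rewrite chart_mapK.
Qed.

Lemma rigid_const t p : rigid_at t p -> exists2 P : 'M[R]_n.+1, \tr P = t%:R &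
  \forall s \near p, f s *m (1%:M - P) = 0.
Proof.
move=> [[c [D [H [T [[cp Dp Dc] [dT cT fT trT _]]]]]]].
have [e e0 He] := near_sqdist (nearD (@oopen _ D) Dp).
have [P hP] := closed_matrix He e0 dT cT.
have hz : sqdist (chart_map c p) (chart_map c p) < e by rewrite /sqdist !subrr expr0n addr0.
exists P.
  have := congr1 (fun u : sfun D => u (chart_map c p)) trT.
  rewrite /mxtrace (sf_sumE _ Dp).
  have -> : \sum_i T i i (chart_map c p) = (\sum_i P i i)%:C.
    by rewrite rmorph_sum; apply: eq_bigr => i _; exact: hP.
  have -> : (t%:R : sfun D) (chart_map c p) = (t%:R)%:C.
    rewrite rmorph_nat; elim: t {trT} => [|t IH]; first by rewrite (sf0E Dp).
    by rewrite !mulrS (sfDE _ _ Dp) IH (sf1E Dp).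
  by move=> -[].
apply: filterS (chart_ball cp e0) => s [cs /= hs].
rewrite mulmxBr mulmx1; apply/eqP; rewrite subr_eq0; apply/eqP; apply/rowP => j.
have := mul_transfer j (He _ hs) (hP _ hs) fT.
by rewrite (cmK_entry H j (He _ hs)) chart_mapK // => -[].
Qed.

(** The relation f (1 - P) = 0 near one point spreads over M; substantiality then gives P = 1, whose
    trace is n + 1. *)
Lemma rigid_substantial t (U : set M) (p0 : M) : open U -> U p0 ->
  (forall (p : M) (P : set M), nbhs p P -> exists2 r, P r & U r) ->
  (forall V : set M, V `<=` U -> open V -> open [set p | U p /\ ~ V p] ->
    V !=set0 -> U `<=` V) ->
  (forall p, U p -> rigid_at t p) -> substantial f -> n.+1 = t.
Proof.
move=> oU Up0 Ud Uc hr sf.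
have [P trP hP] := rigid_const (hr _ Up0).
have h := glue_linear (conf_surface_cont hf) Ud Uc oU (fun p Up => rigid_loc n.+1 (hr p Up)) hP.
have := substantial_linear sf h => /eqP; rewrite subr_eq0 => /eqP e.
move: trP; rewrite -e mxtrace1 => /eqP; rewrite eqr_nat => /eqP //.
Qed.

End Reducible.

Lemma half_sub_lt0 {R : realFieldType} (a : R) : 0 < a -> a / 2 - a < 0.
Proof. by lra. Qed.

Lemma open_preim {R : realType} {M : topologicalType} (s : M -> R) (A : set R) :
  continuous s -> open A -> open (s @^-1` A).
Proof.
move=> sc oA; rewrite openE => p sp; rewrite /interior; apply: (sc p A).
exact: open_nbhs_nbhs.
Qed.

(** * Torsion and rigidity *)

Section Umbilics.
Context {R : realType} {M : topologicalType} (X : riemann_surface R M).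

(** If kappa vanished identically, then A = 0, and the projector [transfer3] of trace 3 would force
    n = 2. *)
Lemma not_umbilic n (f : M -> 'rV[R]_n.+1) (p0 : M) : conf_surface X f -> substantial f ->
  n != 2 -> exists p, kappa X f p != 0.
Proof.
move=> hf sf n2; apply: contrapT => h.
have k0 p : kappa X f p = 0.
  by apply/eqP; apply: contrapT => /negP kp; apply: h; exists p.
suff e : n.+1 = 3 by case: e n2 => ->.
apply: (@rigid_substantial _ _ X _ _ hf 3 setT p0) => //.
- exact: openT.
- by move=> p P nP; exists p => //; exact: nbhs_singleton.
- move=> V _ oV oW V0.
  have cV : closed V.
    rewrite -openC; congr open: oW; apply/seteqP; split => p; first by case.
    by move=> /= Vp; split.
  have -> : V = setT; last by [].
  apply: (surface_connected X) => //; by exists V => //; rewrite setTI.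
move=> p _; have [c ac cp] := atlas_cover X p.
have [iF hi _] := cmF_inv (hf c ac); have Hh := cm_harm hi.
have A0 : vA (sfd (chD c)) (cmK (hf c ac)) (cmF (hf c ac)) iF = 0.
  apply: (@bdot_pos _ (sfd (chD c))); rewrite (gauss Hh).
  set k := kF _ _ _.
  have kiF : k * iF = 0.
    apply: sfunP => z Dz; rewrite (ev_kappa hi Dz) (kappaE hf ac Dz) k0.
    by rewrite (sf0E Dz).
  transitivity (k * iF * cmF (hf c ac) ^+ 2); last by rewrite kiF mul0r.
  transitivity (k * (cmF (hf c ac) * iF) * cmF (hf c ac)); first by rewrite hi mulr1.
  by ring.
split; exists c, (chD c), (hf c ac), (transfer3 (sfd (chD c)) (cmK (hf c ac)) iF); split.
  by split => //; exact: chart_map_cod.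
split.
- by move=> i j; apply: (d_transfer3 Hh).
- by move=> i j; apply: (cj_transfer3 Hh).
- exact: (transfer3_mul Hh).
- exact: (mxtrace_transfer3 Hh).
move=> y l w Dy hk; apply: kills_transfer3 hk.
- exact: vanishD.
- exact: vanishM.
- exact: vanish_dd.
- exact: vanish_cj.
- exact: dd_cstK.
- exact: cj_cstK.
Qed.

Section U.
Variables (n : nat) (f : M -> 'rV[R]_n.+1).
Hypothesis hf : conf_surface X f.

Definition umbilic_free : set M := [set p | kappa X f p != 0].

Lemma umbilic_free_open : open umbilic_free.
Proof.
rewrite openE => r kr; rewrite /interior.
apply: (kappa_cont hf (t := [set t | t != 0])).
by apply: open_nbhs_nbhs; split => //; exact: open_neq.
Qed.

Lemma umbilic_free_conn (V : set M) : V `<=` umbilic_free -> open V ->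
  open [set p | umbilic_free p /\ ~ V p] -> V !=set0 -> umbilic_free `<=` V.
Proof.
move=> _ oV oW [p Vp] q Uq; apply: (kappa_uc hf oV oW) => //.
by exists p; apply: filterS (open_nbhs_nbhs (conj oV Vp)) => r; left.
Qed.

Definition uD (c : chart R M) : opn R := wD umbilic_free_open c.
Definition uH (c : chart R M) (ac : atlas X c) : conf_minimal (uD c) (in_chart f c) :=
  wH hf umbilic_free_open ac.

Lemma uD_frame c (ac : atlas X c) : exists iF ik,
  cmF (uH ac) * iF = 1 /\ kF (sfd (uD c)) (cmF (uH ac)) iF * ik = 1.
Proof.
by have [iF [ik []]] := wD_frame hf umbilic_free_open (fun p Up => Up) ac; exists iF, ik.
Qed.

End U.
End Umbilics.

Section Torsion.
Context {R : realType} {M : topologicalType} (X : riemann_surface R M).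
Variable g : M -> 'rV[R]_(6.+1).
Hypothesis hg : conf_surface X g.
Hypothesis gJ : forall c z, atlas X c -> chart_cod c z -> forall v,
  cayley_im ('D_(rotJ v) (in_chart g c) z) =
  cayley_mul (cayley_im (in_chart g c z)) (cayley_im ('D_v (in_chart g c) z)).
Hypothesis gcircle : forall c z, atlas X c -> chart_cod c z -> regular_at (in_chart g c) z ->
  forall Z, induced_metric (in_chart g c) z Z Z = 1 ->
  is_circle (curvature_ellipse (in_chart g c) 2 z Z).
Hypothesis gsub : substantial g.
Local Notation U := (umbilic_free X g).
Local Notation kap := (kappa X g).

Lemma pseudohol_Phi0 c z : atlas X c -> chart_cod c z ->
  bdot (rA (in_chart g c) z) (rA (in_chart g c) z) = 0.
Proof.
move=> ac cz; have [iF hi _] := cmF_inv (hg ac).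
have GJ y : oset (chD c) y -> forall v, cayley_im ('D_(rotJ v) (in_chart g c) y) =
  cayley_mul (cayley_im (in_chart g c y)) (cayley_im ('D_v (in_chart g c) y)).
  by move=> Dy v; exact: gJ.
have := g2_Phi (hg ac) GJ iF; move/(congr1 (fun u : sfun (chD c) => u z)).
by rewrite (evv_bdot (D := chD c) _ _ cz) (evv_A hi (D := chD c) cz) (sf0E (D := chD c) cz).
Qed.

Section Local.
Variables (W : set M) (oW : open W) (c : chart R M).
Hypothesis ac : atlas X c.
Local Notation D := (wD oW c).
Local Notation H := (wH hg oW ac).
Local Notation S := (sfd D).
Variables iF ik : sfun D.
Hypothesis hi : cmF H * iF = 1.
Local Notation k := (kF S (cmF H) iF).
Hypothesis Hk : k * ik = 1.
Local Notation A := (vA S (cmK H) (cmF H) iF).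
Local Notation B := (vB S (cmK H) (cmF H) iF ik).
Local Notation q := (qF S (cmF H) iF ik).

Lemma local_J y : oset D y -> forall v, cayley_im ('D_(rotJ v) (in_chart g c) y) =
  cayley_mul (cayley_im (in_chart g c y)) (cayley_im ('D_v (in_chart g c) y)).
Proof. by move=> [cy _] v; exact: gJ. Qed.

Lemma local_Phi : bdot A A = 0.
Proof. exact: g2_Phi local_J _. Qed.

(** theta2 = |<B, B>|^2/F^6 separates the cases of [g2_dichotomy] by a continuous function: in the
    first, |<B, B>| = q k F = k F^2. *)
Lemma theta2_torsion y : oset D y ->
  (q y = cmF H y /\ (bdot B B * cj S (bdot B B)) y = ((q * (k * cmF H)) ^+ 2) y /\
   theta2 X g (chart_inv c y) = kap (chart_inv c y) ^+ 2) \/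
  ((q + q) y = cmF H y /\ theta2 X g (chart_inv c y) = 0).
Proof.
move=> Dy; have Hc z Z : oset D z -> regular_at (in_chart g c) z ->
    induced_metric (in_chart g c) z Z Z = 1 ->
    is_circle (curvature_ellipse (in_chart g c) 2 z Z).
  by move=> [cz _] rz; exact: gcircle.
have cy : chart_cod c y by case: Dy.
have e2 : (theta2 X g (chart_inv c y))%:C = (bdot B B * cj S (bdot B B)) y * (iF ^+ 6) y.
  rewrite -(theta2E hg pseudohol_Phi0 ac cy) -(ev_theta2 hi Dy) /theta2K.
  by rewrite (Phi2E ik local_Phi) (sfME _ (iF ^+ 6) Dy).
have e1 : (kap (chart_inv c y))%:C = k y * iF y.
  by rewrite -(kappaE hg ac cy) -(ev_kappa hi Dy) (sfME _ _ Dy).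
have hi0 : cmF H y * iF y = 1.
  by have := congr1 (fun u : sfun D => u y) hi; rewrite (sfME _ _ Dy) (sf1E Dy).
have real_inj (s t : R) : s%:C = t%:C -> s = t by move=> [].
have [[h1 h2]|[h1 h2]] := g2_dichotomy local_J hi Hk Hc Dy; [left|right].
  split => //; split => //; apply: real_inj; rewrite e2 h2 rmorphXn /= e1.
  rewrite !(sfXE _ _ Dy) (sfME _ _ Dy) (sfME k _ Dy) h1.
  move: (k y) (cmF H y) (iF y) hi0 => a b t hbt.
  transitivity ((a * t) ^+ 2 * (b * t) ^+ 4); first by ring.
  by rewrite hbt expr1n mulr1.
split => //; apply: real_inj; rewrite e2 (sfME _ _ Dy) h2 !mul0r //.
Qed.

End Local.

(** The case q = F: B is parallel to its conjugate, so [transfer6] is the projector, and the inverse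
    of q is [iF]. *)
Lemma torsion_five : (forall p, U p -> theta2 X g p = kap p ^+ 2) ->
  forall p, U p -> rigid_at g 6 p.
Proof.
move=> h p Up; have [c ac cp] := atlas_cover X p.
have [iF [ik [hi Hk]]] := uD_frame hg ac; have Hh := cm_harm hi.
set D := uD hg c in iF ik hi Hk Hh *; set H := uH hg ac in hi Hk Hh *.
have hy y : oset D y -> qF (sfd D) (cmF H) iF ik y = cmF H y /\
    (bdot (vB (sfd D) (cmK H) (cmF H) iF ik) (vB (sfd D) (cmK H) (cmF H) iF ik) *
     cj (sfd D) (bdot (vB (sfd D) (cmK H) (cmF H) iF ik) (vB (sfd D) (cmK H) (cmF H) iF ik))) y =
    ((qF (sfd D) (cmF H) iF ik * (kF (sfd D) (cmF H) iF * cmF H)) ^+ 2) y.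
  move=> Dy; have [[h1 [h2 _]] //|[_ h0]] := theta2_torsion hi Hk Dy.
  have [_ Uy] := Dy; move: (h _ Uy); rewrite h0 => /esym/eqP.
  by rewrite expf_eq0 /= => /eqP e; move: Uy; rewrite /umbilic_free /= e eqxx.
have hq : qF (sfd D) (cmF H) iF ik = cmF H by apply: sfunP => y /hy[].
have hB := sfunP (fun y Dy => (hy y Dy).2).
have Hq : qF (sfd D) (cmF H) iF ik * iF = 1 by rewrite hq.
have HP : bdot (vA (sfd D) (cmK H) (cmF H) iF) (vA (sfd D) (cmK H) (cmF H) iF) = 0.
  exact: local_Phi.
split; exists c, D, H, (transfer6 (sfd D) (cmF H) iF ik iF (cmK H) (cmK H)); split.
  split => //; last by move=> z [].
  by split; [exact: chart_map_cod|rewrite /= chart_mapK].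
split.
- by move=> i j; exact: (d_transfer6 Hk Hq i j Hh HP hq hB).
- by move=> i j; exact: (cj_transfer6 Hk Hq i j Hh hB).
- exact: (transfer6_mul _ _ _ Hh HP).
- exact: (mxtrace_transfer6 Hk Hq Hh).
move=> y l w Dy hk; apply: kills_transfer6 hk.
- exact: vanishD.
- exact: vanishM.
- exact: vanish_dd.
- exact: vanish_cj.
- exact: dd_cstK.
- exact: cj_cstK.
Qed.

Lemma torsion_null (p0 : M) : forall p, U p -> theta2 X g p = 0.
Proof.
have [p1 Up1] := not_umbilic p0 hg gsub isT.
have alt p : U p -> theta2 X g p = kap p ^+ 2 \/ theta2 X g p = 0.
  move=> Up; have [c ac cp] := atlas_cover X p.
  have [iF [ik [hi Hk]]] := uD_frame hg ac.
  have Dp : oset (uD hg c) (chart_map c p).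
    by split; [exact: chart_map_cod|rewrite /= chart_mapK].
  have := theta2_torsion hi Hk Dp; rewrite chart_mapK //.
  by move=> [[_ [_ h]]|[_ h]]; [left|right].
have kc := kappa_cont hg; have tc := theta2_cont hg pseudohol_Phi0.
(* On U, theta2 takes only the values 0 and kappa^2; comparison with the midpoint kappa^2/2 makes
   both cases open. *)
have sc : continuous (fun p => kap p ^+ 2 / 2 - theta2 X g p).
  move=> p; apply: cvgB; last exact: tc.
  apply: cvgMl; rewrite /=.
  by under eq_cvg do rewrite expr2; rewrite expr2; apply: cvgM; exact: kc.
pose V := U `&` [set p | kap p ^+ 2 / 2 - theta2 X g p < 0].
have oV : open V.
  apply: openI; first exact: umbilic_free_open.
  exact: (open_preim sc (@open_lt R 0)).
have k2 p : U p -> 0 < kap p ^+ 2 by move=> Up; rewrite exprn_even_gt0.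
have oW : open [set p | U p /\ ~ V p].
  have -> : [set p | U p /\ ~ V p] = U `&` [set p | 0 < kap p ^+ 2 / 2 - theta2 X g p].
    apply/seteqP; split => p [Up h]; split => //.
      have [e|e] := alt p Up; last by rewrite /= e subr0 divr_gt0 // k2.
      by exfalso; apply: h; split => //=; rewrite e half_sub_lt0 // k2.
    by move=> [_ /= h']; move: h; rewrite /= ltNge (ltW h').
  apply: openI; first exact: umbilic_free_open.
  exact: (open_preim sc (@open_gt R 0)).
have [[r Vr]|V0] := pselect (V !=set0); last first.
  move=> p Up; have [e|//] := alt p Up; exfalso; apply: V0; exists p; split => //=.
  by rewrite e half_sub_lt0 // k2.
have UV := umbilic_free_conn hg (@subIsetl _ _ _) oV oW (ex_intro _ r Vr).
have h p : U p -> theta2 X g p = kap p ^+ 2.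
  move=> Up; have [//|e] := alt p Up; have [_ /=] := UV p Up.
  by rewrite e subr0 ltNge divr_ge0 // ltW // k2.
(* The case q = F on all of U would give 7 = 6. *)
have := rigid_substantial hg (umbilic_free_open hg) Up1
  (kappa_dense hg Up1) (umbilic_free_conn hg) (torsion_five h) gsub.
by [].
Qed.

(** W is an arbitrary open set of non-umbilic points, because the quartic argument also has to leave
    out the zeros of <A, A>. *)
Lemma torsion_half (p0 : M) (W : set M) (oW : open W) c (ac : atlas X c) (iF ik : sfun (wD oW c)) :
  (forall p, W p -> kap p != 0) -> cmF (wH hg oW ac) * iF = 1 ->
  kF (sfd (wD oW c)) (cmF (wH hg oW ac)) iF * ik = 1 ->
  let q := qF (sfd (wD oW c)) (cmF (wH hg oW ac)) iF ik in q + q = cmF (wH hg oW ac).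
Proof.
move=> W0 hi Hk q; apply: sfunP => y Dy; have [_ /W0 Uy] := Dy.
have [[_ [_ e]]|[//]] := theta2_torsion hi Hk Dy.
move: e; rewrite (torsion_null p0 Uy) => /esym/eqP; rewrite expf_eq0 /= => /eqP e.
by move: Uy; rewrite e eqxx.
Qed.

End Torsion.

(** * The quartic form on a compact surface *)

Lemma bdot_conj_le {R : realType} m (V : 'rV[R[i]]_m) (a b : R) :
  bdot V V * conjc (bdot V V) = a%:C -> bdot V (vconj V) = b%:C -> a <= b ^+ 2.
Proof.
move=> ha hb; have h : `|bdot V V| <= b%:C.
  rewrite -hb; apply: le_trans (ler_norm_sum _ _ _) _.
  by apply: ler_sum => i _; rewrite normrM -expr2 sqr_normc mxE.
have h2 : `|bdot V V| ^+ 2 <= b%:C ^+ 2.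
  by rewrite ler_pXn2r // nnegrE ?normr_ge0 // (le_trans _ h).
by move: h2; rewrite sqr_normc ha -rmorphXn /= lecR.
Qed.

Lemma quartic_weight (K : fieldType) (a b s t r : K) : b * s = 1 -> r * t = 1 ->
  a ^+ 3 * (s * t * t) ^+ 4 = (a * t ^+ 4) ^+ 3 * (b * t)^-1 ^+ 4.
Proof.
move=> bs rt; have b0 : b != 0.
  by apply/eqP => b0; move/eqP: bs; rewrite b0 mul0r eq_sym oner_eq0.
have t0 : t != 0 by apply/eqP => t0; move/eqP: rt; rewrite t0 mulr0 eq_sym oner_eq0.
have -> : s = b^-1 by rewrite -[LHS]mul1r -(mulVf b0) -mulrA bs mulr1.
by field; rewrite t0 b0.
Qed.

Section Quartic.
Context {R : realType} {M : topologicalType} (X : riemann_surface R M).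
Variables (n : nat) (f : M -> 'rV[R]_n.+1).
Hypothesis hf : conf_surface X f.
Local Notation kap := (kappa X f).
Local Notation th := (theta X f).
Hypothesis half_torsion : forall (W : set M) (oW : open W) c (ac : atlas X c) (iF ik : sfun (wD oW c)),
  (forall p, W p -> kap p != 0) -> cmF (wH hf oW ac) * iF = 1 ->
  kF (sfd (wD oW c)) (cmF (wH hf oW ac)) iF * ik = 1 ->
  let q := qF (sfd (wD oW c)) (cmF (wH hf oW ac)) iF ik in q + q = cmF (wH hf oW ac).

Lemma theta_bounds p : 0 <= th p <= kap p ^+ 2.
Proof.
have [c ac cp] := atlas_cover X p; have cz := chart_map_cod cp.
have := kappaE hf ac cz; have := thetaE hf ac cz; rewrite chart_mapK // /rkappa /rtheta.
have [b b0 hb] := bdot_conj_real (rA (in_chart f c) (chart_map c p)).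
rewrite hb (cm_F (hf ac) cz); set V := rA _ _ in hb *; set r := 2^-1 * _.
have r0 : 0 < r by rewrite mulr_gt0 ?invr_gt0 // (cm_pos (hf ac) cz).
have [a a0 ha] : exists2 a : R, 0 <= a & bdot V V * conjc (bdot V V) = a%:C.
  case: (bdot V V) => s t; exists (s ^+ 2 + t ^+ 2); first by rewrite addr_ge0 ?sqr_ge0.
  by apply: complex_ext; rewrite /=; ring.
have hab := bdot_conj_le ha hb.
rewrite ha -fmorphV -!rmorphXn -!rmorphM => -[<-] [<-].
rewrite mulr_ge0 ?exprn_even_ge0 //= exprMn -exprM ler_wpM2r // exprn_even_ge0 //.
Qed.

(** Equal to |<A, A>|^6/(F |A|^2)^4 off the umbilics. The convention 0^-1 = 0 gives the value 0 at
    umbilics, and the bound of [quartic_le] makes this the continuous extension. *)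
Let w p := th p ^+ 3 * (kap p)^-1 ^+ 4.

Lemma quartic_le p : 0 <= w p <= kap p ^+ 2.
Proof.
have /andP[t0 tk] := theta_bounds p; have k0 := kappa_ge0 hf p.
rewrite /w mulr_ge0 ?exprn_ge0 ?invr_ge0 //=.
have [k00|kn] := eqVneq (kap p) 0; first by rewrite k00 invr0 !expr0n /= mulr0.
rewrite -(@ler_pM2r _ (kap p ^+ 4)) ?exprn_gt0 ?lt_def ?kn //.
rewrite -mulrA -exprMn mulVf // expr1n mulr1 -exprD.
apply: le_trans (_ : (kap p ^+ 2) ^+ 3 <= _); last by rewrite -exprM.
by rewrite ler_pXn2r // nnegrE (le_trans t0 tk).
Qed.

Lemma quartic_cont : continuous w.
Proof.
have kc := kappa_cont hf; have tc := theta_cont hf.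
move=> p; rewrite /continuous_at; have [kp|kp] := eqVneq (kap p) 0.
  have -> : w p = 0 by rewrite /w kp invr0 expr0n /= mulr0.
  have hc2 : (fun q => kap q ^+ 2) @ nbhs p --> (0 : R).
    have -> : (0 : R) = kap p ^+ 2 by rewrite kp expr0n.
    exact: continuous_for_exprn (kc p).
  have hc0 : (fun=> 0) @ nbhs p --> (0 : R) by exact: cvg_cst.
  apply: (squeeze_cvgr _ hc0 hc2); apply: nearW => q; exact: quartic_le.
apply: cvgM.
  exact: continuous_for_exprn (tc p).
have ic : {for p, continuous (fun q => (kap q)^-1)} by apply: cvgV => //; exact: kc.
exact: (continuous_for_exprn (n := 4) ic).
Qed.

Lemma quartic_zero : compact [set: M] -> forall c z, atlas X c -> chart_cod c z ->
  bdot (rA (in_chart f c) z) (rA (in_chart f c) z) = 0.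
Proof.
move=> cM c z ac cz.
have w0 : forall p, w p = 0.
  apply: (max_principle cM quartic_cont) => [p|]; first by have /andP[] := quartic_le p.
  move=> {c z ac cz} c z ac cz wz.
  (* Where w > 0 neither kappa nor theta vanishes, so k and <A, A> have the inverses that
     [logd_quartic] needs. *)
  pose W := [set p | kap p != 0] `&` [set p | th p != 0].
  have oW : open W.
    by apply: openI; [exact: (open_preim (kappa_cont hf) (@open_neq R 0))|
      exact: (open_preim (theta_cont hf) (@open_neq R 0))].
  have W0 p : W p -> kap p != 0 by case.
  have Wz : W (chart_inv c z).
    split; apply/eqP => e; move: wz; rewrite /w e.
      by rewrite invr0 expr0n /= mulr0 ltxx.
    by rewrite expr0n /= mul0r ltxx.
  have Dz : oset (wD oW c) z by [].
  have [iF [ik [hi hk e]]] := wD_frame hf oW W0 ac.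
  have hq := half_torsion W0 hi hk.
  set H := wH hf oW ac in hi hk e hq *; have Hh := cm_harm hi.
  set A := vA (sfd (wD oW c)) (cmK H) (cmF H) iF.
  have et y : oset (wD oW c) y -> thetaK H iF y = (th (chart_inv c y))%:C.
    by move=> Dy; rewrite (ev_theta hi Dy) (thetaE hf ac) //; case: Dy.
  have P0 y : oset (wD oW c) y -> bdot A A y != 0.
    move=> Dy; apply/eqP => h0; have := et y Dy; rewrite /thetaK -/A.
    rewrite (sfME _ (iF ^+ 4) Dy) (sfME _ _ Dy) h0 !mul0r => -[h].
    by have [_ [_]] := Dy; rewrite /= -h eqxx.
  have [iP hP _] := sf_inv P0.
  have [l hl dbl] := logd_quartic (harm_inv Hh) hk hP (dbPhi Hh) hq.
  exists (wD oW c), ((bdot A A * cj (sfd (wD oW c)) (bdot A A)) ^+ 3 * (ik * iF * iF) ^+ 4), l.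
  split => //.
    have wC p : (w p)%:C = (th p)%:C ^+ 3 * (kap p)%:C^-1 ^+ 4.
      by rewrite /w rmorphM !rmorphXn /= fmorphV.
    move=> y Dy; rewrite wC -(et y Dy) -(e y Dy).
    have kk : kF (sfd (wD oW c)) (cmF H) iF y * ik y = 1.
      by have := congr1 (fun u : sfun (wD oW c) => u y) hk; rewrite (sfME _ _ Dy) (sf1E Dy).
    have FF : cmF H y * iF y = 1.
      by have := congr1 (fun u : sfun (wD oW c) => u y) hi; rewrite (sfME _ _ Dy) (sf1E Dy).
    rewrite /thetaK -/A (sfME _ ((ik * iF * iF) ^+ 4) Dy) !(sfXE _ _ Dy).
    rewrite (sfME _ (iF ^+ 4) Dy) (sfXE _ _ Dy) (sfME (kF _ _ _) _ Dy) (sfME (ik * iF) _ Dy).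
    rewrite (sfME ik _ Dy).
    exact: quartic_weight kk FF.
  rewrite dbl mulr2n (sfDE _ _ Dz) ReD.
  by rewrite addr_gt0 // (F_gt0 H Dz).
(* w = 0 leaves theta = 0 or kappa = 0, and in the second case theta <= kappa^2 = 0. *)
have t0 : th (chart_inv c z) = 0.
  have /andP[t0 tk] := theta_bounds (chart_inv c z).
  have := w0 (chart_inv c z) => /eqP; rewrite /w mulf_eq0 !expf_eq0 /= invr_eq0.
  case/orP => /eqP //= k0; apply/eqP; rewrite eq_le t0 andbT.
  by move: tk; rewrite k0 expr0n.
have := thetaE hf ac cz; rewrite t0 /rtheta => /eqP.
rewrite mulf_eq0 expf_eq0 invr_eq0 (negPf (cm_F_neq0 (hf ac) cz)) andbF orbF.
by rewrite mulf_eq0 conjc_eq0 orbb => /eqP.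
Qed.

End Quartic.

(** * Congruence of f and g *)

Section Congruence.
Context {R : realType} {M : topologicalType} (X : riemann_surface R M).
Variables (n : nat) (f : M -> 'rV[R]_n.+1) (g : M -> 'rV[R]_(6.+1)).
Hypothesis cM : compact [set: M].
Hypothesis hf : conf_surface X f.
Hypothesis hg : conf_surface X g.
Hypothesis fg : isometric X f g.
Hypothesis fsub : substantial f.
Hypothesis gsub : substantial g.
Hypothesis gJ : forall c z, atlas X c -> chart_cod c z -> forall v,
  cayley_im ('D_(rotJ v) (in_chart g c) z) =
  cayley_mul (cayley_im (in_chart g c z)) (cayley_im ('D_v (in_chart g c) z)).
Hypothesis gcircle : forall c z, atlas X c -> chart_cod c z -> regular_at (in_chart g c) z ->
  forall Z, induced_metric (in_chart g c) z Z Z = 1 ->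
  is_circle (curvature_ellipse (in_chart g c) 2 z Z).
Variable p0 : M.
Local Notation U := (umbilic_free X g).
Let oU : open U := umbilic_free_open hg.

Lemma same_F (W : set M) (oW : open W) c (ac : atlas X c) :
  cmF (wH hf oW ac) = cmF (wH hg oW ac).
Proof.
apply: sfunP => z Dz; have [cz _] := Dz.
rewrite (ev_F _ Dz) (ev_F _ Dz) (cm_F (wH hf oW ac) Dz) (cm_F (wH hg oW ac) Dz).
by rewrite (fg ac cz).
Qed.

Lemma Phi_f c z : atlas X c -> chart_cod c z ->
  bdot (rA (in_chart f c) z) (rA (in_chart f c) z) = 0.
Proof.
move=> ac0 cz0; refine (quartic_zero (hf := hf) _ cM ac0 cz0).
move=> W oW d ad iF ik; rewrite (same_F oW ad) (kappa_isometric hf hg fg) => W0 hi hk.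
exact: (torsion_half gJ gcircle gsub p0 W0 hi hk).
Qed.

Lemma local_transfer p : U p -> rigid_at g 7 p /\
  exists2 P : 'M[R]_(6.+1, n.+1), \forall s \near p, f s = g s *m P &
    \forall s \near p, g s = f s *m P^T.
Proof.
move=> Up; have [c ac cp] := atlas_cover X p.
have [iF [ik [hi Hk]]] := uD_frame hg ac.
have hif : cmF (wH hf oU ac) * iF = 1 by rewrite same_F.
have hq := torsion_half gJ gcircle gsub p0 (oW := oU) (fun p Up => Up) hi Hk.
have Hg := cm_harm hi; have Hf := cm_harm hif; rewrite same_F in Hf.
set D := wD oU c in iF ik hi Hk hif hq Hg Hf.
set gK := cmK (uH hg ac) in Hg; set fK := cmK (wH hf oU ac) in Hf.
set F := cmF (uH hg ac) in hi Hk hq Hg Hf.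
have HPg : bdot (vA (sfd D) gK F iF) (vA (sfd D) gK F iF) = 0.
  by apply: (g2_Phi (uH hg ac)) => y [cy _] v; exact: gJ.
have HPf : bdot (vA (sfd D) fK F iF) (vA (sfd D) fK F iF) = 0.
  rewrite /F -[cmF _](same_F oU ac); apply: sfunP => y Dy.
  rewrite (evv_bdot _ _ Dy) (evv_A hif Dy) (sf0E Dy); apply: Phi_f => //.
  by case: Dy.
(* Since 2q = F, the inverse of q is 2/F. *)
pose iq : sfun D := iF + iF.
have Hq : qF (sfd D) F iF ik * iq = 1.
  by rewrite /iq mulrDr -mulrDl hq.
have Cg := null_torsion_C Hg Hk Hq hq; have Cf := null_torsion_C Hf Hk Hq hq.
have Dp : oset D (chart_map c p).
  by split; [exact: chart_map_cod|rewrite /= chart_mapK].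
have Dc : oset D `<=` chart_cod c by move=> y [].
split.
  split; exists c, D, (uH hg ac), (transfer7 (sfd D) F iF ik iq gK gK); split => //.
  split.
  - by move=> i j; exact: (d_transfer7 Hk Hq Hg Hg i j Cg Cg).
  - by move=> i j; exact: (cj_transfer7 Hk Hq i j Hg Hg).
  - exact: (transfer7_mul _ _ _ Hg HPg).
  - exact: (mxtrace_transfer7 Hk Hq Hg).
  move=> y l w Dy hk; apply: kills_transfer7 hk.
  - exact: vanishD.
  - exact: vanishM.
  - exact: vanish_dd.
  - exact: vanish_cj.
  - exact: dd_cstK.
  - exact: cj_cstK.
have [e e0 He] := near_sqdist (nearD (@oopen _ D) Dp).
have dT i j := d_transfer7 Hk Hq Hg Hf i j Cf Cg.
have cT i j := cj_transfer7 Hk Hq i j Hg Hf.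
have [P hP] := closed_matrix He e0 dT cT.
have gT := transfer7_mul ik iq fK Hg HPg.
have fT : fK *m (transfer7 (sfd D) F iF ik iq gK fK)^T = gK.
  by rewrite tr_transfer7; exact: (transfer7_mul ik iq gK Hf HPf).
exists P; apply: filterS (chart_ball cp e0) => s [cs /= hs]; apply/rowP => j.
  have := mul_transfer j (He _ hs) (hP _ hs) gT.
  by rewrite (cmK_entry _ j (He _ hs)) chart_mapK // => -[].
have hPT i j' : (transfer7 (sfd D) F iF ik iq gK fK)^T i j' (chart_map c s) = (P^T i j')%:C.
  have trE (K : Type) a b (A : 'M[K]_(a, b)) r t : A^T r t = A t r by rewrite mxE.
  by rewrite (trE _ _ _ P) -(hP _ hs) (trE _ _ _ (transfer7 _ _ _ _ _ _ _)).
have := mul_transfer j (He _ hs) hPT fT.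
by rewrite (cmK_entry _ j (He _ hs)) chart_mapK // => -[].
Qed.

(** A relation such as f = g P is a linear relation of the single map (f, g), to which [glue_linear]
    applies. *)
Let h p : 'rV[R]_(n.+1 + 6.+1) := row_mx (f p) (g p).

(** Where f = g P, a relation (w1, w2) of the pair is the relation P w1 + w2 of g alone, and g is
    rigid. *)
Lemma pair_loc l p : U p -> exists2 N, nbhs p N & forall w : 'M[R]_(n.+1 + 6.+1, l),
  forall r, N r -> (\forall s \near r, h s *m w = 0) -> forall s, N s -> h s *m w = 0.
Proof.
move=> Up; have [rg [P fP _]] := local_transfer Up.
have [N nN hN] := rigid_loc l rg.
have oI : nbhs p [set r | \forall s \near r, f s = g s *m P] by move: fP => /near_join.
exists (N `&` [set r | \forall s \near r, f s = g s *m P]); first exact: filterI.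
have hw (w : 'M[R]_(n.+1 + 6.+1, l)) s : f s = g s *m P ->
    h s *m w = g s *m (P *m usubmx w + dsubmx w).
  by move=> e; rewrite -[w in LHS]vsubmxK mul_row_col e mulmxDr mulmxA.
move=> w r [Nr fr] hr s [Ns /nbhs_singleton fs].
rewrite hw //; apply: (hN _ r) => //.
by apply: filterS (filterI fr hr) => x [fx hx]; rewrite -hw.
Qed.

Lemma pair_glue l (w : 'M[R]_(n.+1 + 6.+1, l)) p : U p ->
  (\forall s \near p, h s *m w = 0) -> forall s, h s *m w = 0.
Proof.
move=> Up; apply: (glue_linear _ (kappa_dense hg Up) (umbilic_free_conn hg) oU (@pair_loc l)).
move=> i; have cf := conf_surface_cont hf; have cg := conf_surface_cont hg.
case: (splitP i) => j ij.
  have -> : i = lshift 6.+1 j by apply: val_inj.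
  rewrite (_ : (fun p => _) = fun p => f p 0 j); first exact: cf.
  by apply/funext => x; rewrite /h row_mxEl.
have -> : i = rshift n.+1 j by apply: val_inj.
rewrite (_ : (fun p => _) = fun p => g p 0 j); first exact: cg.
by apply/funext => x; rewrite /h row_mxEr.
Qed.

Lemma congruence : exists P : 'M[R]_(6.+1, n.+1),
  [/\ P *m P^T = 1%:M, P^T *m P = 1%:M & forall p, f p = g p *m P].
Proof.
have [p1 Up1] := not_umbilic p0 hg gsub isT.
have [_ [P fP gP]] := local_transfer Up1.
have fgP p : f p = g p *m P.
  have := @pair_glue _ (col_mx 1%:M (- P)) p1 Up1.
  move=> H; apply/eqP; rewrite -subr_eq0; apply/eqP; move: p.
  suff H' : forall s, h s *m col_mx 1%:M (- P) = 0.
    by move=> p; move: (H' p); rewrite mul_row_col mulmx1 mulmxN.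
  apply: H; apply: filterS fP => s fs.
  by rewrite mul_row_col mulmx1 mulmxN fs subrr.
have gfP p : g p = f p *m P^T.
  have := @pair_glue _ (col_mx (- P^T) 1%:M) p1 Up1.
  move=> H; apply/eqP; rewrite -subr_eq0; apply/eqP; move: p.
  suff H' : forall s, h s *m col_mx (- P^T) 1%:M = 0.
    by move=> p; move: (H' p); rewrite mul_row_col mulmx1 mulmxN addrC.
  apply: H; apply: filterS gP => s gs.
  by rewrite mul_row_col mulmx1 mulmxN gs addNr.
(* g P P^T = g and f P^T P = f; substantiality of g and of f turns these into matrix identities. *)
exists P; split => //; apply/eqP; rewrite -subr_eq0; apply/eqP.
  apply: (substantial_linear gsub) => p.
  by rewrite mulmxBr mulmx1 mulmxA -fgP -gfP subrr.
apply: (substantial_linear fsub) => p.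
by rewrite mulmxBr mulmx1 mulmxA -gfP -fgP subrr.
Qed.

End Congruence.

Theorem theorem3 (R : realType) (M : topologicalType)
    (X : riemann_surface R M) (n : nat)
    (f : M -> 'rV[R]_n.+1) (g : M -> 'rV[R]_(6.+1)) :
  compact [set: M] ->
  minimal_surface X f ->
  substantial f ->
  pseudoholomorphic_curve X g ->
  isotropic X g ->
  isometric X f g ->
  exists e : n = 6%N,
    congruent (fun p => castmx (erefl 1%N, congr1 S e) (f p)) g.
Proof.
move=> cM mf sf [_ [p0 _] gJ] ig fg.
have [gsub mg _] := ig 0%N isT.
(* For n = 6 the bound [n.-1./2] is 2, so the second curvature ellipse is covered. *)
have [_ _ gc] := ig 2%N isT.
have gconf c z : atlas X c -> chart_cod c z ->
    induced_metric (in_chart g c) z ex ex = induced_metric (in_chart g c) z ey ey /\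
    induced_metric (in_chart g c) z ex ey = 0.
  move=> ac cz; have [[_ gs] _ _] := mg.
  exact: (@pseudohol_conf _ (chD c) _ (gs c ac) (fun y cy => gJ c y ac cy) z cz).
have hg := minimal_conf mg gconf.
have hf : conf_surface X f.
  by apply: (minimal_conf mf) => c z ac cz; rewrite !(fg c z ac cz); exact: gconf.
have gcirc c z : atlas X c -> chart_cod c z -> regular_at (in_chart g c) z ->
    forall Z, induced_metric (in_chart g c) z Z Z = 1 ->
    is_circle (curvature_ellipse (in_chart g c) 2 z Z).
  by move=> ac cz; exact: (gc 2%N isT c z ac cz).
have [P [PP PP' fP]] := congruence cM hf hg fg sf gsub gJ gcirc p0.
have e : n = 6%N.
  (* The two identity matrices have ranks 7 and n + 1, each bounded by the other size. *)
  have /= r1 : (\rank (P *m P^T) <= n.+1)%N := leq_trans (mxrankM_maxl _ _) (rank_leq_col _).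
  have /= r2 : (\rank (P^T *m P) <= 6.+1)%N := leq_trans (mxrankM_maxl _ _) (rank_leq_col _).
  rewrite PP mxrank1 in r1; rewrite PP' mxrank1 in r2.
  by apply/eqP; rewrite eqn_leq -ltnS r2 -ltnS r1.
by subst n; exists erefl, P.
Qed.
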